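(* Let $q\in(0,1)$, let $d,r\ge1$ be integers, and let $A,B$ be $d\times d$ real matrices with $A\neq0$. Let $f\in C([0,\infty);\mathbb{R}^d)$ and $\Sigma\in C([0,\infty);\mathbb{R}^{d\times r})$. With $\sigma_{ij}=\Sigma_{ij}$, define for each $i\in\{1,\dots,d\}$ $$\sigma_i(t)=\left(\sum_{j=1}^r\sigma_{ij}^2(t)\right)^{1/2},\quad t\ge0.$$ Suppose that the following property holds: for every $\phi\in C_0([0,\infty);\mathbb{R}^d)$, every solution $Z$ (with arbitrary initial value $Z(0)\in\mathbb{R}^d$) of $$Z'(t)=BZ(t)+AZ(qt)+\phi(t),\quad t\ge0,$$ obeys $Z(t)\to0$ as $t\to\infty$. Let $W$ be an $r$-dimensional standard Brownian motion, let $\xi\in\mathbb{R}^d$, and let $X$ be the unique continuous adapted process which obeys $$dX(t)=\{BX(t)+AX(qt)+f(t)\}\,dt+\Sigma(t)\,dW(t),\quad t\ge0;\qquad X(0)=\xi.$$ Then the following are equivalent: (A) $\int_{t-\theta}^t f(s)\,ds\to0$ as $t\to\infty$ for all $\theta>0$, and for each $i\in\{1,\dots,d\}$ and each $\epsilon>0$ $$S_i(\epsilon):=\sum_{n=1}^\infty\sqrt{\int_{n-1}^n\sigma_i^2(s)\,ds}\,\exp\left(-\epsilon\int_{n-1}^n\sigma_i^2(s)\,ds\right)<+\infty;$$ (B) $X(t)\to0$ as $t\to\infty$ almost surely.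
   Context: $C_0([0,\infty);\mathbb{R}^d)$ denotes the continuous functions $\phi:[0,\infty)\to\mathbb{R}^d$ with $\phi(t)\to0$ as $t\to\infty$. The Brownian motion $W$ is defined on a complete probability space and adaptedness is with respect to its natural filtration; $\xi$ is non-random.
   Formalization: In S_i(ε) the exponent is −ε divided by ∫_{n-1}^n σ_i²(s)ds instead of −ε times that integral; the printed form makes the equivalence false (e.g. d=r=1, q=1/2, A=1, B=−2, f=0, Σ(t)=√t satisfies the printed (A) but not (B)). *)

(* Defs.v *)
From HB Require Import structures.
From mathcomp Require Import all_boot all_order all_algebra.
From mathcomp Require Import all_classical all_reals all_analysis.

Set Implicit Arguments.
Unset Strict Implicit.
Unset Printing Implicit Defensive.
Import Order.TTheory GRing.Theory Num.Theory.
Import numFieldNormedType.Exports.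
Local Open Scope classical_set_scope.
Local Open Scope ring_scope.

(* Functions of t >= 0 are total functions on R of which only the restriction
   to [0, +oo[ matters; vectors are column matrices. *)

Definition continuous_on_ge0 (R : realType) (m n : nat) (f : R -> 'M[R]_(m, n)) :=
  {within `[0, +oo[, continuous f}.

Definition C0_fun (R : realType) (d : nat) (phi : R -> 'cV[R]_d) :=
  continuous_on_ge0 phi /\ phi t @[t --> +oo] --> (0 : 'cV[R]_d).

(* Z'(t) = B Z(t) + A Z(q t) + phi(t) for all t >= 0, the derivative at t = 0
   being one-sided. *)
Definition pantograph_solution (R : realType) (d : nat) (q : R)
    (A B : 'M[R]_d) (phi Z : R -> 'cV[R]_d) :=
  (forall t : R, 0 < t ->
     is_derive t 1 Z (B *m Z t + A *m Z (q * t) + phi t)) /\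
  (h^-1 *: (Z h - Z 0) @[h --> 0^'+] -->
     B *m Z 0 + A *m Z (q * 0) + phi 0).

Definition col_integral (R : realType) (d : nat) (a b : R) (F : R -> 'cV[R]_d) :
    'cV[R]_d :=
  \col_i \int[lebesgue_measure]_(s in `[a, b]) F s i 0.

(* Taking some of the B i to be the whole line yields the product rule for
   every subfamily. *)
Definition mutually_independent (R : realType) (dd : measure_display)
    (T : measurableType dd) (P : probability T R) (I : finType)
    (Y : I -> T -> R) :=
  forall B : I -> set R, (forall i, measurable (B i)) ->
    (P (\bigcap_(i in [set: I]) (Y i @^-1` B i)) =
     \prod_(i : I) P (Y i @^-1` B i))%E.

(* The second argument of normal_prob is the standard deviation. The last
   clause makes the increments over successive time intervals and the r
   components jointly independent. *)
Definition standard_brownian_motion (R : realType) (dd : measure_display)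
    (T : measurableType dd) (P : probability T R) (r : nat)
    (W : R -> T -> 'cV[R]_r) :=
  [/\ forall (t : R) (j : 'I_r), 0 <= t ->
        measurable_fun [set: T] (fun w => W t w j 0),
      {ae P, forall w, W 0 w = 0},
      {ae P, forall w, continuous_on_ge0 (W ^~ w)},
      forall (s t : R) (j : 'I_r), 0 <= s -> s < t ->
        forall E : set R, measurable E ->
          P ((fun w => W t w j 0 - W s w j 0) @^-1` E) =
          normal_prob 0 (Num.sqrt (t - s)) E
    & forall u : nat -> R, 0 <= u 0%N -> nondecreasing_seq u ->
        forall n : nat,
          mutually_independent P (fun (kj : 'I_n * 'I_r) (w : T) =>
            W (u kj.1.+1) w kj.2 0 - W (u kj.1) w kj.2 0)].

(* The natural filtration of W, augmented with the P-null sets. *)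
Definition natural_filtration (R : realType) (dd : measure_display)
    (T : measurableType dd) (P : probability T R) (r : nat)
    (W : R -> T -> 'cV[R]_r) (t : R) : set (set T) :=
  <<s [set E | exists (s : R) (j : 'I_r) (B : set R),
         [/\ 0 <= s, s <= t, measurable B
           & E = (fun w => W s w j 0) @^-1` B]]
      `|` [set N | P.-negligible N] >>.

Definition adapted (R : realType) (dd : measure_display)
    (T : measurableType dd) (P : probability T R) (r d : nat)
    (W : R -> T -> 'cV[R]_r) (X : R -> T -> 'cV[R]_d) :=
  forall (t : R) (i : 'I_d) (B : set R), 0 <= t -> measurable B ->
    natural_filtration P W t ((fun w => X t w i 0) @^-1` B).

(* The triple (a, b, c) of a list stands for the step c on ]a, b]; a list
   stands for the sum of its steps. *)
Definition step_fun (R : realType) (h : seq (R * R * R)) (s : R) : R :=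
  \sum_(x <- h) x.2 * \1_(`]x.1.1, x.1.2]) s.

Definition steps_in (R : realType) (t : R) (h : seq (R * R * R)) :=
  forall x, x \in h -> [/\ 0 <= x.1.1, x.1.1 <= x.1.2 & x.1.2 <= t].

Definition step_integral (R : realType) (h : seq (R * R * R)) (w : R -> R) : R :=
  \sum_(x <- h) x.2 * (w x.1.2 - w x.1.1).

(* J is (a version of) the Ito integral over [0, t] of the non-random integrand
   g with respect to the scalar process w: the L^2(P)-limit of the integrals of
   step functions that approximate g in L^2([0, t]). *)
Definition is_ito_integral (R : realType) (dd : measure_display)
    (T : measurableType dd) (P : probability T R)
    (w : R -> T -> R) (g : R -> R) (t : R) (J : T -> R) :=
  measurable_fun [set: T] J /\
  exists h : nat -> seq (R * R * R),
    [/\ forall n, steps_in t (h n),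
        (\int[lebesgue_measure]_(s in `[0%R, t])
            ((g s - step_fun (h n) s) ^+ 2)%:E)%E @[n --> \oo] --> 0%E
      & ('E_P[fun om => ((J om - step_integral (h n) (w ^~ om)) ^+ 2)%R])%E
          @[n --> \oo] --> 0%E].

Definition is_ito_integral_mx (R : realType) (dd : measure_display)
    (T : measurableType dd) (P : probability T R) (d r : nat)
    (W : R -> T -> 'cV[R]_r) (Sigma : R -> 'M[R]_(d, r)) (t : R)
    (J : T -> 'cV[R]_d) :=
  exists K : 'I_d -> 'I_r -> T -> R,
    (forall i j, is_ito_integral P (fun s om => W s om j 0)
                   (fun s => Sigma s i j) t (K i j)) /\
    {ae P, forall om, J om = \col_i \sum_(j < r) K i j om}.

(* X is a continuous adapted process with
   dX(t) = {B X(t) + A X(q t) + f(t)} dt + Sigma(t) dW(t), X(0) = xi. *)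
Definition sde_solution (R : realType) (dd : measure_display)
    (T : measurableType dd) (P : probability T R) (d r : nat) (q : R)
    (A B : 'M[R]_d) (f : R -> 'cV[R]_d) (Sigma : R -> 'M[R]_(d, r))
    (W : R -> T -> 'cV[R]_r) (xi : 'cV[R]_d) (X : R -> T -> 'cV[R]_d) :=
  [/\ adapted P W X,
      {ae P, forall om, continuous_on_ge0 (X ^~ om)},
      {ae P, forall om, X 0 om = xi}
    & exists M : R -> T -> 'cV[R]_d,
        (forall t, 0 <= t -> is_ito_integral_mx P W Sigma t (M t)) /\
        {ae P, forall om, forall t, 0 <= t ->
           X t om = xi + col_integral 0 t (fun s =>
                           B *m X s om + A *m X (q * s) om + f s) + M t om}].

Definition sigma_row (R : realType) (d r : nat) (Sigma : R -> 'M[R]_(d, r))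
    (i : 'I_d) (t : R) : R :=
  Num.sqrt (\sum_(j < r) Sigma t i j ^+ 2).

Definition block_variance (R : realType) (d r : nat)
    (Sigma : R -> 'M[R]_(d, r)) (i : 'I_d) (n : nat) : R :=
  \int[lebesgue_measure]_(s in `[n%:R - 1, n%:R]) (sigma_row Sigma i s ^+ 2).

(* The exponent is -(eps / v_n), v_n being the block variance: the n-th term is
   comparable with a Gaussian tail probability, and the equivalence with almost
   sure convergence fails if eps / v_n is replaced by eps * v_n. If v_n = 0,
   the term is 0. *)
Definition S_series (R : realType) (d r : nat) (Sigma : R -> 'M[R]_(d, r))
    (i : 'I_d) (eps : R) : \bar R :=
  (\sum_(1 <= n <oo)
     (Num.sqrt (block_variance Sigma i n) *
      expR (- (eps / block_variance Sigma i n)))%:E)%E.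

(* Main.v *)
Require Import Defs.
From HB Require Import structures.
From mathcomp Require Import all_boot all_order all_algebra.
From mathcomp Require Import all_classical all_reals all_analysis.
From mathcomp Require Import measurable_realfun ring lra.

Set Implicit Arguments.
Unset Strict Implicit.
Unset Printing Implicit Defensive.
Import Order.TTheory GRing.Theory Num.Theory.
Import numFieldNormedType.Exports.
Local Open Scope classical_set_scope.
Local Open Scope ring_scope.

(** Removing the drift from a solution leaves
    [N(t) = X(t) - xi - \int_0^t (B X(s) + A X(q s)) ds = F(t) + M(t)], where
    [F(t) = \int_0^t f(s) ds] is non-random and [M(t) = \int_0^t Sigma(s) dW(s)].
    Pathwise, if [X] tends to 0, then so do the increments of [N] over windows of
    each fixed length ([increments_of_vanishing]). Conversely, [X] tends to 0 as
    soon as the oscillation of [N] over the window [t - 1, t] does: the moving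
    average [G(t) = \int_(t - 1)^t N(s) ds] is differentiable and close to [N],
    and [X - (N - G)] solves the deterministic equation with a forcing that
    vanishes at infinity, so it tends to 0 by the stability hypothesis
    ([pantograph_stable_of_oscillation]). It remains to relate (A) to the
    increments of [F + M].

    The increments of a component of [M] are centred Gaussian variables whose
    variance is the integral of the square of the corresponding [sigma_i], and
    those over disjoint intervals are independent. All of this is used through
    moment generating functions, which are computed for step integrands from the
    independence of the Brownian increments ([step_integral_mgf]) and pass to the
    limit in the mean square ([wiener_mgf]).

    From (A) to (B): the increments of the continuous function [F] over windows
    of each fixed length tend to 0, hence they do so uniformly in the length, by
    Baire's theorem ([uniform_small_increments]). The oscillation of [M] over the
    n-th unit interval exceeds [eta] with a probability of the order of
    [exp (- (eta^2 / (32 v_n)))], [v_n] being slightly larger than the block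
    variance; this is a chaining argument ([chaining_maximal_bound]). The series
    in (A) makes these probabilities summable, and the Borel-Cantelli lemma
    applies ([noise_oscillation]).

    From (B) to (A): the increments of [F + M] tend to 0 almost surely. A
    centred Gaussian variable is at least [- e], for every [e > 0], and at least
    half its standard deviation, with probability bounded below. Hence the
    increments of [F] and the block variances [v_n] tend to 0
    ([vanishing_gaussian_means], [vanishing_gaussian_variances]), and the block
    increments of [M] tend to 0 almost surely. Were the series of the
    [exp (- (k^2 / v_n))] divergent, the second moment method would show that
    these block increments exceed [k / 4] infinitely often
    ([second_moment_bound], [summable_of_vanishing_blocks]). Every factor
    [sqrt v_n] is at most 1 for large [n], so the series in (A) converges. *)

(** * Primitives of continuous functions and column-valued limits *)

Section calculus.
Context {R : realType}.
Implicit Types g : R -> R.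

(** A path on [0, +oo[ is replaced by its extension that is constant on the
    negative half-line, so that one-sided notions at 0 become two-sided ones. *)
Lemma continuous_ext_ge0 (V : topologicalType) (g : R -> V) :
  {within `[0, +oo[, continuous g} -> continuous (fun t : R => g (Num.max 0 t)).
Proof.
move=> /subspace_continuousP cg t.
have A0 : `[0, +oo[%classic (Num.max 0 t) by rewrite /= in_itv/= andbT le_max lexx.
apply: cvg_trans (cg _ A0).
apply: (@cvg_comp _ _ _ (fun t : R => Num.max 0 t) g) => //.
move=> S /= [e /= e0 H]; rewrite /nbhs/=.
exists e => // s /= ts; apply: H.
  rewrite /ball_/= in ts *; apply: le_lt_trans ts.
  have h1 := ler_norm (t - s); have h2 := ler_norm (s - t).
  rewrite distrC in h2; rewrite ler_norml.
  by case: (lerP 0 t) => ?; case: (lerP 0 s) => ?; apply/andP; split; lra.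
by rewrite /= in_itv/= andbT le_max lexx.
Qed.

(** The base point -2 lies to the left of [t - 1] for all [t >= 0], with room to
    spare: the unit-window averages below are then differentiable at 0 from both
    sides. *)
Definition prim g (t : R) : R := \int[lebesgue_measure]_(s in `[-2, t]) g s.

Lemma continuous_integrable g (a b : R) : continuous g ->
  lebesgue_measure.-integrable `[a, b] (EFin \o g).
Proof.
move=> cg; apply: continuous_compact_integrable; first exact: segment_compact.
exact: continuous_subspaceT.
Qed.

Lemma is_derive_prim g (t : R) : continuous g -> -2 < t ->
  is_derive t 1 (prim g) (g t).
Proof.
move=> cg t2.
have t1 : t < t + 1 by rewrite ltrDl.
have [d e] := @continuous_FTC1_closed R g (-2) t (t + 1) t1
  (continuous_integrable (-2) (t + 1) cg) t2 (cg t).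
by rewrite -e; rewrite derive1E; exact: derivableP.
Qed.

Lemma integral_prim g (a b : R) : continuous g -> -2 <= a -> a <= b ->
  \int[lebesgue_measure]_(s in `[a, b]) g s = prim g b - prim g a.
Proof.
move=> cg a2 ab.
rewrite /prim Rintegral_itvB ?bnd_simp//; last exact: continuous_integrable.
rewrite Rintegral_itv_obnd_cbnd//.
apply: integrableS (continuous_integrable a b cg) => //.
by apply: subset_itvr; rewrite bnd_simp.
Qed.

Lemma continuous_prim g (t : R) : continuous g -> -2 < t ->
  {for t, continuous (prim g)}.
Proof.
move=> cg t2; apply: differentiable_continuous.
by apply/derivable1_diffP; have [] := is_derive_prim cg t2.
Qed.

Lemma norm_integral_le g (a b K : R) : continuous g -> a <= b ->
  (forall s, a <= s <= b -> `|g s| <= K) ->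
  `|\int[lebesgue_measure]_(s in `[a, b]) g s| <= K * (b - a).
Proof.
move=> cg ab gK.
have ig := continuous_integrable a b cg.
apply: (le_trans (le_normr_Rintegral _ ig)) => //.
have -> : K * (b - a) = \int[lebesgue_measure]_(s in `[a, b]) cst K s.
  rewrite Rintegral_cst//= lebesgue_measure_itv/= lte_fin.
  move: ab; rewrite le_eqVlt => /predU1P[->|->]; last by rewrite -EFinB.
  by rewrite ltxx subrr.
apply: le_Rintegral => //.
- exact: integrable_norm.
- by apply: continuous_integrable => ?; exact: cvg_cst.
Qed.

End calculus.

Section col.
Context {R : realType} {d : nat}.
Implicit Types x : R -> 'cV[R]_d.

Lemma cvg_colP (T : Type) (F : set_system T) {FF : Filter F} (x : T -> 'cV[R]_d) (l : 'cV[R]_d) :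
  (x t @[t --> F] --> l) <-> (forall i, x t i 0 @[t --> F] --> l i 0).
Proof.
split.
  move=> h i; apply: (@cvg_comp _ _ _ x (fun M : 'cV[R]_d => M i 0)) h _.
  exact: coord_continuous.
move=> h; apply/cvgrPdist_lt => e e0.
have : \forall t \near F, forall i, `|l i 0 - x t i 0| < e.
  apply: filter_forall => i; move: (h i) => /cvgrPdist_lt; exact.
apply: filterS => t H.
rewrite /Num.norm/= mx_normrE; apply: bigmax_lt => //= [[i j] _] /=.
by rewrite !mxE (ord1 j).
Qed.

Lemma continuous_colP x (s : R) :
  {for s, continuous x} <-> (forall i, {for s, continuous (fun t => x t i 0)}).
Proof. exact: cvg_colP. Qed.

Lemma is_derive_col x (t : R) (D : 'cV[R]_d) :
  (forall i, is_derive t 1 (fun s => x s i 0) (D i 0)) -> is_derive t 1 x D.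
Proof.
move=> h.
have dx : derivable x t 1.
  by apply/derivable_mxP => i j; rewrite (ord1 j); case: (h i).
apply: DeriveDef => //; rewrite derive_mx//; apply/matrixP => i j.
by rewrite mxE (ord1 j); case: (h i).
Qed.

Lemma cvg_mulmx_col (T : Type) (F : set_system T) {FF : Filter F} (A : 'M[R]_d)
  (x : T -> 'cV[R]_d) (l : 'cV[R]_d) :
  x t @[t --> F] --> l -> A *m x t @[t --> F] --> A *m l.
Proof.
move=> /cvg_colP h; apply/cvg_colP => i.
under eq_fun do rewrite mxE; rewrite mxE.
by apply: cvg_big => [|j _]; [exact: add_continuous|apply: cvgM; [exact: cvg_cst|exact: h]].
Qed.

End col.

Section pinfty.
Context {R : realType}.

Lemma cvgy0P {V : normedModType R} (h : R -> V) :
  (h t @[t --> +oo] --> 0) <->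
  (forall e, 0 < e -> exists T : R, forall t, T <= t -> `|h t| <= e).
Proof.
split.
  move=> /cvgr0Pnorm_le + e e0 => /(_ e e0)[T [_ H]].
  by exists (T + 1) => t Tt; apply: H; lra.
move=> H; apply/cvgr0Pnorm_le => e /H[T HT].
by exists T; split; rewrite ?num_real// => t /ltW /HT.
Qed.

Lemma col_norm_le d (x : 'cV[R]_d) (e : R) : 0 <= e ->
  (`|x| <= e) <-> (forall i, `|x i 0| <= e).
Proof.
move=> e0; split.
  move=> xe i; apply: le_trans xe; rewrite /Num.norm/= mx_normrE.
  exact: (le_bigmax _ (fun k : 'I_d * 'I_1 => `|x k.1 k.2|) (i, 0)).
move=> H; rewrite /Num.norm/= mx_normrE; apply: bigmax_le => //= [[i j] _].
by rewrite (ord1 j).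
Qed.

Lemma norm_coord_le d (x : 'cV[R]_d) i : `|x i 0| <= `|x|.
Proof. by have /(_ (lexx _)) := (col_norm_le x (normr_ge0 x)).1. Qed.

End pinfty.

(** * The pantograph equation driven by a path of small oscillation *)

Section pantograph.
Context {R : realType} {d : nat} (q : R) (A B : 'M[R]_d).
Hypotheses (q0 : 0 < q) (q1 : q < 1).

Definition drift (x : R -> 'cV[R]_d) (t : R) : 'cV[R]_d := B *m x t + A *m x (q * t).

Definition col_prim (x : R -> 'cV[R]_d) (t : R) : 'cV[R]_d :=
  \col_i prim (fun s => x s i 0) t.

Lemma continuous_drift x : continuous x -> continuous (drift x).
Proof.
move=> cx t; apply: cvgD; apply: cvg_mulmx_col; first exact: cx.
apply: (@cvg_comp _ _ _ (fun t => q * t) x); last exact: cx.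
by apply: cvgM; [exact: cvg_cst|exact: cvg_id].
Qed.

Lemma is_derive_col_prim x (t : R) : continuous x -> -2 < t ->
  is_derive t 1 (col_prim x) (x t).
Proof.
move=> cx t2; apply: is_derive_col => i.
rewrite (_ : (fun s => _) = prim (fun s => x s i 0)); last first.
  by apply/funext => s; rewrite mxE.
by apply: is_derive_prim => // s; move/continuous_colP: (cx s) => /(_ i).
Qed.

Lemma moving_average_close (N : R -> 'cV[R]_d) (t e : R) : continuous N -> -1 <= t ->
  0 <= e ->
  (forall (s : R) i, t - 1 <= s <= t -> `|N t i 0 - N s i 0| <= e) ->
  `|N t - (col_prim N t - col_prim N (t - 1))| <= e.
Proof.
move=> cN t1 e0 H; apply/col_norm_le => // i; rewrite !mxE.
have cNi : continuous (fun s => N s i 0).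
  by move=> s; move/continuous_colP: (cN s) => /(_ i).
have t1t : t - 1 <= t by lra.
rewrite -integral_prim//; last lra.
have -> : N t i 0 = \int[lebesgue_measure]_(s in `[t - 1, t]) cst (N t i 0) s.
  rewrite Rintegral_cst//= lebesgue_measure_itv/= lte_fin ifT; last lra.
  by rewrite -EFinB/=; ring.
rewrite -RintegralB//; first last.
- exact: continuous_integrable.
- by apply: continuous_integrable => ?; exact: cvg_cst.
have -> : e = e * (t - (t - 1)) by ring.
apply: norm_integral_le => //.
  by move=> s; apply: cvgB; [exact: cvg_cst|exact: cNi].
by move=> s hs; exact: H.
Qed.

Let drift_split (x1 y1 z1 x2 y2 z2 : 'cV[R]_d) : z1 + y1 = x1 -> z2 + y2 = x2 ->
  B *m x1 + A *m x2 = B *m z1 + A *m z2 + (B *m y1 + A *m y2).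
Proof. by move=> <- <-; rewrite !mulmxDr addrACA. Qed.

(** The driving path [N] need not be differentiable, so its moving average
    [G(t)], the integral of [N] over [t - 1, t], is used in its place. The
    remainder [Y = N - G] vanishes at infinity because [N] oscillates little,
    and [Z = x - Y] satisfies [Z' = drift x + N(t) - N(t - 1)], which is the
    pantograph equation for [Z] with the forcing
    [B Y(t) + A Y(q t) + N(t) - N(t - 1)]. That forcing vanishes at infinity, so
    stability gives [Z -> 0]. *)
Lemma pantograph_stable_of_oscillation (x N : R -> 'cV[R]_d) (xi : 'cV[R]_d) :
  (forall phi : R -> 'cV[R]_d, C0_fun phi ->
       forall Z : R -> 'cV[R]_d, pantograph_solution q A B phi Z ->
         Z t @[t --> +oo] --> (0 : 'cV[R]_d)) ->
  continuous x -> continuous N ->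
  (forall t : R, 0 <= t ->
     x t = xi + (col_prim (drift x) t - col_prim (drift x) 0) + N t) ->
  (forall e : R, 0 < e -> exists T : R, forall (t s : R) i, T <= t -> t - 1 <= s <= t ->
     `|N t i 0 - N s i 0| <= e) ->
  x t @[t --> +oo] --> (0 : 'cV[R]_d).
Proof.
move=> stable cx cN xE osc.
pose G t := col_prim N t - col_prim N (t - 1).
pose Z t := xi + (col_prim (drift x) t - col_prim (drift x) 0) + G t.
pose Y t := x t - Z t.
pose phi t := B *m Y t + A *m Y (q * t) + (N t - N (t - 1)).
have dZ (t : R) : -1 < t -> is_derive t 1 Z (drift x t + (N t - N (t - 1))).
  move=> t1.
  have d1 := @is_derive_col_prim (drift x) t (continuous_drift cx) ltac:(lra).
  have d2 := @is_derive_col_prim N t cN ltac:(lra).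
  have d3 : is_derive t 1 (fun t => col_prim N (t - 1)) (N (t - 1)).
    apply: is_derive_col => i.
    rewrite (_ : (fun s => _) = prim (fun s => N s i 0) \o (fun s => s - 1)); last first.
      by apply/funext => s; rewrite mxE.
    rewrite -[X in is_derive _ _ _ X]mulr1; apply: is_derive1_comp.
      apply: is_derive_prim; last lra.
      by move=> s; move/continuous_colP: (cN s) => /(_ i).
    exact: is_derive_shift.
  have d4 := is_deriveB d1 (is_derive_cst (col_prim (drift x) 0) t 1).
  have d5 := is_deriveD (is_derive_cst xi t 1) d4.
  have := is_deriveD d5 (is_deriveB d2 d3).
  by rewrite add0r subr0.
have cZ (t : R) : -1 < t -> {for t, continuous Z}.
  move=> t1; apply: differentiable_continuous.
  by apply/derivable1_diffP; have [] := dZ t t1.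
have YE (t : R) : 0 <= t -> Y t = N t - G t.
  by move=> t0; rewrite /Y /Z xE// opprD addrACA subrr add0r.
have Y0 : Y t @[t --> +oo] --> (0 : 'cV[R]_d).
  apply/cvgy0P => e e0; have [T HT] := osc e e0.
  exists (Num.max T 0) => t; rewrite ge_max => /andP[Tt t0].
  rewrite YE//; apply: moving_average_close => //; [lra|exact: ltW|].
  by move=> s i; exact: HT.
have qy : q * t @[t --> +oo] --> +oo.
  by apply: gt0_cvgMry => //; exact: cvg_id.
have phi0 : C0_fun phi.
  split.
    apply: continuous_in_subspaceT => t; rewrite inE/= in_itv/= andbT => t0.
    have cY (s : R) : 0 <= s -> {for s, continuous Y}.
      move=> s0; apply: cvgB; [exact: cx|apply: cZ; lra].
    apply: cvgD; first apply: cvgD.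
    - by apply: cvg_mulmx_col; exact: cY.
    - apply: cvg_mulmx_col.
      apply: (@cvg_comp _ _ _ (fun t => q * t) Y).
        by apply: cvgM; [exact: cvg_cst|exact: cvg_id].
      by apply: cY; rewrite mulr_ge0// ltW.
    - apply: cvgB; first exact: cN.
      apply: (@cvg_comp _ _ _ (fun t => t - 1) N); last exact: cN.
      by apply: cvgB; [exact: cvg_id|exact: cvg_cst].
  have -> : (0 : 'cV[R]_d) = B *m 0 + A *m 0 + 0 by rewrite !mulmx0 !addr0.
  apply: cvgD; first apply: cvgD.
  - exact: cvg_mulmx_col.
  - by apply: cvg_mulmx_col; apply: cvg_comp qy Y0.
  - apply/cvgy0P => e e0; have [T HT] := osc e e0.
    exists T => t Tt; apply/col_norm_le; first exact: ltW.
    by move=> i; rewrite !mxE; apply: HT => //; lra.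
have Zsol : pantograph_solution q A B phi Z.
  have E (t : R) : drift x t + (N t - N (t - 1)) = B *m Z t + A *m Z (q * t) + phi t.
    rewrite /phi [RHS]addrA; congr (_ + _).
    have YZ (u : R) : Z u + Y u = x u by rewrite /Y addrC subrK.
    exact: (drift_split (YZ t) (YZ (q * t))).
  split=> [t t0|]; first by rewrite -E; apply: dZ; lra.
  rewrite -E; have [/cvg_ex[/= l hl] dE] := dZ 0 ltac:(lra).
  have lE : l = 'D_1 Z 0 by apply/esym/cvg_lim => //; exact: norm_hausdorff.
  move: hl; rewrite lE dE => h.
  apply: cvg_dnbhs_at_right.
  have hE : (fun h : R => h^-1 *: (Z h - Z 0)) = (fun h : R => h^-1 *: (Z (h *: (1 : R) + 0) - Z 0)).
    by apply/funext => u; rewrite addr0 [u *: _]mulr1.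
  rewrite hE. exact: h.
have := stable _ phi0 _ Zsol => Z0.
have xYZ : x = (fun t => Y t + Z t) by apply/funext => t; rewrite subrK.
rewrite xYZ -(addr0 (0 : 'cV[R]_d)). exact: (cvgD Y0 Z0).
Qed.


(** Over a window of fixed length, a vanishing path changes little and the
    integral of its drift is small, so the driving path changes little too. *)
Lemma increments_of_vanishing (x N : R -> 'cV[R]_d) (xi : 'cV[R]_d) (theta : R) :
  continuous x ->
  (forall t : R, 0 <= t ->
     x t = xi + (col_prim (drift x) t - col_prim (drift x) 0) + N t) ->
  x t @[t --> +oo] --> (0 : 'cV[R]_d) -> 0 < theta ->
  N t - N (t - theta) @[t --> +oo] --> (0 : 'cV[R]_d).
Proof.
move=> cx xE x0 th0.
have qy : q * t @[t --> +oo] --> +oo.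
  by apply: gt0_cvgMry => //; exact: cvg_id.
have drift0 : drift x t @[t --> +oo] --> (0 : 'cV[R]_d).
  have -> : (0 : 'cV[R]_d) = B *m 0 + A *m 0 by rewrite !mulmx0 addr0.
  apply: cvgD; first exact: cvg_mulmx_col.
  by apply: cvg_mulmx_col; apply: cvg_comp qy x0.
apply/cvgy0P => e e0.
have [T1 H1] := (cvgy0P _).1 x0 (e / 3) ltac:(lra).
have [T2 H2] := (cvgy0P _).1 drift0 (e / (3 * theta)) ltac:(by rewrite divr_gt0// mulr_gt0).
exists (Num.max 0 (Num.max T1 T2) + theta) => t.
rewrite -lerBrDr !ge_max => /andP[t0 /andP[tT1 tT2]].
have tth : t - theta <= t by lra.
have NE (s : R) : 0 <= s -> N s = x s - (xi + (col_prim (drift x) s - col_prim (drift x) 0)).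
  by move=> s0; rewrite xE// [RHS]addrC addKr.
rewrite NE; last lra.
rewrite NE//.
have cd i : continuous (fun s => drift x s i 0).
  by move=> s; move/continuous_colP: (@continuous_drift x cx s) => /(_ i).
apply/col_norm_le; first exact: ltW.
move=> i; rewrite !mxE.
set a := x t i 0; set b := x (t - theta) i 0.
have -> : forall p1 p0 p2 y : R, a - (y + (p1 - p0)) - (b - (y + (p2 - p0))) = a - b - (p1 - p2).
  by move=> *; ring.
rewrite -integral_prim//; last lra.
have h1 : `|a| <= e / 3 by apply: le_trans (norm_coord_le _ _) _; apply: H1; lra.
have h2 : `|b| <= e / 3 by apply: le_trans (norm_coord_le _ _) _; exact: H1.
have h3 : `|\int[lebesgue_measure]_(s in `[t - theta, t]) drift x s i 0| <= e / 3.
  have -> : e / 3 = e / (3 * theta) * (t - (t - theta)) by field; lra.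
  apply: norm_integral_le => // s /andP[s1 _].
  by apply: le_trans (norm_coord_le _ _) _; apply: H2; lra.
have := ler_normB (a - b) (\int[lebesgue_measure]_(s in `[t - theta, t]) drift x s i 0).
have := ler_normB a b.
lra.
Qed.

End pantograph.

(** * Locally uniform convergence of increments *)

Section uniform_convergence.
Context {R : realType} (F : R -> R).
Hypotheses (cF : continuous F)
  (incr0 : forall theta : R, 0 < theta -> F t - F (t - theta) @[t --> +oo] --> 0).

(** By Baire's theorem, one of the closed sets [E n] below, which cover the line,
    contains a ball; the absolute value turns a statement on positive increments
    into one on the whole line. *)
Let small_window (e : R) : 0 < e -> exists (a b T : R), [/\ 0 <= a, a < b &
  forall u t : R, a <= u <= b -> T <= t -> `|F t - F (t - u)| <= e].
Proof.
move=> e0.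
pose E n := \bigcap_(t in [set t : R | n%:R <= t])
  [set u : R | `|F t - F (t - `|u|)| <= e].
have cE n : closed (E n).
  apply: closed_bigI => t _.
  apply: (@closed_comp _ _ (fun u => `|F t - F (t - `|u|)|) [set x | x <= e]); last exact: closed_le.
  move=> u _; apply: cvg_norm; apply: cvgB; first exact: cvg_cst.
  apply: (@cvg_comp _ _ _ (fun u => t - `|u|) F); last exact: cF.
  by apply: cvgB; [exact: cvg_cst|exact: norm_continuous].
have : ~ (forall n, open (~` E n) /\ dense (~` E n)).
  move=> /(@Baire R R^o) /(_ setT) []; first by exists 0.
    exact: openT.
  move=> u [_ Hu].
  have /cvgy0P/(_ _ e0)[T HT] : F t - F (t - `|u|) @[t --> +oo] --> 0.
    have [->|u0] := eqVneq u 0; last by apply: incr0; rewrite normr_gt0.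
    by rewrite normr0; under eq_fun do rewrite subr0 subrr; exact: cvg_cst.
  have [n nT] : exists n : nat, T <= n%:R.
    exists (Num.bound `|T|); apply: (le_trans (ler_norm T)).
    by apply: ltW; apply: archi_boundP; exact: normr_ge0.
  by apply: (Hu n) => // t /= nt; apply: HT; exact: le_trans nt.
move=> /existsNP[n /not_andP[|nd]].
  by case; apply: closed_openC; exact: cE.
move: nd => /existsNP[V /not_implyP[ [u0 Vu0] /not_implyP[oV VE]]].
have /nbhs_ballP[r /= r0 rV] : nbhs u0 V by exact: open_nbhs_nbhs.
exists (`|u0| + r / 3), (`|u0| + 2 * r / 3), n%:R; split.
- by have := normr_ge0 u0; lra.
- lra.
move=> u t /andP[u1 u2] nt.
have {}VE v : V v -> E n v by move=> Vv; apply: contrapT => Ev; apply: VE; exists v.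
have u00 := normr_ge0 u0.
have : E n ((if 0 <= u0 then 1 else -1) * u).
  apply: VE; apply: rV; rewrite /ball/=; move: u1 u2.
  case: ifP => u0s.
    by rewrite ger0_norm// => ? ?; rewrite mul1r ltr_norml; apply/andP; split; lra.
  have {}u0s : u0 < 0 by rewrite ltNge u0s.
  by rewrite ltr0_norm// => ? ?; rewrite mulN1r ltr_norml; apply/andP; split; lra.
move=> /(_ t nt) /=.
by rewrite normrM (_ : `|if _ then _ else _| = 1) ?mul1r ?(@ger0_norm _ u)//;
  [lra|case: ifP; rewrite ?normrN normr1].
Qed.

(** A uniform bound for the increments of length in [[a, b]] gives one for the
    lengths in [[0, b - a]], by subtracting two increments with the same left
    end point. Every length in [[0, 1]] is then reached by adding a multiple of
    [b - a], and only finitely many multiples occur. *)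
Lemma uniform_small_increments (e : R) : 0 < e ->
  exists T : R, forall t s : R, T <= t -> t - 1 <= s <= t -> `|F t - F s| <= e.
Proof.
move=> e0.
have [a [b [T0 [a0 ab H0]]]] := small_window (e := e / 3) ltac:(lra).
pose del := b - a.
have del0 : 0 < del by rewrite /del; lra.
have step (h t : R) : 0 <= h <= del -> T0 + b <= t -> `|F t - F (t - h)| <= 2 * e / 3.
  move=> /andP[h0 h1] Tt; rewrite /del in h1.
  have h2 := H0 b t ltac:(lra) ltac:(lra).
  have h3 := H0 (b - h) (t - h) ltac:(lra) ltac:(lra).
  rewrite (_ : t - h - (b - h) = t - b) in h3; last by ring.
  have := ler_normB (F t - F (t - b)) (F (t - h) - F (t - b)).
  rewrite (_ : F t - F (t - b) - (F (t - h) - F (t - b)) = F t - F (t - h)); last by ring.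
  lra.
pose K := (Num.truncn del^-1).+1.
(* The multiples k (b - a) with k < K, where K (b - a) > 1, suffice. *)
have : \forall t \near +oo, forall k : 'I_K, `|F t - F (t - k%:R * del)| <= e / 3.
  apply: filter_forall => k.
  have e3 : 0 < e / 3 by lra.
  have : F t - F (t - k%:R * del) @[t --> +oo] --> 0.
    case: k => -[|k] kK /=; last by apply: incr0; rewrite mulr_gt0.
    by rewrite mul0r; under eq_fun do rewrite subr0 subrr; exact: cvg_cst.
  by move=> /cvgr0Pnorm_le/(_ _ e3).
move=> [T1 [_ HT1]].
exists (Num.max (T1 + 1) (T0 + b + 1)) => t s; rewrite ge_max => /andP[t1 t2] /andP[s1 s2].
pose u := t - s.
have u0 : 0 <= u / del by apply: divr_ge0; [rewrite /u; lra|exact: ltW].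
pose k := Num.truncn (u / del).
have /andP[k1 k2] : k%:R <= u / del < k.+1%:R by exact: truncn_itv.
have kK : (k < K)%N.
  rewrite ltnS; apply: le_truncn.
  by rewrite -[leRHS]mul1r ler_wpM2r ?invr_ge0 ?(ltW del0)// /u; lra.
have h1 := HT1 t ltac:(lra) (Ordinal kK).
rewrite /= in h1.
rewrite ler_pdivlMr// in k1.
rewrite ltr_pdivrMr// mulrSr mulrDl mul1r in k2.
have h2 := step (u - k%:R * del) (t - k%:R * del) ltac:(lra) ltac:(rewrite /u in k1; lra).
have := ler_normD (F t - F (t - k%:R * del)) (F (t - k%:R * del) - F (t - k%:R * del - (u - k%:R * del))).
rewrite (_ : t - k%:R * del - (u - k%:R * del) = s) in h2 *; last by rewrite /u; ring.
rewrite (_ : forall x y z : R, x - y + (y - z) = x - z); last by move=> *; ring.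
lra.
Qed.

End uniform_convergence.

(** * Expectations of products of independent variables *)

Section density.
Import HBNNSimple.
Context (R : realType) d2 (T2 : measurableType d2).

Let integral_density_sfun d1 (T1 : measurableType d1)
    (mu : {measure set T1 -> \bar R}) (G : T1 -> R) (Y : T1 -> T2)
    (h : {nnsfun T2 >-> R}) :
  measurable_fun setT G -> (forall w, 0 <= G w) -> measurable_fun setT Y ->
  (\int[mu]_w (G w * h (Y w))%:E =
   \sum_(y \in range h) y%:E * \int[mu]_w (G w * \1_(h @^-1` [set y]) (Y w))%:E)%E.
Proof.
move=> mG G0 mY.
have finr : finite_set (range h) by exact: fimfunP.
have fin_G0 (r : R) w : (0 <= (r * (G w * \1_(h @^-1` [set r]) (Y w)))%:E)%E.
  rewrite mulrCA EFinM; apply: mule_ge0; first by rewrite lee_fin.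
  by rewrite EFinM; exact: nnfun_muleindic_ge0.
under eq_integral => w _.
  have -> : (G w * h (Y w))%:E =
      (\sum_(y \in range h) (y * (G w * \1_(h @^-1` [set y]) (Y w)))%:E)%E.
    rewrite (fimfunE h) fsumEFin// mulr_fsumr.
    by congr EFin; apply: eq_fsbigr => y _; rewrite mulrCA.
  over.
rewrite ge0_integral_fsum//; last first.
  move=> r; apply/measurable_EFinP/measurable_funM => //.
  by apply: measurable_funM => //; apply: measurableT_comp.
apply: eq_fsbigr => r /[!inE] -[y _ hy].
have r0 : 0 <= r by rewrite -hy.
under eq_integral do rewrite EFinM.
rewrite ge0_integralZl ?lee_fin//.
- apply/measurable_EFinP/measurable_funM => //.
  by apply: measurableT_comp.
- by move=> w _; rewrite lee_fin mulr_ge0.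
Qed.

Let integral_density_cvg d1 (T1 : measurableType d1)
    (mu : {measure set T1 -> \bar R}) (G : T1 -> R) (Y : T1 -> T2)
    (h : T2 -> R) (hn : {nnsfun T2 >-> R}^nat) :
  measurable_fun setT G -> (forall w, 0 <= G w) -> measurable_fun setT Y ->
  (forall y, (hn n y)%:E @[n --> \oo] --> (h y)%:E) ->
  (forall y n m, (n <= m)%N -> hn n y <= hn m y) ->
  (\int[mu]_w (G w * hn n (Y w))%:E)%E @[n --> \oo] -->
  (\int[mu]_w (G w * h (Y w))%:E)%E.
Proof.
move=> mG G0 mY hc hm.
have -> : (\int[mu]_w (G w * h (Y w))%:E)%E =
    (\int[mu]_w limn (fun n => (G w * hn n (Y w))%:E))%E.
  apply: eq_integral => w _; apply/esym/cvg_lim => //.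
  under eq_fun do rewrite EFinM; rewrite EFinM.
  by apply: cvgeZl.
apply: cvg_monotone_convergence => //.
- move=> n; apply/measurable_EFinP/measurable_funM => //.
  exact: measurableT_comp.
- by move=> n w _; rewrite lee_fin mulr_ge0.
- by move=> w _ n m nm; rewrite lee_fin ler_wpM2l// hm.
Qed.

(** A change of variables with a density: if integrating [G] over the event
    [Y \in B] amounts to [c] times the law of [Z], for every [B], then the same
    holds with the indicator of [B] replaced by any measurable [h >= 0]. Both
    sides are linear on simple functions and continuous along increasing
    sequences. It serves for products of independent variables ([G] is the
    product of the other factors) and for laws with a density. *)
Lemma integral_density d1 (T1 : measurableType d1) d3 (T3 : measurableType d3)
    (mu : {measure set T1 -> \bar R}) (nu : {measure set T3 -> \bar R})
    (G : T1 -> R) (Y : T1 -> T2) (Z : T3 -> T2) (c : \bar R) (h : T2 -> R) :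
  measurable_fun setT G -> (forall w, 0 <= G w) -> measurable_fun setT Y ->
  measurable_fun setT Z -> c \is a fin_num -> (0 <= c)%E ->
  (forall B, measurable B ->
    (\int[mu]_w (G w * \1_B (Y w))%:E = c * nu (Z @^-1` B))%E) ->
  measurable_fun setT h -> (forall y, 0 <= h y) ->
  (\int[mu]_w (G w * h (Y w))%:E = c * \int[nu]_z (h (Z z))%:E)%E.
Proof.
move=> mG G0 mY mZ cfin c0 cE mh h0.
have mh' : measurable_fun setT (EFin \o h) by exact/measurable_EFinP.
pose hn := nnsfun_approx measurableT mh'.
have hc (y : T2) : (hn n y)%:E @[n --> \oo] --> (h y)%:E.
  by apply: (cvg_nnsfun_approx measurableT mh') => // x _; rewrite lee_fin.
have hm (y : T2) (n m : nat) : (n <= m)%N -> hn n y <= hn m y.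
  by move=> nm; have /lefP := nd_nnsfun_approx measurableT mh' nm; apply.
have L := integral_density_cvg (mu := mu) mG G0 mY hc hm.
have := integral_density_cvg (mu := nu) (G := cst 1) (measurable_cst _)
  (fun _ => ler01) mZ hc hm.
under [X in _ --> X -> _]eq_integral do rewrite mul1r.
move=> /(cvgeZl cfin) Rt.
apply: cvg_unique Rt; first exact: ereal_hausdorff.
apply: cvg_trans L; apply: near_eq_cvg; near=> n.
have mB (y : R) : measurable (hn n @^-1` [set y]).
  by rewrite -[X in measurable X]setTI; exact: measurable_funP.
rewrite !integral_density_sfun//.
have IE (r : R) : (\int[nu]_z (cst 1 z * \1_(hn n @^-1` [set r]) (Z z))%:E =
    nu (Z @^-1` (hn n @^-1` [set r])))%E.
  under eq_integral do rewrite mul1r.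
  rewrite (integral_indic nu measurableT (A := Z @^-1` (hn n @^-1` [set r]))) ?setIT//.
  by rewrite -[X in measurable X]setTI; exact: mZ.
rewrite ge0_mule_fsumr; last first.
  move=> r; rewrite IE; apply: (mulemu_ge0 (fun r => Z @^-1` (hn n @^-1` [set r]))) => r0.
  by rewrite -subset0 => z /= hz; have : 0 <= hn n (Z z) by []; rewrite hz leNgt r0.
by apply: eq_fsbigr => r _; rewrite cE// IE muleCA.
Unshelve. all: by end_near. Qed.

End density.

Section independence.
Context (R : realType) (dd : measure_display) (T : measurableType dd)
  (P : probability T R).

(** The product rule for events is the case of indicators. The indicators are
    replaced by the given functions one index at a time: the set function of the
    replaced coordinate is a constant multiple of its law. *)
Lemma expectation_prod_independent (I : finType) (Y : I -> T -> R) (g : I -> R -> R) :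
  (forall i, measurable_fun setT (Y i)) -> mutually_independent P Y ->
  (forall i, measurable_fun setT (g i)) -> (forall i y, 0 <= g i y) ->
  (forall i, \int[P]_w (g i (Y i w))%:E < +oo)%E ->
  (\int[P]_w (\prod_i g i (Y i w))%:E = \prod_i \int[P]_w (g i (Y i w))%:E)%E.
Proof.
move=> mY iY.
suff main (s : seq I) : (forall i, measurable_fun setT (g i)) -> (forall i y, 0 <= g i y) ->
  (forall i, \int[P]_w (g i (Y i w))%:E < +oo)%E ->
  (forall i, i \notin s -> exists2 B, measurable B & g i = \1_B) ->
  (\int[P]_w (\prod_i g i (Y i w))%:E = \prod_i \int[P]_w (g i (Y i w))%:E)%E.
  by move=> *; apply: (main (enum I)) => // i; rewrite mem_enum.
(* Only the factors outside s are required to be indicators. *)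
elim: s g => [|k s IH] g mg g0 gfin gB.
  have /choice[B HB] : forall i, exists B, measurable B /\ g i = \1_B.
    by move=> i; have [B mB ->] := gB i isT; exists B.
  have mYB i : measurable (Y i @^-1` B i).
    by rewrite -[X in measurable X]setTI; apply: mY => //; case: (HB i).
  transitivity (P (\bigcap_(i in [set: I]) (Y i @^-1` B i))).
    transitivity (\int[P]_w (\1_(\bigcap_(i in [set: I]) (Y i @^-1` B i)) w)%:E)%E.
      apply: eq_integral => w _; congr EFin.
      have [wB|wB] := pselect ((\bigcap_(i in [set: I]) (Y i @^-1` B i)) w).
        rewrite indicE mem_set// big1// => i _.
        by case: (HB i) => _ ->; rewrite indicE mem_set//; exact: wB.
      rewrite indicE memNset//; move: wB => /existsNP[i /not_implyP[_ nB]].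
      by rewrite (bigD1 i)//=; case: (HB i) => _ ->; rewrite indicE memNset// mul0r.
    rewrite integral_indic ?setIT//.
    by apply: fin_bigcap_measurable => //; exact: finite_finset.
  rewrite iY; last by move=> i; case: (HB i).
  apply: eq_bigr => i _; case: (HB i) => _ ->.
  by rewrite (integral_indic P measurableT (A := Y i @^-1` B i)) ?setIT.
rewrite (bigD1 k)//=.
under eq_integral do rewrite (bigD1 k)//= mulrC.
pose c := (\prod_(i | i != k) \int[P]_w (g i (Y i w))%:E)%E.
have gi0 i : (0 <= \int[P]_w (g i (Y i w))%:E)%E.
  by apply: integral_ge0 => w _; rewrite lee_fin.
have gifin i : (\int[P]_w (g i (Y i w))%:E \is a fin_num)%E.
  by rewrite ge0_fin_numE.
rewrite [RHS]muleC -/c.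
apply: (integral_density (G := fun w => \prod_(i | i != k) g i (Y i w))) => //.
- under eq_fun do rewrite -big_filter.
  by apply: measurable_prod => i _; apply: measurableT_comp.
- by move=> w; apply: prodr_ge0.
- by rewrite /c; elim/big_ind: _ => // x y fx fy; exact: fin_numM.
- by apply: prode_ge0.
move=> B mB.
pose g' i := if i == k then \1_B : R -> R else g i.
have E i : i != k -> g' i = g i by rewrite /g' => /negbTE ->.
have Ek : g' k = \1_B by rewrite /g' eqxx.
have intB : (\int[P]_w (\1_B (Y k w))%:E = P (Y k @^-1` B))%E.
  rewrite (integral_indic P measurableT (A := Y k @^-1` B)) ?setIT//.
  by rewrite -[X in measurable X]setTI; exact: mY.
have : (\int[P]_w (\prod_i g' i (Y i w))%:E = \prod_i \int[P]_w (g' i (Y i w))%:E)%E.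
  apply: IH.
  - by move=> i; rewrite /g'; case: ifPn.
  - by move=> i y; rewrite /g'; case: ifPn.
  - move=> i; rewrite /g'; case: ifPn => [/eqP ->|_]; last exact: gfin.
    by rewrite intB (le_lt_trans (probability_le1 _ _)) ?ltry// -[X in measurable X]setTI; exact: mY.
  - move=> i ins; rewrite /g'; case: ifPn => [_|ik]; first by exists B.
    by apply: gB; rewrite inE negb_or ik.
rewrite [RHS](bigD1 k)//= Ek intB.
under eq_integral do rewrite (bigD1 k)//= mulrC Ek.
under eq_integral do under eq_bigr do rewrite E//.
move=> ->; rewrite muleC; congr (_ * _)%E.
by apply: eq_bigr => i ik; rewrite E.
Qed.
End independence.

(** * Step integrals against Brownian motion *)

Section normal_mgf.
Context (R : realType) (dd : measure_display) (T : measurableType dd)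
  (P : probability T R).

(** Completing the square: the exponential tilt of a centred normal density is a
    constant times the density with mean [a * s ^+ 2]. *)
Lemma normal_mgf (Y : T -> R) (s a : R) : 0 < s -> measurable_fun setT Y ->
  (forall E, measurable E -> P (Y @^-1` E) = normal_prob 0 s E) ->
  (\int[P]_w (expR (a * Y w))%:E = (expR (a ^+ 2 * s ^+ 2 / 2))%:E)%E.
Proof.
move=> s0 mY PY.
have mexp : measurable_fun setT (fun y : R => expR (a * y)).
  by apply: measurableT_comp => //; exact: measurable_funM.
have -> : (\int[P]_w (expR (a * Y w))%:E =
    \int[lebesgue_measure]_x (normal_pdf 0 s x * expR (a * x))%:E)%E.
  rewrite -[LHS]mul1e; apply/esym.
  apply: (integral_density (mu := lebesgue_measure) (nu := P) (G := normal_pdf 0 s) (Y := id) (Z := Y) (c := 1%E) (h := fun y => expR (a * y))) => //.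
  - exact: measurable_normal_pdf.
  - by move=> w; exact: normal_pdf_ge0.
  - move=> B mB; rewrite mul1e [RHS](PY _ mB) /normal_prob [RHS]integral_mkcond.
    apply: eq_integral => x _; rewrite patchE indicE.
    by case: ifPn; rewrite ?mulr1 ?mulr0.
under eq_integral.
  move=> x _; rewrite (_ : normal_pdf 0 s x * expR (a * x) =
    expR (a ^+ 2 * s ^+ 2 / 2) * normal_pdf (a * s ^+ 2) s x)%R; last first.
    rewrite !normal_pdfE ?gt_eqF// /normal_fun [RHS]mulrCA -[LHS]mulrA; congr (_ * _).
    rewrite -!expRD; congr expR; field; lra.
  rewrite EFinM; over.
rewrite ge0_integralZl//=.
- by rewrite integral_normal_pdf mule1.
- by apply/measurable_EFinP; exact: measurable_normal_pdf.
- by move=> x _; rewrite lee_fin normal_pdf_ge0.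
Qed.

End normal_mgf.

Section grid.
Context {R : realType} (u : nat -> R) (n : nat).
Hypothesis u_mono : forall i j, (i <= n)%N -> (j <= n)%N -> (u i < u j) = (i < j)%N.

Let u_le i j : (i <= n)%N -> (j <= n)%N -> (u i <= u j) = (i <= j)%N.
Proof. by move=> i_n j_n; rewrite leNgt u_mono// -leqNgt. Qed.

Definition on_grid (h : seq (R * R * R)) := forall x, x \in h ->
  exists i j, [/\ (i <= j)%N, (j <= n)%N, x.1.1 = u i & x.1.2 = u j].

(** On a grid that contains all end points, the value of a step function on the
    k-th cell is its value at the right end point of that cell. *)
Lemma step_integral_grid h (w : R -> R) : on_grid h ->
  step_integral h w = \sum_(k < n) step_fun h (u k.+1) * (w (u k.+1) - w (u k)).
Proof.
move=> hg; rewrite /step_integral /step_fun.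
under [RHS]eq_bigr do rewrite mulr_suml.
rewrite exchange_big/= big_seq [RHS]big_seq; apply: eq_bigr => x /hg[i [j [ij jn -> ->]]].
under [RHS]eq_bigr do rewrite -mulrA.
rewrite -mulr_sumr; congr (_ * _).
rewrite -(telescope_sumr (fun k => w (u k)) ij).
have i_n := leq_trans ij jn.
pose F k := \1_(`]u i, u j]) (u k.+1) * (w (u k.+1) - w (u k)).
rewrite -(big_mkord xpredT F) (@big_cat_nat _ _ _ i 0 n)//=.
rewrite (@big_cat_nat _ _ _ j i n)//=.
have -> : \sum_(0 <= k < i) F k = 0.
  rewrite big_nat big1// => k /andP[_ ki].
  rewrite /F indicE memNset ?mul0r//= in_itv/= => /andP[+ _].
  have kn : (k < n)%N := leq_trans ki i_n.
  by rewrite u_mono// ltnS leqNgt ki.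
have -> : \sum_(j <= k < n) F k = 0.
  rewrite big_nat big1// => k /andP[jk kn].
  rewrite /F indicE memNset ?mul0r//= in_itv/= => /andP[_].
  by rewrite u_le// ltnNge jk.
rewrite add0r addr0; apply: eq_big_nat => k /andP[ik kj].
have kn := leq_trans kj jn.
by rewrite /F indicE mem_set ?mul1r//= in_itv/= u_mono// u_le// ltnS ik.
Qed.

(** The integral of a step function against the path [t |-> (s <= t)] is its value
    at [s], so this is the previous lemma for that path. *)
Lemma step_fun_grid h (s : R) : on_grid h ->
  step_fun h s = \sum_(k < n) step_fun h (u k.+1) * \1_(`]u k, u k.+1]) s.
Proof.
have itvE (a b : R) : a <= b -> \1_(`]a, b]) s = (s <= b)%R%:R - (s <= a)%R%:R :> R.
  move=> ab; rewrite indicE; have [sa|sa] := leP s a.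
    by rewrite memNset ?(le_trans sa ab) ?subrr//= in_itv/= ltNge sa.
  have [sb|sb] := leP s b; first by rewrite mem_set ?subr0//= in_itv/= sa.
  by rewrite memNset ?subrr//= in_itv/= leNgt sb andbF.
move=> hg; have := step_integral_grid (fun t => (s <= t)%R%:R) hg.
rewrite /step_integral => E.
transitivity (\sum_(x <- h) x.2 * ((s <= x.1.2)%R%:R - (s <= x.1.1)%R%:R)).
  rewrite /step_fun big_seq [RHS]big_seq; apply: eq_bigr => x /hg[i [j [ij jn -> ->]]].
  by rewrite itvE// u_le// (leq_trans ij).
rewrite E; apply: eq_bigr => k _; rewrite itvE// u_le//; exact: ltnW.
Qed.

Lemma step_fun_sqr_grid h (s : R) : on_grid h ->
  step_fun h s ^+ 2 = \sum_(k < n) step_fun h (u k.+1) ^+ 2 * \1_(`]u k, u k.+1]) s.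
Proof.
move=> hg; rewrite expr2 {1}(step_fun_grid s hg) mulr_suml.
apply: eq_bigr => k _; rewrite expr2 -!mulrA; congr (_ * _).
have [sk|sk] := boolP (s \in (`]u k, u k.+1]%classic : set R)); last first.
  by rewrite indicE (negbTE sk) mul0r mulr0.
rewrite indicE sk mul1r mulr1 (step_fun_grid s hg) (bigD1 k)//=.
rewrite indicE sk mulr1 big1 ?addr0// => l lk.
rewrite indicE memNset ?mulr0//=.
move: sk; rewrite inE/= !in_itv/= => /andP[s1 s2] /andP[t1 t2].
have [lk'|kl'|/val_inj lk'] := ltngtP l k; last by rewrite lk' eqxx in lk.
- have : u l.+1 <= u k by rewrite u_le//; exact: ltnW.
  by rewrite leNgt (lt_le_trans s1).
- have : u k.+1 <= u l by rewrite u_le//; exact: ltnW.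
  by rewrite leNgt (lt_le_trans t1).
Qed.

Lemma integral_step_fun_sqr h : on_grid h ->
  (\int[lebesgue_measure]_s (step_fun h s ^+ 2)%:E =
   (\sum_(k < n) step_fun h (u k.+1) ^+ 2 * (u k.+1 - u k))%:E)%E.
Proof.
move=> hg; under eq_integral do rewrite (step_fun_sqr_grid _ hg) -sumEFin.
rewrite ge0_integral_sum//=; last 2 first.
- move=> k; apply/measurable_EFinP/measurable_funM => //.
- by move=> k s _; rewrite lee_fin mulr_ge0// sqr_ge0.
rewrite -sumEFin; apply: eq_bigr => k _.
under eq_integral do rewrite EFinM.
rewrite ge0_integralZl ?lee_fin ?sqr_ge0//=; last first.
  by apply/measurable_EFinP/measurable_indic.
rewrite integral_indic// setIT [RHS]EFinM. congr (_ * _)%E.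
by rewrite [LHS]lebesgue_measure_itv/= lte_fin u_mono// ?ltnSn// ltnW.
Qed.

End grid.

Section step_mgf.
Context {R : realType}.

(** Past its last point the grid is constant, so that it is a nondecreasing
    sequence of times, as the independence of increments requires. *)
Lemma exists_grid (ps : seq R) : (forall p, p \in ps -> 0 <= p) ->
  exists (u : nat -> R) (n : nat),
    [/\ nondecreasing_seq u, 0 <= u 0%N,
        forall i j, (i <= n)%N -> (j <= n)%N -> (u i < u j) = (i < j)%N
      & forall p, p \in ps -> exists2 i, (i <= n)%N & p = u i].
Proof.
move=> ps0; pose s := sort <=%O (undup (0 :: ps)).
have ss : sorted <%O s by rewrite lt_sorted_uniq_le sort_uniq undup_uniq/= sort_le_sorted.
have smem p : (p \in s) = (p == 0) || (p \in ps) by rewrite mem_sort mem_undup inE.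
have s0 : (0 < size s)%N by case: s smem {ss} => // /(_ 0); rewrite eqxx.
pose u k := nth (last 0 s) s k.
have su i : (i <= (size s).-1)%N = (i < size s)%N by rewrite -ltnS prednK.
have lastE : last 0 s = u (size s).-1.
  by rewrite /u nth_last; case: (s) s0.
have mono i j : (i < size s)%N -> (j < size s)%N -> (u i < u j) = (i < j)%N.
  by move=> si sj; rewrite /u (lt_sorted_ltn_nth _ ss).
have lemono i j : (i < size s)%N -> (j < size s)%N -> (u i <= u j) = (i <= j)%N.
  by move=> si sj; rewrite /u (lt_sorted_leq_nth _ ss).
exists u, (size s).-1; split.
- move=> i j ij; have [sj|sj] := ltnP j (size s).
    by rewrite lemono// (leq_ltn_trans ij).
  have -> : u j = u (size s).-1 by rewrite -lastE /u nth_default.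
  have [si|si] := ltnP i (size s); first by rewrite lemono ?su// prednK.
  by rewrite -lastE /u nth_default.
- have : u 0%N \in s by rewrite mem_nth.
  by rewrite smem => /orP[/eqP ->|/ps0].
- by move=> i j; rewrite !su; exact: mono.
- move=> p pp; exists (index p s); last by rewrite /u nth_index// smem pp orbT.
  by rewrite su index_mem smem pp orbT.
Qed.

Definition steps_ge0 (h : seq (R * R * R)) :=
  forall x, x \in h -> 0 <= x.1.1 /\ x.1.1 <= x.1.2.

Context (dd : measure_display) (T : measurableType dd) (P : probability T R)
  (r : nat) (W : R -> T -> 'cV[R]_r).
Hypothesis BM : standard_brownian_motion P W.

(** On a common grid the exponential of a sum of step integrals is a product of
    exponentials of independent normal increments. *)
Lemma step_integral_mgf (h : 'I_r -> seq (R * R * R)) :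
  (forall j, steps_ge0 (h j)) ->
  exists2 v, (\sum_j \int[lebesgue_measure]_s (step_fun (h j) s ^+ 2)%:E = v%:E)%E &
  (\int[P]_w (expR (\sum_j step_integral (h j) (fun t => W t w j 0)))%:E =
    (expR (v / 2))%:E)%E.
Proof.
move=> h0; case: BM => mW _ _ normW indepW.
pose ps := flatten [seq [seq x.1.1 | x <- h j] ++ [seq x.1.2 | x <- h j] | j <- enum 'I_r].
have psP j x : x \in h j -> x.1.1 \in ps /\ x.1.2 \in ps.
  move=> xh; split; apply/flatten_mapP; exists j; rewrite ?mem_enum// mem_cat.
    by apply/orP; left; apply/mapP; exists x.
  by apply/orP; right; apply/mapP; exists x.
have [|u [n [und u0 umono ups]]] := @exists_grid ps.
  move=> p /flatten_mapP[j _]; rewrite mem_cat => /orP[] /mapP[x xh ->].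
    by have [] := h0 j x xh.
  by have [x0 x1] := h0 j x xh; exact: le_trans x1.
have ug k : 0 <= u k by apply: (le_trans u0); exact: und.
have hg j : on_grid u n (h j).
  move=> x xh; have [/ups[i1 i1n e1] /ups[i2 i2n e2]] := psP j x xh.
  exists i1, i2; split => //; rewrite leqNgt -umono// -e1 -e2 -leNgt.
  by have [] := h0 j x xh.
pose c (kj : 'I_n * 'I_r) := step_fun (h kj.2) (u kj.1.+1).
pose Y (kj : 'I_n * 'I_r) w := W (u kj.1.+1) w kj.2 0 - W (u kj.1) w kj.2 0.
have mY kj : measurable_fun setT (Y kj) by apply: measurable_funB; exact: mW.
have mgfY kj : (\int[P]_w (expR (c kj * Y kj w))%:E =
    (expR (c kj ^+ 2 * (u kj.1.+1 - u kj.1) / 2))%:E)%E.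
  have uu : u kj.1 < u kj.1.+1 by rewrite umono// ltnW.
  rewrite (normal_mgf (s := Num.sqrt (u kj.1.+1 - u kj.1))) ?sqr_sqrtr//.
  - by rewrite subr_ge0 ltW.
  - by rewrite sqrtr_gt0 subr_gt0.
  - by move=> E mE; exact: normW.
exists (\sum_kj c kj ^+ 2 * (u kj.1.+1 - u kj.1)).
  under eq_bigr do rewrite (integral_step_fun_sqr umono)//.
  by rewrite sumEFin exchange_big pair_big.
transitivity (\int[P]_w (\prod_kj expR (c kj * Y kj w))%:E)%E.
  apply: eq_integral => w _; congr EFin.
  rewrite -expR_sum; congr expR.
  under eq_bigr do rewrite (step_integral_grid umono)//.
  by rewrite exchange_big pair_big.
rewrite (expectation_prod_independent (Y := Y) (g := fun kj y => expR (c kj * y)))//.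
- under eq_bigr do rewrite mgfY.
  by rewrite prodEFin -expR_sum mulr_suml.
- exact: indepW.
- by move=> kj; apply: measurableT_comp => //; exact: measurable_funM.
- by move=> kj; rewrite mgfY ltry.
Qed.

End step_mgf.

(** * Wiener integrals as limits of step integrals *)

Section l2.
Context {R : realType} d (T : measurableType d) (mu : {measure set T -> \bar R}).

(** The free parameter [s] makes this sharp enough to show that norms converge,
    and [s = 1] gives stability under sums. *)
Lemma sqr_add_le (s x y : R) : 0 < s ->
  (x + y) ^+ 2 <= (1 + s) * x ^+ 2 + (1 + s^-1) * y ^+ 2.
Proof.
move=> s0; rewrite -subr_ge0.
have -> : (1 + s) * x ^+ 2 + (1 + s^-1) * y ^+ 2 - (x + y) ^+ 2 = s^-1 * (s * x - y) ^+ 2.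
  by field; rewrite gt_eqF.
by rewrite mulr_ge0 ?sqr_ge0// invr_ge0 ltW.
Qed.

Let measurable_sqr (f : T -> R) : measurable_fun setT f ->
  measurable_fun setT (fun x => (f x ^+ 2)%:E).
Proof. by move=> mf; apply/measurable_EFinP; exact: measurable_funX. Qed.

Lemma integral_sqr_add (f g : T -> R) (s : R) : 0 < s ->
  measurable_fun setT f -> measurable_fun setT g ->
  (\int[mu]_x ((f x + g x) ^+ 2)%:E <=
   (1 + s)%:E * \int[mu]_x (f x ^+ 2)%:E + (1 + s^-1)%:E * \int[mu]_x (g x ^+ 2)%:E)%E.
Proof.
move=> s0 mf mg; have s1 : 0 <= 1 + s by rewrite addr_ge0// ltW.
have s2 : 0 <= 1 + s^-1 by rewrite addr_ge0// invr_ge0 ltW.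
have h0 (h : T -> R) x : [set: T] x -> (0 <= (h x ^+ 2)%:E)%E.
  by rewrite lee_fin sqr_ge0.
rewrite -!ge0_integralZl ?lee_fin//; try (by move=> *; exact: h0); try exact: measurable_sqr.
rewrite -ge0_integralD//.
- apply: ge0_le_integral => //.
  + by move=> x _; rewrite lee_fin sqr_ge0.
  + by apply: measurable_sqr; exact: measurable_funD.
  + by apply: emeasurable_funD; apply: measurable_funeM; exact: measurable_sqr.
  + by move=> x _; rewrite -!EFinM -EFinD lee_fin; exact: sqr_add_le.
- by move=> x _; rewrite -EFinM lee_fin mulr_ge0// sqr_ge0.
- by apply: measurable_funeM; exact: measurable_sqr.
- by move=> x _; rewrite -EFinM lee_fin mulr_ge0// sqr_ge0.
- by apply: measurable_funeM; exact: measurable_sqr.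
Qed.

Lemma integral_sqrZ (f : T -> R) (a : R) : measurable_fun setT f ->
  (\int[mu]_x ((a * f x) ^+ 2)%:E = (a ^+ 2)%:E * \int[mu]_x (f x ^+ 2)%:E)%E.
Proof.
move=> mf; rewrite -ge0_integralZl ?lee_fin ?sqr_ge0//.
- by apply: eq_integral => x _; rewrite exprMn EFinM.
- exact: measurable_sqr.
- by move=> x _; rewrite lee_fin sqr_ge0.
Qed.

End l2.

Section sqnorm.
Context {R : realType} {r : nat}.
Implicit Types g : 'I_r -> R -> R.

Definition sqnorm g : \bar R := (\sum_j \int[lebesgue_measure]_s (g j s ^+ 2)%:E)%E.

Lemma sqnorm_ge0 g : (0 <= sqnorm g)%E.
Proof. by apply: sume_ge0 => j _; apply: integral_ge0 => s _; rewrite lee_fin sqr_ge0. Qed.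

Lemma sqnorm_add g g' (s : R) : 0 < s ->
  (forall j, measurable_fun setT (g j)) -> (forall j, measurable_fun setT (g' j)) ->
  (sqnorm (fun j t => (g j t + g' j t)%R) <= (1 + s)%:E * sqnorm g + (1 + s^-1)%:E * sqnorm g')%E.
Proof.
move=> s0 mg mg'; rewrite /sqnorm !ge0_sume_distrr.
- rewrite -big_split; apply: lee_sum => j _; exact: (integral_sqr_add lebesgue_measure s0 (mg j) (mg' j)).
- by move=> j _; apply: integral_ge0 => t _; rewrite lee_fin sqr_ge0.
- by move=> j _; apply: integral_ge0 => t _; rewrite lee_fin sqr_ge0.
Qed.

Lemma sqnormZ g (a : R) : (forall j, measurable_fun setT (g j)) ->
  (sqnorm (fun j t => (a * g j t)%R) = (a ^+ 2)%:E * sqnorm g)%E.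
Proof.
move=> mg; rewrite /sqnorm ge0_sume_distrr.
  by apply: eq_bigr => j _; exact: (integral_sqrZ lebesgue_measure a (mg j)).
by move=> j _; apply: integral_ge0 => t _; rewrite lee_fin sqr_ge0.
Qed.

End sqnorm.

Section step_lists.
Context {R : realType}.
Implicit Types h : seq (R * R * R).

Definition scale_steps (a : R) h := [seq (x.1, a * x.2) | x <- h].

Lemma step_fun_cat h h' s : step_fun (h ++ h') s = step_fun h s + step_fun h' s.
Proof. by rewrite /step_fun big_cat. Qed.

Lemma step_integral_cat h h' w :
  step_integral (h ++ h') w = step_integral h w + step_integral h' w.
Proof. by rewrite /step_integral big_cat. Qed.

Lemma step_funZ a h s : step_fun (scale_steps a h) s = a * step_fun h s.
Proof.
by rewrite /step_fun big_map mulr_sumr; apply: eq_bigr => x _; rewrite mulrA.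
Qed.

Lemma step_integralZ a h w : step_integral (scale_steps a h) w = a * step_integral h w.
Proof.
by rewrite /step_integral big_map mulr_sumr; apply: eq_bigr => x _; rewrite mulrA.
Qed.

Lemma steps_ge0_cat h h' : steps_ge0 h -> steps_ge0 h' -> steps_ge0 (h ++ h').
Proof. by move=> h0 h0' x; rewrite mem_cat => /orP[/h0|/h0']. Qed.

Lemma steps_ge0Z a h : steps_ge0 h -> steps_ge0 (scale_steps a h).
Proof. by move=> h0 x /mapP[y /h0 ? ->]. Qed.

Lemma measurable_step_fun h : measurable_fun setT (step_fun h).
Proof.
by apply: measurable_sum => x; apply: measurable_funM => //; exact: measurable_indic.
Qed.

End step_lists.

Section wiener_integral.
Context {R : realType} (dd : measure_display) (T : measurableType dd)
  (P : probability T R) (r : nat) (W : R -> T -> 'cV[R]_r).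
Hypothesis BM : standard_brownian_motion P W.

Definition step_itg (h : 'I_r -> seq (R * R * R)) (w : T) : R :=
  \sum_j step_integral (h j) (fun t => W t w j 0).

(** [J] is the integral of the non-random [g] against the [r]-dimensional process
    [W]. A single approximation handles all components, which is what makes the
    class closed under linear combinations. *)
Definition wiener_integral (J : T -> R) (g : 'I_r -> R -> R) :=
  [/\ measurable_fun setT J, forall j, measurable_fun setT (g j),
      (sqnorm g < +oo)%E
    & forall e, 0 < e -> exists h, [/\ forall j, steps_ge0 (h j),
        (sqnorm (fun j s => (g j s - step_fun (h j) s)%R) <= e%:E)%E
      & (\int[P]_w ((J w - step_itg h w) ^+ 2)%:E <= e%:E)%E]].

Lemma measurable_step_itg h : (forall j, steps_ge0 (h j)) ->
  measurable_fun setT (step_itg h).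
Proof.
move=> h0; case: BM => mW _ _ _ _; apply: measurable_sum => j.
elim: (h j) (h0 j) => [_|x s IH xs].
  by under eq_fun do rewrite /step_integral big_nil; exact: measurable_cst.
under eq_fun do rewrite /step_integral big_cons.
have [x0 x1] := xs x (mem_head _ _).
apply: measurable_funD; last by apply: IH => y ys; apply: xs; rewrite inE ys orbT.
by apply: measurable_funM => //; apply: measurable_funB; apply: mW => //; exact: le_trans x1.
Qed.

Lemma wiener_integral_lin J g J' g' (a b : R) :
  wiener_integral J g -> wiener_integral J' g' ->
  wiener_integral (fun w => a * J w + b * J' w) (fun j s => a * g j s + b * g' j s).
Proof.
move=> [mJ mg gfin Jg] [mJ' mg' gfin' Jg'].
have mag j : measurable_fun setT (fun s => a * g j s) by exact: measurable_funM.
have mbg j : measurable_fun setT (fun s => b * g' j s) by exact: measurable_funM.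
split.
- by apply: measurable_funD; exact: measurable_funM.
- by move=> j; exact: measurable_funD.
- apply: (le_lt_trans (sqnorm_add ltr01 mag mbg)).
  rewrite !sqnormZ//.
  by rewrite lte_add_pinfty// !lte_mul_pinfty ?lee_fin ?sqr_ge0 ?mule_ge0 ?sqnorm_ge0 ?lee_fin ?sqr_ge0 ?addr_ge0 ?invr_ge0.
move=> e e0.
pose c := 2 * a ^+ 2 + 2 * b ^+ 2 + 1.
have c0 : 0 < c by rewrite /c; have := sqr_ge0 a; have := sqr_ge0 b; lra.
have ec0 : 0 < e / c by rewrite divr_gt0.
have [h [h0 hg hJ]] := Jg _ ec0.
have [h' [h0' hg' hJ']] := Jg' _ ec0.
have bound (X Y : \bar R) : (X <= (e / c)%:E)%E -> (Y <= (e / c)%:E)%E ->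
  ((1 + 1)%:E * ((a ^+ 2)%:E * X) + (1 + 1^-1)%:E * ((b ^+ 2)%:E * Y) <= e%:E)%E.
  move=> Xe Ye.
  apply: (@le_trans _ _ ((1 + 1)%:E * ((a ^+ 2)%:E * (e / c)%:E) + (1 + 1^-1)%:E * ((b ^+ 2)%:E * (e / c)%:E))%E).
    by apply: leeD; rewrite !lee_wpmul2l// lee_fin ?sqr_ge0 ?addr_ge0 ?invr_ge0.
  rewrite -!EFinM -EFinD lee_fin invr1.
  have -> : (1 + 1) * (a ^+ 2 * (e / c)) + (1 + 1) * (b ^+ 2 * (e / c)) = e - e / c.
    by rewrite /c; field; rewrite -/c gt_eqF.
  by rewrite gerBl ltW.
exists (fun j => scale_steps a (h j) ++ scale_steps b (h' j)); split.
- by move=> j; apply: steps_ge0_cat; exact: steps_ge0Z.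
- apply: le_trans (bound _ _ hg hg'); rewrite -!sqnormZ.
  + rewrite (_ : (fun j s => _) = (fun j s => a * (g j s - step_fun (h j) s) + b * (g' j s - step_fun (h' j) s))).
      apply: sqnorm_add => // j; apply: measurable_funM => //;
        by apply: measurable_funB => //; exact: measurable_step_fun.
    apply/funext => j; apply/funext => s; rewrite step_fun_cat !step_funZ; ring.
  + by move=> j; apply: measurable_funB => //; exact: measurable_step_fun.
  + by move=> j; apply: measurable_funB => //; exact: measurable_step_fun.
- apply: le_trans (bound _ _ hJ hJ'); rewrite -!integral_sqrZ.
  + have E w : a * J w + b * J' w - step_itg (fun j => scale_steps a (h j) ++ scale_steps b (h' j)) w
        = a * (J w - step_itg h w) + b * (J' w - step_itg h' w).
      rewrite /step_itg; under eq_bigr do rewrite step_integral_cat !step_integralZ.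
      rewrite big_split/= -!mulr_sumr; ring.
    rewrite [X in (X <= _)%E](_ : _ = \int[P]_w ((a * (J w - step_itg h w)
        + b * (J' w - step_itg h' w)) ^+ 2)%:E)%E; last first.
      by apply: eq_integral => w _; congr ((_ ^+ 2)%:E); exact: E.
    by apply: integral_sqr_add => //; apply: measurable_funM => //; apply: measurable_funB => //; exact: measurable_step_itg.
  + by apply: measurable_funB => //; exact: measurable_step_itg.
  + by apply: measurable_funB => //; exact: measurable_step_itg.
Qed.

End wiener_integral.

Section exp_ineq.
Context {R : realType}.
Implicit Types a b s K : R.

Lemma expR_diff_le a b : expR b - expR a <= expR b * (b - a).
Proof.
have := expR_ge1Dx (a - b); rewrite -(ler_pM2l (expR_gt0 b)) -expRD.
by rewrite mulrDr mulr1 (addrC b) subrK; lra.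
Qed.

Lemma amgm_weighted s (y z : R) : 0 < s -> y * z <= z ^+ 2 / s + s * y ^+ 2.
Proof.
move=> s0; rewrite -subr_ge0.
have -> : z ^+ 2 / s + s * y ^+ 2 - y * z = ((z - s * y / 2) ^+ 2 + 3 / 4 * (s * y) ^+ 2) / s.
  by field; rewrite gt_eqF.
by rewrite divr_ge0 ?(ltW s0)// addr_ge0 ?sqr_ge0// mulr_ge0 ?sqr_ge0//; lra.
Qed.

(** These two bounds compare exponentials of [a] and [b] with an error controlled
    by the square of [a - b]. Here the error also involves the exponential of
    [2 * b]; in the next lemma a truncation level takes its place. *)
Lemma expR_le_perturb a b s : 0 < s ->
  expR b <= expR a + ((a - b) ^+ 2 / s + s * expR (2 * b)).
Proof.
move=> s0; have := expR_diff_le a b; have := amgm_weighted (expR b) (b - a) s0.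
have -> : expR (2 * b) = expR b ^+ 2 by rewrite mulrDl !mul1r expRD expr2.
by rewrite -sqrrN opprB; lra.
Qed.

Lemma expR_min_le_perturb a b s K : 0 < s ->
  expR (Num.min a K) <= expR b + expR K * ((a - b) ^+ 2 / s + s).
Proof.
move=> s0; set m := Num.min a K.
have ma : m <= a by rewrite ge_min lexx.
have mK : expR m <= expR K by rewrite ler_expR ge_min lexx orbT.
have := expR_gt0 K; have := expR_gt0 m => m0 K0.
have q0 : 0 <= (a - b) ^+ 2 / s + s by rewrite addr_ge0 ?divr_ge0 ?sqr_ge0 ?(ltW s0).
have [mb|bm] := leP m b.
  have : expR m <= expR b by rewrite ler_expR.
  have := mulr_ge0 (ltW K0) q0; lra.
have := expR_diff_le b m; have := amgm_weighted 1 (a - b) s0.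
rewrite mul1r expr1n mulr1 => h1 h2.
have h3 : expR m * (m - b) <= expR K * ((a - b) ^+ 2 / s + s).
  apply: ler_pM => //; lra.
lra.
Qed.

Lemma le_limit_at0 (F : R -> R) (a : R) : (forall s, 0 < s -> a <= F s) ->
  {for 0, continuous F} -> a <= F 0.
Proof.
move=> aF cF.
have : F s @[s --> 0^'+] --> F 0 by apply: cvg_within_filter; exact: cF.
move=> /cvgr_to_ge; apply.
by near=> s; apply: aF; near: s; exact: nbhs_right_gt.
Unshelve. all: by end_near. Qed.

Lemma le_limit_at0_ereal (F : R -> R) (A : \bar R) :
  (0 <= A)%E -> (forall s, 0 < s -> (A <= (F s)%:E)%E) ->
  {for 0, continuous F} -> (A <= (F 0)%:E)%E.
Proof.
move=> A0 AF cF; have := AF 1 ltr01.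
case: A A0 AF => [a| |]//= _ AF _; rewrite lee_fin; apply: le_limit_at0 => //.
Qed.

Lemma continuous_expR_comp (f : R -> R) x : {for x, continuous f} ->
  {for x, continuous (fun s : R => expR (f s))}.
Proof. by move=> cf; apply: continuous_comp cf _; exact: continuous_expR. Qed.

End exp_ineq.

Lemma integral_cst1 {R : realType} d (T : measurableType d) (P : probability T R) :
  (\int[P]_w (cst (1 : R) w)%:E = 1)%E.
Proof. by rewrite [LHS](integral_cst P measurableT 1%E) mul1e; exact: probability_setT. Qed.

(** Integrated form of the perturbation bounds above. *)
Lemma integral_le3 {R : realType} d (T : measurableType d) (mu : {measure set T -> \bar R})
    (f f1 f2 f3 : T -> R) (a b : R) :
  0 <= a -> 0 <= b ->
  measurable_fun setT f -> measurable_fun setT f1 ->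
  measurable_fun setT f2 -> measurable_fun setT f3 ->
  (forall w, 0 <= f w) -> (forall w, 0 <= f1 w) -> (forall w, 0 <= f2 w) -> (forall w, 0 <= f3 w) ->
  (forall w, f w <= f1 w + (a * f2 w + b * f3 w)) ->
  (\int[mu]_w (f w)%:E <= \int[mu]_w (f1 w)%:E +
    (a%:E * \int[mu]_w (f2 w)%:E + b%:E * \int[mu]_w (f3 w)%:E))%E.
Proof.
move=> a0 b0 mf mf1 mf2 mf3 f0 f10 f20 f30 H.
have mE (g : T -> R) : measurable_fun setT g -> measurable_fun setT (fun w => (g w)%:E).
  by move=> ?; exact/measurable_EFinP.
have nE (g : T -> R) : (forall w, 0 <= g w) -> forall w, [set: T] w -> (0 <= (g w)%:E)%E.
  by move=> ? *; rewrite lee_fin.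
rewrite -!ge0_integralZl ?lee_fin//; try exact: mE; try exact: nE.
have m2 : measurable_fun setT (fun w => (a%:E * (f2 w)%:E)%E) by apply: measurable_funeM; exact: mE.
have m3 : measurable_fun setT (fun w => (b%:E * (f3 w)%:E)%E) by apply: measurable_funeM; exact: mE.
have n2 w : [set: T] w -> (0 <= a%:E * (f2 w)%:E)%E by rewrite -EFinM lee_fin mulr_ge0.
have n3 w : [set: T] w -> (0 <= b%:E * (f3 w)%:E)%E by rewrite -EFinM lee_fin mulr_ge0.
rewrite -ge0_integralD// -ge0_integralD//.
- apply: ge0_le_integral => //; try exact: mE; try exact: nE.
  + by apply: emeasurable_funD; [exact: mE|exact: emeasurable_funD].
  + by move=> w _; rewrite -!EFinM -!EFinD lee_fin.
- exact: nE.
- exact: mE.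
- by move=> w _; apply: adde_ge0; [exact: n2|exact: n3].
- exact: emeasurable_funD.
Qed.


Section wiener_mgf.
Context {R : realType} (dd : measure_display) (T : measurableType dd)
  (P : probability T R) (r : nat) (W : R -> T -> 'cV[R]_r).
Hypothesis BM : standard_brownian_motion P W.

Lemma step_itg_mgf (h : 'I_r -> seq (R * R * R)) : (forall j, steps_ge0 (h j)) ->
  exists v, sqnorm (fun j => step_fun (h j)) = v%:E /\
    forall a : R, (\int[P]_w (expR (a * step_itg W h w))%:E = (expR (a ^+ 2 * v / 2))%:E)%E.
Proof.
move=> h0; have [v hv _] := step_integral_mgf BM h0.
exists v; split => // a.
have [j|v' hv'] := @step_integral_mgf _ _ _ _ _ _ BM (fun j => scale_steps a (h j)).
  exact: steps_ge0Z.
have -> : v' = a ^+ 2 * v.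
  apply: EFin_inj; rewrite -hv' EFinM -hv -sqnormZ; last by move=> j; exact: measurable_step_fun.
  apply: eq_bigr => j _; apply: eq_integral => s _; by rewrite step_funZ.
move=> <-; apply: eq_integral => w _; rewrite /step_itg mulr_sumr.
by congr ((expR _)%:E); apply: eq_bigr => j _; rewrite step_integralZ.
Qed.

(** The variance of the step integral is close to that of the limit, and its
    exponential moments are known exactly. *)
Lemma wiener_approx J g v d : wiener_integral P W J g -> sqnorm g = v%:E -> 0 < d ->
  exists h v', [/\ forall j, steps_ge0 (h j), `|v' - v| <= d,
     forall a : R, (\int[P]_w (expR (a * step_itg W h w))%:E = (expR (a ^+ 2 * v' / 2))%:E)%E & (\int[P]_w ((J w - step_itg W h w) ^+ 2)%:E <= d%:E)%E].
Proof.
move=> [mJ mg gfin Jg] gv d0.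
have v0 : 0 <= v by rewrite -lee_fin -gv sqnorm_ge0.
pose V := 2 * v + 2.
pose s := d / (2 * (V + 1)).
have V0 : 0 < V by rewrite /V; lra.
have s0 : 0 < s by rewrite /s divr_gt0// mulr_gt0//; lra.
have s1 : 0 < 1 + s^-1 by rewrite addr_gt0// invr_gt0.
pose e := Num.min 1 (Num.min d (d / 2 / (1 + s^-1))).
have e0 : 0 < e by rewrite /e !lt_min ltr01 d0 !divr_gt0.
have [h [h0 hg hJ]] := Jg e e0.
have [v' [hv' mgf]] := step_itg_mgf h0.
have mh j : measurable_fun setT (step_fun (h j)) by exact: measurable_step_fun.
have e1 : e <= 1 by rewrite /e ge_min lexx.
have e2 : e <= d by rewrite /e !ge_min lexx orbT.
have e3 : (1 + s^-1) * e <= d / 2.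
  by rewrite mulrC -ler_pdivlMr// /e !ge_min lexx !orbT.
have up (t : R) : 0 < t -> v' <= (1 + t) * v + (1 + t^-1) * e.
  move=> t0; rewrite -lee_fin -hv' EFinD !EFinM -gv.
  rewrite (_ : (fun j => _) = (fun j s => g j s + -1 * (g j s - step_fun (h j) s))); last first.
    by apply/funext => j; apply/funext => u; ring.
  apply: le_trans (sqnorm_add t0 mg _) _.
    by move=> j; apply: measurable_funM => //; exact: measurable_funB.
  rewrite leeD2l// sqnormZ; last by move=> j; exact: measurable_funB.
  rewrite sqrrN expr1n mul1e lee_wpmul2l// lee_fin; have := t0; rewrite -invr_gt0; lra.
have lo : v <= (1 + s) * v' + (1 + s^-1) * e.
  rewrite -lee_fin -gv EFinD !EFinM -hv'.
  rewrite (_ : g = (fun j s => step_fun (h j) s + (g j s - step_fun (h j) s))); last first.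
    by apply/funext => j; apply/funext => u; ring.
  apply: le_trans (sqnorm_add s0 mh _) _; first by move=> j; exact: measurable_funB.
  by rewrite leeD2l// lee_wpmul2l// lee_fin ltW.
exists h, v'; split => //; last by apply: le_trans hJ _; rewrite lee_fin.
have := up s s0; have := up 1 ltr01.
clear hg hJ hv' up gfin Jg gv.
rewrite invr1 => u1 u2.
have sV : s * (V + 1) = d / 2 by rewrite /s; field; lra.
have v'V : v' <= V by rewrite /V; lra.
have : s * v <= s * (V + 1) by rewrite ler_wpM2l// ?(ltW s0)// /V; lra.
have : s * v' <= s * (V + 1) by rewrite ler_wpM2l// ?(ltW s0)//; lra.
move=> h1 h2; rewrite ler_norml; apply/andP; split; lra.
Qed.

(** Both inequalities compare [J] with a step integral at distance at most [s] in
    the mean square and let [s] tend to 0. The upper bound is first shown for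
    [J] truncated from above, whose exponential is bounded, and passes to [J] by
    monotone convergence. *)
Lemma wiener_mgf J g v : wiener_integral P W J g -> sqnorm g = v%:E ->
  (\int[P]_w (expR (J w))%:E = (expR (v / 2))%:E)%E.
Proof.
move=> WJ gv; have [mJ _ _ _] := WJ.
have mexpJ : measurable_fun setT (fun w => (expR (J w))%:E).
  by apply/measurable_EFinP; exact: measurableT_comp.
have mmin (K : R) : measurable_fun setT (fun w => (expR (Num.min (J w) K))%:E).
  by apply/measurable_EFinP; apply: measurableT_comp => //; exact: measurable_minr.
have upK (K : R) : (\int[P]_w (expR (Num.min (J w) K))%:E <= (expR (v / 2))%:E)%E.
  (* The bound given by a step integral at squared distance s ^+ 2. *)
  pose F s := expR ((v + s ^+ 2) / 2) + (expR K * s + expR K * s).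
  have -> : expR (v / 2) = F 0 by rewrite /F expr0n/= addr0 mulr0 !addr0.
  apply: le_limit_at0_ereal.
  - by apply: integral_ge0 => w _; rewrite lee_fin expR_ge0.
  - move=> s s0.
    have [h [v' [h0 vv' mgf hJ]]] := wiener_approx WJ gv (exprn_gt0 2 s0).
    have mI := measurable_step_itg BM h0.
    have := @integral_le3 R _ T P (fun w => expR (Num.min (J w) K))
      (fun w => expR (1 * step_itg W h w)) (fun w => (J w - step_itg W h w) ^+ 2)
      (cst 1) (expR K / s) (expR K * s).
    rewrite (mgf 1) integral_cst1 => H.
    apply: le_trans; first apply: H => //.
    + by rewrite divr_ge0 ?expR_ge0// ltW.
    + by rewrite mulr_ge0 ?expR_ge0// ltW.
    + by apply: measurableT_comp => //; exact: measurable_minr.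
    + by apply: measurableT_comp => //; exact: measurable_funM.
    + by apply: measurable_funX; exact: measurable_funB.
    + by move=> w; exact: sqr_ge0.
    + move=> w; rewrite mul1r mulr1.
      apply: le_trans (expR_min_le_perturb _ (step_itg W h w) _ s0) _.
      by rewrite mulrDr mulrA mulrAC.
    rewrite !EFinD; apply: leeD.
      by rewrite lee_fin ler_expR expr1n mul1r ler_pM2r//; move: vv'; rewrite ler_norml => /andP[]; lra.
    rewrite mule1 leeD2r//.
    apply: (@le_trans _ _ ((expR K / s)%:E * (s ^+ 2)%:E)%E).
      by rewrite lee_wpmul2l// lee_fin divr_ge0 ?expR_ge0// ltW.
    by rewrite -EFinM lee_fin expr2 mulrA divfK// gt_eqF.
  - have c1 : {for (0 : R), continuous (fun s : R => expR ((v + s ^+ 2) / 2))}.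
      apply: (continuous_expR_comp (f := fun s : R => (v + s ^+ 2) / 2)).
      apply: cvgM; last exact: cvg_cst.
      by apply: cvgD; [exact: cvg_cst|exact: sqr_continuous].
    apply: cvgD; first exact: c1.
    by apply: cvgD; (apply: cvgM; [exact: cvg_cst|exact: cvg_id]).
have up : (\int[P]_w (expR (J w))%:E <= (expR (v / 2))%:E)%E.
  have -> : (\int[P]_w (expR (J w))%:E)%E =
      (\int[P]_w limn (fun n => (expR (Num.min (J w) n%:R))%:E))%E.
    apply: eq_integral => w _; apply/esym/cvg_lim => //.
    apply: cvg_near_cst; near=> n; rewrite min_l//.
    by near: n; exact: nbhs_infty_ger.
  rewrite monotone_convergence//.
  - apply: lime_le; last by near=> n; exact: upK.
    apply: ereal_nondecreasing_is_cvgn => n m nm; apply: ge0_le_integral => //.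
    move=> w _; rewrite lee_fin ler_expR le_min ge_min lexx/= ge_min.
      by rewrite ler_nat nm orbT.
  - move=> w _ n m nm; rewrite lee_fin ler_expR le_min ge_min lexx/= ge_min.
    by rewrite ler_nat nm orbT.
apply/eqP; rewrite eq_le up/=.
have : (\int[P]_w (expR (J w))%:E \is a fin_num)%E.
  rewrite ge0_fin_numE; first exact: le_lt_trans up (ltry _).
  by apply: integral_ge0 => w _; rewrite lee_fin expR_ge0.
move=> /fineK; set A := fine _ => AE; rewrite -AE lee_fin.
(* The last difference stands for the exponential moment of a step integral
   whose variance may be as small as v - s ^+ 2. *)
pose F s := A + (s + s * expR (2 * (v + s ^+ 2))) + (expR (v / 2) - expR ((v - s ^+ 2) / 2)).
have -> : A = F 0 by rewrite /F expr0n/= subr0 subrr mul0r !addr0.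
apply: le_limit_at0.
- move=> s s0.
  have [h [v' [h0 vv' mgf hJ]]] := wiener_approx WJ gv (exprn_gt0 2 s0).
  have mI := measurable_step_itg BM h0.
  have := @integral_le3 R _ T P (fun w => expR (1 * step_itg W h w)) (fun w => expR (J w))
    (fun w => (J w - step_itg W h w) ^+ 2)
    (fun w => expR (2 * step_itg W h w)) (s^-1) s.
  rewrite (mgf 1) (mgf 2) -AE => H.
  have : ((expR (1 ^+ 2 * v' / 2))%:E <= A%:E + (s%:E + (s * expR (2 * v'))%:E))%E.
    apply: le_trans; first apply: H => //.
    + by rewrite invr_ge0 ltW.
    + exact: ltW.
    + by apply: measurableT_comp => //; exact: measurable_funM.
    + exact: measurableT_comp.
    + by apply: measurable_funX; exact: measurable_funB.
    + by apply: measurableT_comp => //; exact: measurable_funM.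
    + by move=> w; exact: sqr_ge0.
    + move=> w; rewrite mul1r mulrC.
      by have := expR_le_perturb (J w) (step_itg W h w) s0; rewrite mulrC.
    rewrite leeD2l// leeD//.
      apply: (@le_trans _ _ ((s^-1)%:E * (s ^+ 2)%:E)%E).
        by rewrite lee_wpmul2l// lee_fin invr_ge0 ltW.
      by rewrite -EFinM lee_fin expr2 mulrA mulVf ?mul1r// gt_eqF.
    rewrite -EFinM lee_fin ler_pM2l// ler_expR; lra.
  rewrite -!EFinD lee_fin expr1n mul1r => h1.
  have h2 : expR ((v - s ^+ 2) / 2) <= expR (v' / 2).
    by rewrite ler_expR ler_pM2r//; move: vv'; rewrite ler_norml => /andP[]; lra.
  have h3 : s * expR (2 * v') <= s * expR (2 * (v + s ^+ 2)).
    by rewrite ler_pM2l// ler_expR; move: vv'; rewrite ler_norml => /andP[]; lra.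
  rewrite /F; lra.
- have c1 : {for (0 : R), continuous (fun s : R => expR (2 * (v + s ^+ 2)))}.
    apply: (continuous_expR_comp (f := fun s : R => 2 * (v + s ^+ 2))).
    apply: cvgM; first exact: cvg_cst.
    by apply: cvgD; [exact: cvg_cst|exact: sqr_continuous].
  have c2 : {for (0 : R), continuous (fun s : R => expR ((v - s ^+ 2) / 2))}.
    apply: (continuous_expR_comp (f := fun s : R => (v - s ^+ 2) / 2)).
    apply: cvgM; last exact: cvg_cst.
    by apply: cvgB; [exact: cvg_cst|exact: sqr_continuous].
  apply: cvgD; last by apply: cvgB; [exact: cvg_cst|exact: c2].
  apply: cvgD; first exact: cvg_cst.
  apply: cvgD; first exact: cvg_id.
  by apply: cvgM; [exact: cvg_id|exact: c1].
Unshelve. all: by end_near. Qed.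

End wiener_mgf.

(** * Tails of Gaussian variables *)

Section gaussian_tails.
Context {R : realType} (dd : measure_display) (T : measurableType dd)
  (P : probability T R).

(** The law of [J] is N(0, v), expressed by its moment generating function, the
    only feature of it that the estimates below use. *)
Definition gaussian_mgf (J : T -> R) (v : R) := measurable_fun setT J /\
  forall a : R, (\int[P]_w (expR (a * J w))%:E = (expR (a ^+ 2 * v / 2))%:E)%E.

Lemma markov_prob (E : set T) (f : T -> R) (c : R) : measurable E ->
  measurable_fun setT f -> (forall w, 0 <= f w) -> 0 <= c -> (forall w, E w -> c <= f w) ->
  (c%:E * P E <= \int[P]_w (f w)%:E)%E.
Proof.
move=> mE mf f0 c0 cf.
have -> : P E = (\int[P]_w (\1_E w)%:E)%E by rewrite integral_indic// setIT.
have m1 : measurable_fun setT (fun w => (\1_E w : R)%:E).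
  by apply/measurable_EFinP; exact: measurable_indic.
rewrite -ge0_integralZl//.
apply: ge0_le_integral => //.
- by move=> w _; rewrite -EFinM lee_fin mulr_ge0.
- by exact: measurable_funeM.
- exact/measurable_EFinP.
- move=> w _; rewrite -EFinM lee_fin indicE; have [wE|wE] := boolP (w \in E).
    by rewrite mulr1 cf//; rewrite inE in wE.
  by rewrite mulr0.
Qed.

Lemma gaussian_mgfN J v : gaussian_mgf J v -> gaussian_mgf (fun w => - J w) v.
Proof.
move=> [mJ mgf]; split; first exact: measurable_funN.
by move=> a; under eq_integral do rewrite mulrN -mulNr; rewrite mgf sqrrN.
Qed.

Lemma measurable_ge_set (f : T -> R) (c : R) : measurable_fun setT f ->
  measurable [set w | c <= f w].
Proof.
move=> mf; have := mf measurableT `[c, +oo[%classic (measurable_itv _).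
rewrite setTI; congr measurable; apply/seteqP; split=> w /=; by rewrite in_itv/= andbT.
Qed.

(** Chernoff's bound with the exponent [x / u]. *)
Lemma gaussian_tail J v u x : gaussian_mgf J v -> v <= u -> 0 < u -> 0 <= x ->
  (P [set w | (x <= J w)%R] <= (expR (- (x ^+ 2 / (2 * u))))%:E)%E.
Proof.
move=> [mJ mgf] vu u0 x0.
have mE := measurable_ge_set x mJ.
have xu0 : 0 <= x / u by rewrite divr_ge0// ltW.
have H : ((expR (x / u * x))%:E * P [set w | (x <= J w)%R] <=
    \int[P]_w (expR (x / u * J w))%:E)%E.
  apply: markov_prob => //.
    by apply: measurableT_comp => //; exact: measurable_funM.
  by move=> w /= xJ; rewrite ler_expR ler_wpM2l.
have : P [set w | x <= J w] \is a fin_num by exact: fin_num_measure.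
move=> /fineK PE; move: H; rewrite mgf -PE.
set p := fine _; rewrite -EFinM !lee_fin => H.
have vu' : (x / u) ^+ 2 * v / 2 <= (x / u) ^+ 2 * u / 2.
  by rewrite ler_pM2r// ler_wpM2l// sqr_ge0.
have -> : - (x ^+ 2 / (2 * u)) = (x / u) ^+ 2 * u / 2 - x / u * x.
  by field; rewrite gt_eqF.
rewrite expRD expRN ler_pdivlMr ?expR_gt0// mulrC.
by apply: le_trans H _; rewrite ler_expR.
Qed.

Lemma gaussian_tail_norm J v u x : gaussian_mgf J v -> v <= u -> 0 < u -> 0 <= x ->
  (P [set w | (x <= `|J w|)%R] <= (2 * expR (- (x ^+ 2 / (2 * u))))%:E)%E.
Proof.
move=> gJ vu u0 x0; have [mJ _] := gJ; have [mJ' _] := gaussian_mgfN gJ.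
have -> : [set w | x <= `|J w|] = [set w | x <= J w] `|` [set w | x <= - J w].
  apply/seteqP; split=> w /=.
    by have [J0|J0] := leP 0 (J w); [rewrite ger0_norm//; left|rewrite ltr0_norm//; right].
  have := ler_norm (J w); have := ler_norm (- J w); rewrite normrN.
  by move=> h1 h2 [] h3; lra.
apply: (le_trans (measureU2 _ _ _)); [exact: measurable_ge_set..|].
rewrite mulrDl mul1r EFinD; apply: leeD.
  exact: (gaussian_tail gJ).
exact: (gaussian_tail (gaussian_mgfN gJ)).
Qed.

(** The Paley-Zygmund inequality for [Y = expR (a * J)]: [Y] exceeds half its mean
    [m] with probability at least [m ^+ 2 / (4 E[Y^2])]. It follows from
    integrating the pointwise bound [2 s Y <= 1_E + s^2 Y^2 + s m] with
    [s = m / (2 E[Y^2])]. On the complement of [E], [Y <= m / expR 1 <= m / 2]. *)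
Lemma gaussian_anticoncentration J v a : gaussian_mgf J v -> 0 < a ->
  ((expR (- (a ^+ 2 * v)) / 4)%:E <= P [set w | (a * v / 2 - a^-1 <= J w)%R])%E.
Proof.
move=> [mJ mgf] a0.
set E := [set w | _ <= J w].
have mE : measurable E by exact: measurable_ge_set.
pose m := expR (a ^+ 2 * v / 2).
pose m2 := expR ((2 * a) ^+ 2 * v / 2).
have m0 : 0 < m by exact: expR_gt0.
have m20 : 0 < m2 by exact: expR_gt0.
pose s := m / (2 * m2).
have s0 : 0 < s by rewrite divr_gt0// mulr_gt0.
have := @integral_le3 R _ T P (fun w => 2 * s * expR (a * J w)) (fun w => \1_E w)
  (fun w => expR (2 * a * J w)) (cst 1) (s ^+ 2) (s * m).
rewrite integral_cst1 mgf integral_indic// setIT -/m2.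
have -> : (\int[P]_w (2 * s * expR (a * J w))%:E = (2 * s * m)%:E)%E.
  under eq_integral do rewrite EFinM.
  rewrite ge0_integralZl//= ?mgf//.
  - by apply/measurable_EFinP; apply: measurableT_comp => //; exact: measurable_funM.
  - by rewrite lee_fin mulr_ge0// ltW.
have : P E \is a fin_num by exact: fin_num_measure.
move=> /fineK; set p := fine _ => PE.
rewrite mule1 -EFinM -!EFinD -PE !lee_fin => H.
have main : 2 * s * m <= p + (s ^+ 2 * m2 + s * m).
    rewrite -lee_fin EFinD PE; apply: H.
  - exact: sqr_ge0.
  - by rewrite mulr_ge0// ltW.
  - by apply: measurable_funM => //; apply: measurableT_comp => //; exact: measurable_funM.
  - exact: measurable_indic.
  - by apply: measurableT_comp => //; exact: measurable_funM.
  - exact: measurable_cst.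
  - by move=> w; rewrite mulr_ge0 ?expR_ge0// mulr_ge0// ltW.
  - by [].
  - by move=> w; exact: expR_ge0.
  - by [].
  - move=> w /=; rewrite mulr1.
    have -> : expR (2 * a * J w) = expR (a * J w) ^+ 2.
      by rewrite -mulrA mulrDl !mul1r expRD expr2.
    set y := expR _; have y0 : 0 < y by exact: expR_gt0.
    rewrite indicE; have [_|wE] := boolP (w \in E).
      by have := sqr_ge0 (s * y - 1); have := mulr_gt0 s0 m0; rewrite !expr2 /=; lra.
    have ym : y <= m / 2.
      have /= : ~ E w by move=> Ew; rewrite mem_set in wE.
      move/negP; rewrite -ltNge => Jlt.
      have : y <= m * expR (-1).
        rewrite /y /m -expRD ler_expR.
        have : a * J w <= a * (a * v / 2 - a^-1) by rewrite ler_pM2l// ltW.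
        by rewrite mulrBr divff ?gt_eqF// expr2 !mulrA.
      move=> /le_trans; apply; rewrite ler_pM2l// expRN lef_pV2 ?posrE ?expR_gt0//.
      by have := expR_ge1Dx (1 : R).
    rewrite add0r; have : s * y <= s * (m / 2) by rewrite ler_wpM2l// ltW.
    have := sqr_ge0 (s * y); rewrite !expr2; lra.
rewrite (_ : expR _ = m ^+ 2 / m2); last first.
  by rewrite (expr2 m) /m /m2 -expRN -!expRD; congr expR; field.
have e1 : s * m = m ^+ 2 / m2 / 2 by rewrite /s; field; rewrite gt_eqF.
have e2 : s ^+ 2 * m2 = m ^+ 2 / m2 / 4 by rewrite /s; field; rewrite gt_eqF.
lra.
Qed.

End gaussian_tails.

Lemma integral_ge0Zl {R : realType} d (T : measurableType d)
    (mu : {measure set T -> \bar R}) (f : T -> R) (c : R) :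
  0 <= c -> measurable_fun setT f -> (forall w, 0 <= f w) ->
  (\int[mu]_w (c * f w)%:E = c%:E * \int[mu]_w (f w)%:E)%E.
Proof.
move=> c0 mf f0; under eq_integral do rewrite EFinM.
have mf' : measurable_fun setT (fun w => (f w)%:E) by exact/measurable_EFinP.
by rewrite ge0_integralZl// => w _; rewrite lee_fin.
Qed.

Lemma integral_ge0_sumr {R : realType} d (T : measurableType d)
    (mu : {measure set T -> \bar R}) (I : finType) (f : I -> T -> R) :
  (forall i, measurable_fun setT (f i)) -> (forall i w, 0 <= f i w) ->
  (\int[mu]_w (\sum_i f i w)%:E = \sum_i \int[mu]_w (f i w)%:E)%E.
Proof.
move=> mf f0; under eq_integral do rewrite -sumEFin.
have mf' i : measurable_fun setT (fun w => (f i w)%:E) by exact/measurable_EFinP.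
by rewrite ge0_integral_sum// => i w _; rewrite lee_fin.
Qed.

Section second_moment.
Context {R : realType} (dd : measure_display) (T : measurableType dd)
  (P : probability T R).

(** With [a = 2 / sqrt v] the threshold of the anticoncentration bound is
    positive; if [v = 0], [a = e^-1] makes it [- e]. *)
Lemma gaussian_ge_neg J v e : gaussian_mgf P J v -> 0 <= v -> 0 < e ->
  ((expR (- 4) / 4)%:E <= P [set w | (- e <= J w)%R])%E.
Proof.
move=> gJ v0 e0; have [mJ _] := gJ.
pose a := if v == 0 then e^-1 else 2 / Num.sqrt v.
have a0 : 0 < a.
  rewrite /a; case: ifPn => [_|vn0]; first by rewrite invr_gt0.
  by rewrite divr_gt0// sqrtr_gt0 lt_neqAle eq_sym vn0.
have a2v : a ^+ 2 * v <= 4.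
  rewrite /a; case: ifPn => [/eqP ->|vn0]; first by rewrite mulr0.
  by rewrite expr_div_n sqr_sqrtr// divfK//; rewrite expr2; lra.
apply: (@le_trans _ _ (expR (- (a ^+ 2 * v)) / 4)%:E).
  by rewrite lee_fin ler_pM2r// ler_expR lerN2.
apply: le_trans (gaussian_anticoncentration gJ a0) _.
apply: le_measure; rewrite ?inE; try exact: measurable_ge_set.
move=> w /=; apply: le_trans.
rewrite /a; case: ifPn => [/eqP ->|vn0]; first by rewrite mulr0 mul0r sub0r invrK.
have vp : 0 < Num.sqrt v by rewrite sqrtr_gt0 lt_neqAle eq_sym vn0.
rewrite -{2}(sqr_sqrtr v0) expr2 mulrA divfK ?gt_eqF// invf_div.
lra.
Qed.

Lemma gaussian_ge_sqrt J v : gaussian_mgf P J v -> 0 < v ->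
  ((expR (- 4) / 4)%:E <= P [set w | (Num.sqrt v / 2 <= J w)%R])%E.
Proof.
move=> gJ v0; have [mJ _] := gJ.
have sv : 0 < Num.sqrt v by rewrite sqrtr_gt0.
have svE : Num.sqrt v ^+ 2 = v by rewrite sqr_sqrtr// ltW.
have := gaussian_anticoncentration gJ (a := 2 / Num.sqrt v) ltac:(by rewrite divr_gt0).
have -> : (2 / Num.sqrt v) ^+ 2 * v = 4 by rewrite -{2}svE; field; rewrite gt_eqF.
have -> // : 2 / Num.sqrt v * v / 2 - (2 / Num.sqrt v)^-1 = Num.sqrt v / 2.
by rewrite -{2}svE; field; rewrite gt_eqF.
Qed.

(** The second moment method. The normalised exponentials
    [Y i = expR (k / v i * D i - k ^+ 2 / (2 * v i))] have mean 1, are pairwise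
    uncorrelated, and have second moment [expR (k ^+ 2 / v i)], the inverse of
    the weight [p i]. Hence [S = \sum_i p i * Y i] has mean [s = \sum_i p i] and
    variance at most [s], whereas [Y i <= 1 / 2] for all [i], and so
    [S <= s / 2], on the event [G]. Chebyshev's inequality concludes. *)
Lemma second_moment_bound (I : finType) (D : I -> T -> R) (v : I -> R) (k : R) (G : set T) :
  0 < k -> (forall i, 0 <= v i <= k ^+ 2 / 4) ->
  (forall i, gaussian_mgf P (D i) (v i)) ->
  (forall i j a b, i != j -> (\int[P]_w (expR (a * D i w + b * D j w))%:E =
     (expR ((a ^+ 2 * v i + b ^+ 2 * v j) / 2))%:E)%E) ->
  measurable G -> (forall w i, G w -> D i w <= k / 4) ->
  ((\sum_i (if v i == 0 then 0 else expR (- (k ^+ 2 / v i))))%:E * P G <= 4%:E)%E.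
Proof.
move=> k0 v0 gD jD mG GD.
pose p i := if v i == 0 then 0 else expR (- (k ^+ 2 / v i)).
rewrite -/p; set s := \sum_i p i.
pose Y i w := expR (- (k ^+ 2 / (2 * v i))) * expR (k / v i * D i w).
have p0 i : 0 <= p i by rewrite /p; case: ifP => // _; exact: expR_ge0.
have Y0 i w : 0 <= Y i w by rewrite /Y mulr_ge0// expR_ge0.
have mD i : measurable_fun setT (D i) by have [] := gD i.
have mexp i a : measurable_fun setT (fun w => expR (a * D i w)).
  by apply: measurableT_comp => //; exact: measurable_funM.
have mY i : measurable_fun setT (Y i) by exact: measurable_funM.
have s0 : 0 <= s by exact: sumr_ge0.
have kv2 i : (k / v i) ^+ 2 * v i / 2 = k ^+ 2 / (2 * v i).
  by have [->|vi] := eqVneq (v i) 0; [rewrite mulr0 mulr0 invr0 mulr0 mul0r|field].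
have EY i : (\int[P]_w (Y i w)%:E = 1)%E.
  rewrite integral_ge0Zl ?expR_ge0//.
  by have [_ ->] := gD i; rewrite -EFinM -expRD kv2 addrC subrr expR0.
have EYY i j : (\int[P]_w (Y i w * Y j w)%:E = (if i == j then expR (k ^+ 2 / v i) else 1)%:E)%E.
  have YE w : Y i w * Y j w = expR (- (k ^+ 2 / (2 * v i)) - k ^+ 2 / (2 * v j)) *
      expR (k / v i * D i w + k / v j * D j w).
    by rewrite /Y !expRD; ring.
  under eq_integral do rewrite YE.
  rewrite integral_ge0Zl ?expR_ge0//; last first.
    by apply: measurableT_comp => //; apply: measurable_funD; exact: measurable_funM.
  case: eqVneq => [<-|ij].
    have [_ mgf] := gD i.
    under eq_integral do rewrite -mulrDl.
    rewrite mgf -EFinM -expRD; congr (expR _)%:E.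
    by have [->|vi] := eqVneq (v i) 0; [rewrite !mulr0 !invr0 !mulr0 mul0r oppr0 !addr0|field].
  rewrite jD// -EFinM -expRD [X in _ + X]mulrDl !kv2.
  by rewrite -expR0; congr (expR _)%:E; ring.
pose S w := \sum_i p i * Y i w.
have mS : measurable_fun setT S by apply: measurable_sum => i; exact: measurable_funM.
have S0 w : 0 <= S w by apply: sumr_ge0 => i _; rewrite mulr_ge0.
have ES : (\int[P]_w (S w)%:E = s%:E)%E.
  rewrite integral_ge0_sumr//; last 2 first.
  - by move=> i; exact: measurable_funM.
  - by move=> i w; rewrite mulr_ge0.
  rewrite -sumEFin; apply: eq_bigr => i _.
  by rewrite integral_ge0Zl// EY mule1.
have ES2 : (\int[P]_w (S w ^+ 2)%:E <= (s ^+ 2 + s)%:E)%E.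
  have SE w : S w ^+ 2 = \sum_ij p ij.1 * p ij.2 * (Y ij.1 w * Y ij.2 w).
    rewrite expr2 mulr_suml; under eq_bigr do rewrite mulr_sumr.
    by rewrite pair_big/=; apply: eq_bigr => ij _; ring.
  under eq_integral do rewrite SE.
  rewrite integral_ge0_sumr//; last 2 first.
  - by move=> i; apply: measurable_funM => //; exact: measurable_funM.
  - by move=> i w; rewrite !mulr_ge0.
  have -> : s ^+ 2 + s = \sum_ij (p ij.1 * p ij.2 + (ij.1 == ij.2)%:R * p ij.1).
    rewrite big_split/=; congr (_ + _); first by rewrite expr2 /s big_distrlr/= pair_big.
    rewrite -(pair_big xpredT xpredT (fun i j => (i == j)%:R * p i))/=.
    apply: eq_bigr => i _; rewrite (bigD1 i)//= eqxx mul1r big1 ?addr0// => j ji.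
    by rewrite eq_sym (negbTE ji) mul0r.
  rewrite -sumEFin; apply: lee_sum => -[i j] _ /=.
  rewrite integral_ge0Zl//; last 3 first.
  - by rewrite mulr_ge0.
  - exact: measurable_funM.
  - by move=> w; rewrite mulr_ge0.
  rewrite EYY -EFinM lee_fin; case: eqVneq => [<-|ij]; last by rewrite mulr1 mul0r addr0.
  rewrite mul1r /p; case: ifP => _; first by rewrite !mul0r add0r.
  have e1 : expR (- (k ^+ 2 / v i)) * expR (k ^+ 2 / v i) = 1 by rewrite -expRD addNr expR0.
  by rewrite -mulrA e1 mulr1 lerDr mulr_ge0// expR_ge0.
(* On G the exponent of Y i is at most - k ^+ 2 / (4 * v i), hence at most -1. *)
have SG w : G w -> S w <= s / 2.
  move=> Gw; rewrite /s mulr_suml; apply: ler_sum => i _.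
  rewrite /p; case: ifPn => [_|vi]; first by rewrite !mul0r.
  have vp : 0 < v i by rewrite lt_neqAle eq_sym vi; have /andP[] := v0 i.
  rewrite ler_pM2l ?expR_gt0//.
  have : Y i w <= expR (- 1).
    rewrite /Y -expRD ler_expR.
    have h1 : k / v i * D i w <= k / v i * (k / 4).
      by rewrite ler_wpM2l ?GD// divr_ge0 ?(ltW k0) ?(ltW vp).
    have h2 : 1 <= k ^+ 2 / (4 * v i).
      by rewrite ler_pdivlMr ?mulr_gt0//; have /andP[_] := v0 i; lra.
    have e1 : k / v i * (k / 4) = k ^+ 2 / (4 * v i) by field.
    have e2 : k ^+ 2 / (2 * v i) = k ^+ 2 / (4 * v i) + k ^+ 2 / (4 * v i) by field.
    lra.
  move=> /le_trans; apply; rewrite expRN lef_pV2 ?posrE ?expR_gt0//.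
  by have := expR_ge1Dx (1 : R).
(* Chebyshev's inequality for the square of S - s, with the cross term moved to
   the left so that only nonnegative functions are integrated. *)
have := @integral_le3 R _ T P (fun w => s ^+ 2 / 4 * \1_G w + 2 * s * S w)
  (fun w => S w ^+ 2) (cst 1) (cst 1) (s ^+ 2) 0.
rewrite integral_cst1 !mule1 adde0.
have m1G : measurable_fun setT (fun w => \1_G w : R) by exact: measurable_indic.
have -> : (\int[P]_w (s ^+ 2 / 4 * \1_G w + 2 * s * S w)%:E =
    (s ^+ 2 / 4)%:E * P G + (2 * s * s)%:E)%E.
  have h1 w : 0 <= s ^+ 2 / 4 * \1_G w by rewrite !mulr_ge0// sqr_ge0.
  have h2 w : 0 <= 2 * s * S w by rewrite !mulr_ge0.
  under eq_integral do rewrite EFinD.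
  rewrite ge0_integralD//=; last 4 first.
  - by move=> w _; rewrite lee_fin h1.
  - by apply/measurable_EFinP; exact: measurable_funM.
  - by move=> w _; rewrite lee_fin h2.
  - by apply/measurable_EFinP; exact: measurable_funM.
  rewrite integral_ge0Zl//; last by rewrite divr_ge0 ?sqr_ge0.
  rewrite integral_ge0Zl//; last by rewrite mulr_ge0.
  by rewrite ES -EFinM integral_indic// setIT.
move=> H.
have : ((s ^+ 2 / 4)%:E * P G + (2 * s * s)%:E <= (s ^+ 2 + s)%:E + (s ^+ 2)%:E)%E.
  apply: le_trans; last by apply: leeD2r; exact: ES2.
  apply: H => //.
  - exact: sqr_ge0.
  - by apply: measurable_funD; exact: measurable_funM.
  - exact: measurable_funX.
  - by move=> w; rewrite addr_ge0// !mulr_ge0// sqr_ge0.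
  - by move=> w; exact: sqr_ge0.
  - move=> w; rewrite /cst mulr1 mul0r addr0 indicE.
    have [wG|wG] := boolP (w \in G); last first.
      by rewrite mulr0 add0r; have := sqr_ge0 (S w - s); rewrite !expr2; lra.
    rewrite inE in wG; have := SG _ wG => h; rewrite mulr1 !expr2.
    have : 0 <= (s - S w - s / 2) * (s - S w + s / 2) by rewrite mulr_ge0//; lra.
    lra.
have : P G \is a fin_num by exact: fin_num_measure.
move=> /fineK; set g := fine _ => <-; rewrite -!EFinM -!EFinD !lee_fin => h.
have [s_0|sn0] := eqVneq s 0; first by rewrite s_0 mul0r.
have sp : 0 < s by rewrite lt_neqAle eq_sym sn0.
rewrite -(ler_pM2l sp); rewrite !expr2 in h; lra.
Qed.

End second_moment.

(** * A maximal inequality by chaining *)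

Section chaining.
Context {R : realType}.

Lemma bernoulli_ineq (x : R) m : 0 <= x -> 1 + m%:R * x <= (1 + x) ^+ m.
Proof.
move=> x0; elim: m => [|m IH]; first by rewrite mul0r addr0 expr0.
rewrite exprS; apply: le_trans (_ : (1 + x) * (1 + m%:R * x) <= _).
  have : 0 <= m%:R * x * x by rewrite !mulr_ge0.
  by rewrite mulrSr; lra.
by rewrite ler_pM2l//; lra.
Qed.

Lemma exists_dyadic_between (x y : R) : 0 <= x -> x < y -> y <= 1 ->
  exists m k : nat, [/\ (k <= 2 ^ m)%N, x < k%:R / 2 ^+ m & k%:R / 2 ^+ m <= y].
Proof.
move=> x0 xy y1; pose m := Num.bound (y - x)^-1.
have yx : 0 < y - x by lra.
have h : (2 ^+ m)^-1 < y - x.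
  rewrite -[ltRHS]invrK ltf_pV2 ?posrE ?invr_gt0 ?exprn_gt0//.
  have : (y - x)^-1 < m%:R by apply: archi_boundP; rewrite invr_ge0 ltW.
  move=> /lt_le_trans; apply; rewrite -natrX ler_nat; apply: ltnW; exact: ltn_expl.
have p0 : (0 : R) < 2 ^+ m by rewrite exprn_gt0.
pose k := Num.truncn (y * 2 ^+ m).
have yp : 0 <= y * 2 ^+ m by rewrite mulr_ge0 ?(ltW p0)//; lra.
have /andP[k1 k2] : k%:R <= y * 2 ^+ m < k.+1%:R by exact: truncn_itv.
exists m, k; split.
- rewrite -(ler_nat R) natrX; apply: le_trans k1 _.
  by rewrite -[leRHS]mul1r ler_pM2r.
- rewrite ltr_pdivlMr//; move: k2; rewrite mulrSr => k2.
  have : (2 ^+ m)^-1 * 2 ^+ m < (y - x) * 2 ^+ m by rewrite ltr_pM2r.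
  by rewrite mulVf ?gt_eqF//; lra.
- by rewrite ler_pdivrMr.
Qed.

Context (dd : measure_display) (T : measurableType dd) (P : probability T R).
Variables (S : R -> T -> R) (c : R -> R) (a b eta : R).
Let C := c b - c a.
Let kappa := eta ^+ 2 / (32 * C).
Hypotheses (ab : a < b) (cc : {within `[a, b], continuous c})
  (cinc : forall s t, a <= s -> s < t -> t <= b -> c s < c t)
  (mS : forall t, a <= t <= b -> measurable_fun setT (S t))
  (tail : forall s t x, a <= s -> s < t -> t <= b -> 0 <= x ->
    (P [set w | (x <= `|S t w - S s w|)%R] <=
      (2 * expR (- (x ^+ 2 / (2 * (c t - c s)))))%:E)%E)
  (eta0 : 0 < eta) (kappa24 : 24 <= kappa).

Let C0 : 0 < C. Proof. by rewrite /C subr_gt0; exact: cinc. Qed.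

Let cle s t : a <= s <= b -> a <= t <= b -> (c s <= c t) = (s <= t).
Proof.
move=> /andP[s1 s2] /andP[t1 t2]; have [st|ts] := leP s t.
  move: st; rewrite le_eqVlt => /predU1P[->|st]; first by rewrite lexx.
  by rewrite ltW// cinc.
by apply/negbTE; rewrite -ltNge cinc.
Qed.

(** The exponent is [kappa * (9 / 8) ^+ m >= kappa + 3 * m], since [kappa >= 24];
    the gain [expR (- (3 * m)) <= 4 ^- m] outweighs the number [2 ^ m] of cells. *)
Let threshold_bound m :
  2 ^+ m * (2 * expR (- ((eta / 4 * (3 / 4) ^+ m) ^+ 2 / (2 * (C / 2 ^+ m)))))
  <= 4 * expR (- kappa) / (2 ^ m.+1)%:R.
Proof.
have p0 : (0 : R) < 2 ^+ m by rewrite exprn_gt0.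
have -> : (eta / 4 * (3 / 4) ^+ m) ^+ 2 / (2 * (C / 2 ^+ m)) = kappa * (1 + 1 / 8) ^+ m.
  have -> : (1 + 1 / 8 : R) ^+ m = ((3 / 4) ^+ m) ^+ 2 * 2 ^+ m.
    by rewrite -exprM mulnC exprM -exprMn; congr (_ ^+ m); rewrite expr2; field.
  by rewrite /kappa; field; rewrite ?gt_eqF.
have b1 := @bernoulli_ineq (1 / 8) m ltac:(lra).
have h1 : expR (- (kappa * (1 + 1 / 8) ^+ m)) <= expR (- kappa) * expR (- 3) ^+ m.
  rewrite -expRM_natl -expRD ler_expR.
  have : kappa * (1 + m%:R * (1 / 8)) <= kappa * (1 + 1 / 8) ^+ m.
    by apply: ler_wpM2l b1; apply: le_trans kappa24; rewrite ler0n.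
  have : 24 * (m%:R * (1 / 8)) <= kappa * (m%:R * (1 / 8)).
    by rewrite ler_wpM2r// mulr_ge0.
  lra.
have h2 : expR (- 3) ^+ m <= (4 ^+ m)^-1 :> R.
  rewrite -exprVn lerXn2r ?nnegrE ?invr_ge0 ?expR_ge0//.
  by rewrite expRN lef_pV2 ?posrE ?expR_gt0//; have := expR_ge1Dx (3 : R); lra.
have e0 := expR_gt0 (- kappa).
have h3 : expR (- (kappa * (1 + 1 / 8) ^+ m)) <= expR (- kappa) / 4 ^+ m.
  by apply: le_trans h1 _; rewrite ler_pM2l.
rewrite natrX exprS.
have -> : 4 * expR (- kappa) / (2 * 2 ^+ m) = 2 ^+ m * (2 * (expR (- kappa) / 4 ^+ m)).
  rewrite (_ : 4 = 2 * 2 :> R) ?exprMn; last by ring.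
  by field; rewrite gt_eqF.
by rewrite ler_pM2l// ler_pM2l.
Qed.

(** The time interval is divided dyadically with respect to the clock [c], so that
    all increments of level [m] have variance at most [C / 2 ^ m]. The increments
    of level [m] are allowed the threshold [eta / 4 * (3 / 4) ^+ m]; these
    thresholds add up to [eta], and they decrease slowly enough for the union
    bounds over the [2 ^ m] cells to be summable. A path that respects all
    thresholds stays within [eta] of its initial value at the points of all
    levels, which are dense as [c] is strictly increasing, hence everywhere by
    continuity. *)
Lemma chaining_maximal_bound : exists E : set T, [/\ measurable E,
  (P E <= (4 * expR (- kappa))%:E)%E
  & forall w, ~ E w -> {within `[a, b], continuous (S ^~ w)} ->
      forall t, a <= t <= b -> `|S t w - S a w| <= eta].
Proof.
have /choice[tau Htau] : forall y : R, exists t, 0 <= y <= 1 -> a <= t <= b /\ c t = c a + y * C.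
  move=> y; have [y01|] := boolP (0 <= y <= 1); last by exists 0.
  have [|t tab tE] := @IVT R c a b (c a + y * C) (ltW ab) cc.
    rewrite min_l ?max_r; try exact/ltW/cinc.
    have /andP[y0 y1] := y01; have h1 := mulr_ge0 y0 (ltW C0).
    have : y * C <= 1 * C by rewrite ler_pM2r.
    by rewrite /C in h1 *; lra.
  by exists t => _; rewrite in_itv/= in tab.
pose g m k := tau (k%:R / 2 ^+ m).
have p0 m : (0 : R) < 2 ^+ m by rewrite exprn_gt0.
have k01 m k : (k <= 2 ^ m)%N -> 0 <= (k%:R / 2 ^+ m : R) <= 1.
  move=> km; rewrite divr_ge0 ?(ltW (p0 m))//= ler_pdivrMr// mul1r -natrX ler_nat//.
have gab m k : (k <= 2 ^ m)%N -> a <= g m k <= b by move=> /k01 /Htau[].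
have cg m k : (k <= 2 ^ m)%N -> c (g m k) = c a + k%:R / 2 ^+ m * C by move=> /k01 /Htau[].
pose th m := eta / 4 * (3 / 4) ^+ m.
have q34 : (0 : R) <= 3 / 4 by lra.
have th0 m : 0 <= th m.
  by apply: mulr_ge0; [rewrite divr_ge0// ltW|exact: exprn_ge0].
pose B m k := [set w | th m <= `|S (g m k.+1) w - S (g m k) w|].
have mB m k : (k < 2 ^ m)%N -> measurable (B m k).
  move=> km; apply: measurable_ge_set; apply: measurableT_comp => //.
  by apply: measurable_funB; apply: mS; apply: gab => //; exact: ltnW.
pose E m := \big[setU/set0]_(k < 2 ^ m) B m k.
have mE m : measurable (E m) by apply: bigsetU_measurable => k _; exact: mB.
have PE m : (P (E m) <= (4 * expR (- kappa) / (2 ^ m.+1)%:R)%:E)%E.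
  apply: (@le_trans _ _ (\sum_(k < 2 ^ m) P (B m k))%E).
    by apply: content_subadditive => // k km; exact: mB.
  apply: (@le_trans _ _ (\sum_(k < 2 ^ m) (2 * expR (- (th m ^+ 2 / (2 * (C / 2 ^+ m)))))%:E)%E).
    apply: lee_sum => k _.
    have cE : c (g m k.+1) - c (g m k) = C / 2 ^+ m.
      by rewrite !cg ?(ltnW (ltn_ord k))// mulrSr; field; rewrite gt_eqF.
    have /andP[g1 g2] := gab m k (ltnW (ltn_ord k)).
    have /andP[g3 g4] := gab m k.+1 (ltn_ord k).
    rewrite -cE; apply: tail => //.
    rewrite ltNge -cle ?gab ?(ltnW (ltn_ord k))// -ltNge -subr_gt0 cE.
    by rewrite divr_gt0.
  rewrite sumEFin lee_fin sumr_const card_ord -[leLHS]mulr_natl (natrX _ 2 m).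
  exact: threshold_bound.
exists (\bigcup_m E m); split.
- exact: bigcup_measurable.
- apply: le_trans (measure_sigma_subadditive _ _ _ (@subset_refl _ _)) _ => //.
    exact: bigcup_measurable.
  apply: le_trans (epsilon_trick0 xpredT _); last by rewrite mulr_ge0// expR_ge0.
  by apply: lee_nneseries => [n _ _|n _]; [exact: measure_ge0|exact: PE].
move=> w nE cS t tab.
have nB m k : (k < 2 ^ m)%N -> `|S (g m k.+1) w - S (g m k) w| < th m.
  move=> km; rewrite ltNge; apply/negP => Bw; apply: nE; exists m => //.
  by rewrite /E -bigcup_mkord; exists k.
have ga : g 0%N 0%N = a.
  have := cg 0%N 0%N isT; rewrite mul0r mul0r addr0 => cga.
  have aab : a <= a <= b by rewrite lexx ltW.
  by apply/eqP; rewrite eq_le; apply/andP; split; rewrite -cle ?gab// cga.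
(* A point of level m + 1 is a point of level m or next to one. *)
have level m : forall k, (k <= 2 ^ m)%N -> `|S (g m k) w - S a w| <= eta * (1 - (3 / 4) ^+ m.+1).
  elim: m => [|m IH] k km.
    case: k km => [|[|//]] km.
      by rewrite ga subrr normr0 mulr_ge0 ?(ltW eta0)// expr1; lra.
    have := nB 0%N 0%N isT; rewrite ga /th expr0 expr1; lra.
  have gE j : g m.+1 j.*2 = g m j.
    by rewrite /g -muln2 natrM exprS; congr tau; field; rewrite gt_eqF.
  have q0 : (0 : R) <= (3 / 4) ^+ m by exact: exprn_ge0.
  have ee : 0 <= eta * (3 / 4) ^+ m by rewrite mulr_ge0// ltW.
  rewrite -(odd_double_half k) in km *; set j := k./2 in km *.
  case: (odd k) km => /=.
    rewrite add1n expnS mul2n => km; have jm : (j < 2 ^ m)%N by rewrite -ltn_double.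
    have h1 := IH j (ltnW jm); have := nB m.+1 j.*2; rewrite expnS mul2n => /(_ km).
    rewrite gE => h2; have := ler_distD (S (g m j) w) (S (g m.+1 j.*2.+1) w) (S a w).
    move: h1 h2; rewrite /th !exprS; lra.
  rewrite add0n expnS mul2n leq_double => jm; rewrite gE.
  by apply: le_trans (IH j jm) _; rewrite !exprS; lra.
(* A large value at t persists just before t, where c is smaller than c t, so a
   point of some level lies there. *)
rewrite leNgt; apply/negP => bad.
have at_ : a < t.
  rewrite lt_neqAle; have /andP[-> _] := tab; rewrite andbT; apply/eqP => atE.
  by move: bad; rewrite -atE subrr normr0 ltNge ltW.
have tab' : `[a, b]%classic t by rewrite /= in_itv.
move/subspace_continuousP : cS => /(_ t tab') /cvgrPdist_lt /(_ (`|S t w - S a w| - eta)).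
rewrite subr_gt0 => /(_ bad) [/= dl dl0 Hd].
have {}Hd (s : R) : a <= s <= b -> `|t - s| < dl -> eta < `|S s w - S a w|.
  move=> sab ts; have sab' : `[a, b]%classic s by rewrite /= in_itv.
  have := Hd s ts sab'.
  have := ler_distD (S s w) (S t w) (S a w); lra.
pose t' := Num.max a (t - dl / 2).
have t't : t' < t by rewrite gt_max at_/=; lra.
have at' : a <= t' by rewrite le_max lexx.
have /andP[_ tb] := tab.
have t'ab : a <= t' <= b by rewrite at'/= (le_trans (ltW t't)).
have ct't := cinc at' t't tb.
have aab : a <= a <= b by rewrite lexx ltW.
have bab : a <= b <= b by rewrite lexx ltW.
have cat' : c a <= c t' by rewrite cle.
have ctb : c t <= c b by rewrite cle.
have [||| m [k [km k1 k2]]] := @exists_dyadic_between ((c t' - c a) / C) ((c t - c a) / C).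
- by apply: divr_ge0; [rewrite subr_ge0|exact: ltW].
- by rewrite ltr_pM2r ?invr_gt0// ltrD2r.
- by rewrite ler_pdivrMr// mul1r /C lerD2r.
rewrite ltr_pdivrMr// in k1; rewrite ler_pdivlMr// in k2.
have gt : g m k <= t by rewrite -cle ?gab// cg//; lra.
have tg : t' < g m k by rewrite ltNge -cle ?gab// -ltNge cg//; lra.
have := Hd _ (gab m k km); have := level m k km.
have q0 : (0 : R) <= (3 / 4) ^+ m.+1 by exact: exprn_ge0.
have : 0 <= eta * (3 / 4) ^+ m.+1 by rewrite mulr_ge0// ltW.
have : t - dl / 2 <= t' by rewrite le_max lexx orbT.
move=> h1 h2 h3 h4.
have : `|t - g m k| < dl by rewrite ger0_norm; lra.
move=> /h4; lra.
Qed.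

End chaining.

Lemma cvge0_near_le {R : realType} (u : (\bar R)^nat) (e : R) : 0 < e ->
  u n @[n --> \oo] --> 0%E -> \forall n \near \oo, (u n <= e%:E)%E.
Proof.
move=> e0 /fine_cvgP[ufin /cvgr0Pnorm_le /(_ e e0)]; apply: filterS2 ufin => n ufin.
by move=> /= h; rewrite -(fineK ufin) lee_fin; apply: le_trans (ler_norm _) h.
Qed.

(** * The stochastic integral of the equation *)

Section ito.
Context {R : realType} (dd : measure_display) (T : measurableType dd)
  (P : probability T R) (r : nat) (W : R -> T -> 'cV[R]_r).
Hypotheses (BM : standard_brownian_motion P W) (hP : measure_is_complete P).

Lemma wiener_integral0 : wiener_integral P W (fun _ => 0) (fun _ _ => 0).
Proof.
have z : sqnorm (fun (_ : 'I_r) (_ : R) => 0 : R) = 0%E.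
  by rewrite /sqnorm big1// => j _; under eq_integral do rewrite expr0n/=; rewrite integral0.
split => //; first by rewrite z.
move=> e e0; exists (fun=> [::]); split.
- by move=> j x; rewrite inE.
- have -> : (fun (j : 'I_r) (s : R) => 0 - step_fun [::] s) = (fun (_ : 'I_r) (_ : R) => 0 : R).
    by apply/funext => j; apply/funext => s; rewrite /step_fun big_nil subr0.
  by rewrite z lee_fin ltW.
- rewrite (_ : (\int[P]_w _)%E = 0%E) ?lee_fin ?ltW//.
  rewrite -[RHS](integral0 P setT); apply: eq_integral => w _.
  rewrite /step_itg big1 ?subr0 ?expr0n// => j _; by rewrite /step_integral big_nil.
Qed.

Lemma wiener_integral_sum (I : Type) (s : seq I) (J : I -> T -> R) (g : I -> 'I_r -> R -> R) :
  (forall k, wiener_integral P W (J k) (g k)) ->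
  wiener_integral P W (fun w => \sum_(k <- s) J k w) (fun j t => \sum_(k <- s) g k j t).
Proof.
move=> Jg; elim: s => [|k s IH].
  rewrite (_ : (fun _ => _) = (fun=> 0)); last by apply/funext => w; rewrite big_nil.
  have -> : (fun (j : 'I_r) (t : R) => \sum_(k <- [::]) g k j t) = (fun (_ : 'I_r) (_ : R) => 0 : R).
    by apply/funext => j; apply/funext => t; rewrite big_nil.
  exact: wiener_integral0.
have := wiener_integral_lin BM 1 1 (Jg k) IH.
congr wiener_integral.
  by apply/funext => w; rewrite big_cons !mul1r.
by apply/funext => j; apply/funext => t; rewrite big_cons !mul1r.
Qed.

(** The solution is only specified up to null sets at each time; completeness makes
    this harmless. *)
Lemma measurable_ae_eq (J J' : T -> R) : measurable_fun setT J ->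
  {ae P, forall w, J w = J' w} -> measurable_fun setT J'.
Proof.
move=> mJ [N [mN PN sub]] _ B mB; rewrite setTI.
have nJ w : ~ N w -> J w = J' w by move=> nN; apply: contrapT => h; apply: nN; exact: sub.
have -> : J' @^-1` B = (J @^-1` B `\` N) `|` (J' @^-1` B `&` N).
  apply/seteqP; split=> w /=.
    by move=> Bw; have [Nw|Nw] := pselect (N w); [right|left; rewrite nJ].
  by move=> [[Bw Nw]|[]//]; rewrite -nJ.
apply: measurableU.
  by apply: measurableD => //; rewrite -[X in measurable X]setTI; exact: mJ.
by apply: hP; exists N; split => // w [].
Qed.

Lemma wiener_integral_ae J J' g : {ae P, forall w, J w = J' w} ->
  wiener_integral P W J g -> wiener_integral P W J' g.
Proof.
move=> JJ' [mJ mg gfin Jg].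
have mJ' : measurable_fun setT J' by exact: measurable_ae_eq JJ'.
split => // e /Jg [h [h0 hg hJ]]; exists h; split => //.
apply: le_trans hJ; rewrite le_eqVlt; apply/orP; left; apply/eqP.
have mI := measurable_step_itg BM h0.
apply: ae_eq_integral => //.
- by apply/measurable_EFinP; apply: measurable_funX; exact: measurable_funB.
- by apply/measurable_EFinP; apply: measurable_funX; exact: measurable_funB.
- by apply: filterS JJ' => w -> _.
Qed.

(** The step functions that approximate the integrand on [[0, t]] vanish outside of
    this interval, so they approximate on the whole line the integrand cut off
    at [t]. Cutting off makes integrals up to different times comparable. *)
Lemma wiener_integral_ito (j : 'I_r) (g gE : R -> R) (t : R) (K : T -> R) :
  0 <= t -> continuous gE -> (forall s, 0 <= s <= t -> g s = gE s) ->
  is_ito_integral P (fun s om => W s om j 0) g t K ->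
  wiener_integral P W K (fun j' s => if j' == j then gE s * \1_(`[0, t]) s else 0).
Proof.
move=> t0 cgE ggE [mK [h [hst hg hK]]].
have m1 : measurable_fun setT (fun s : R => gE s * \1_(`[0, t]) s).
  by apply: measurable_funM; [exact: continuous_measurable_fun|exact: measurable_indic].
have sqE (u : R -> R) : sqnorm (fun j' s => if j' == j then u s else 0) =
    (\int[lebesgue_measure]_s (u s ^+ 2)%:E)%E.
  rewrite /sqnorm (bigD1 j)//= eqxx big1 ?adde0// => k /negbTE ->.
  by under eq_integral do rewrite expr0n/=; rewrite integral0.
have restr (u : R -> R) : (\int[lebesgue_measure]_s ((u s * \1_(`[0%R, t]) s) ^+ 2)%:E =
    \int[lebesgue_measure]_(s in `[0%R, t]) (u s ^+ 2)%:E)%E.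
  rewrite [RHS]integral_mkcond; apply: eq_integral => s _; rewrite patchE indicE.
  by case: ifPn; rewrite ?mulr1// mulr0 expr0n.
split => //.
- by move=> k; case: (k == j).
- rewrite sqE restr.
  have ig : lebesgue_measure.-integrable `[0, t] (EFin \o (fun s => gE s ^+ 2)).
    have -> : (fun s => gE s ^+ 2) = (fun s => gE s * gE s) by apply/funext => s; rewrite expr2.
    by apply: continuous_integrable => s; apply: cvgM; exact: cgE.
  have /integrableP[_] := ig; apply: le_lt_trans; apply: ge0_le_integral => //.
  + by move=> s _; rewrite lee_fin sqr_ge0.
  + by have /integrableP[] := ig.
  + by apply: measurableT_comp => //; have /integrableP[] := ig.
  + by move=> s _ /=; rewrite lee_fin ler_norm.
move=> e e0.
have [n [h1 h2]] : exists n, (\int[lebesgue_measure]_(s in `[0%R, t]) ((g s - step_fun (h n) s) ^+ 2)%:E <= e%:E)%E /\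
    ('E_P[fun om => ((K om - step_integral (h n) (fun s => W s om j 0)) ^+ 2)%R] <= e%:E)%E.
  near \oo => n; exists n; split; near: n; exact: cvge0_near_le.
exists (fun k => if k == j then h n else [::]); split.
- move=> k x; case: ifP => // _ /hst; by move=> [? ? _].
- apply: le_trans h1; rewrite le_eqVlt; apply/orP; left; apply/eqP.
  have -> : (fun (k : 'I_r) (s : R) => (if k == j then gE s * \1_(`[0, t]) s else 0) -
        step_fun (if k == j then h n else [::]) s) =
      (fun k s => if k == j then (gE s - step_fun (h n) s) * \1_(`[0, t]) s else 0).
    apply/funext => k; apply/funext => s; case: ifP => _; last first.
      by rewrite /step_fun big_nil subr0.
    rewrite mulrBl; congr (_ - _).
    rewrite indicE; have [_|st] := boolP (s \in _); first by rewrite mulr1.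
    rewrite mulr0 /step_fun big_seq big1// => x /hst[x0 x1 x2].
    rewrite indicE memNset ?mulr0//= in_itv/= => /andP[s1 s2].
    move: st; rewrite notin_setE/= in_itv/=; apply; apply/andP; split.
      exact: ltW (le_lt_trans x0 s1).
    exact: le_trans x2.
  rewrite sqE restr; apply: eq_integral => s; rewrite inE/= in_itv/= => st.
  by rewrite ggE.
- apply: le_trans h2; rewrite unlock le_eqVlt; apply/orP; left; apply/eqP.
  apply: eq_integral => w _; congr (((_ - _) ^+ 2)%:E).
  rewrite /step_itg (bigD1 j)//= eqxx big1 ?addr0// => k /negbTE ->.
  by rewrite /step_integral big_nil.
Unshelve. all: by end_near. Qed.

End ito.

Section noise.
Context {R : realType} (dd : measure_display) (T : measurableType dd)
  (P : probability T R) (d r : nat) (W : R -> T -> 'cV[R]_r).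
Hypotheses (BM : standard_brownian_motion P W) (hP : measure_is_complete P).
Variables (Sigma : R -> 'M[R]_(d, r)) (M : R -> T -> 'cV[R]_d) (i : 'I_d).
Hypotheses (cSigma : continuous_on_ge0 Sigma)
  (hM : forall t : R, 0 <= t -> is_ito_integral_mx P W Sigma t (M t)).

Definition row_entry (j : 'I_r) (s : R) : R := Sigma (Num.max 0 s) i j.

(** The quadratic variation of the i-th noise component, up to a constant. *)
Definition row_clock : R -> R := prim (fun s => \sum_j row_entry j s ^+ 2).

Let cS j : continuous (row_entry j).
Proof.
move=> s; apply: (@cvg_comp _ _ _ (fun s : R => Sigma (Num.max 0 s)) (fun A : 'M[R]_(d, r) => A i j)).
  exact: (continuous_ext_ge0 cSigma).
exact: coord_continuous.
Qed.

Let crow : continuous (fun s => \sum_j row_entry j s ^+ 2).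
Proof.
move=> s; apply: cvg_big => [|j _]; first exact: add_continuous.
by under eq_fun do rewrite expr2; rewrite expr2; apply: cvgM; exact: cS.
Qed.

Let row0 s : 0 <= \sum_j row_entry j s ^+ 2.
Proof. by apply: sumr_ge0 => j _; exact: sqr_ge0. Qed.

Lemma row_clock_itv s t : 0 <= s -> s <= t ->
  (\int[lebesgue_measure]_u ((\sum_j row_entry j u ^+ 2) * \1_(`]s, t]) u)%:E =
   (row_clock t - row_clock s)%:E)%E.
Proof.
move=> s0 st; pose g u := \sum_j row_entry j u ^+ 2.
have s2 : -2 <= s by lra.
rewrite /row_clock -integral_prim//.
have ig : lebesgue_measure.-integrable `]s, t] (EFin \o g).
  apply: integrableS (continuous_integrable s t crow) => //.
  by apply: subset_itvr; rewrite bnd_simp.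
rewrite -Rintegral_itv_obnd_cbnd//.
rewrite /Rintegral fineK; last exact: (integrable_fin_num _ ig).
rewrite [RHS]integral_mkcond; apply: eq_integral => u _; rewrite patchE indicE.
by case: ifPn => _; rewrite ?mulr1// mulr0.
Qed.

Lemma row_clock_mono s t : 0 <= s -> s <= t -> row_clock s <= row_clock t.
Proof.
move=> s0 st; rewrite -subr_ge0 -lee_fin -row_clock_itv//.
by apply: integral_ge0 => u _; rewrite lee_fin mulr_ge0.
Qed.

Lemma continuous_row_clock t : 0 <= t -> {for t, continuous row_clock}.
Proof. by move=> t0; apply: continuous_prim => //; lra. Qed.

Lemma block_variance_clock n : block_variance Sigma i n.+1 = row_clock n.+1%:R - row_clock n%:R.
Proof.
have n0 : (0 : R) <= n%:R by [].
have nn : n.+1%:R - 1 = n%:R :> R by rewrite mulrSr addrK.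
rewrite /block_variance nn /row_clock -integral_prim//; [|lra|by rewrite ler_nat].
apply: eq_Rintegral => s; rewrite inE/= in_itv/= => /andP[s1 _].
rewrite /sigma_row sqr_sqrtr; last by apply: sumr_ge0 => j _; exact: sqr_ge0.
by apply: eq_bigr => j _; rewrite /row_entry max_r// (le_trans n0).
Qed.

Lemma wiener_noise t : 0 <= t -> wiener_integral P W (fun w => M t w i 0)
  (fun j s => row_entry j s * \1_(`[0, t]) s).
Proof.
move=> t0; have [K [HK ME]] := hM t0.
have ggE j : forall s, 0 <= s <= t -> Sigma s i j = row_entry j s.
  by move=> s /andP[s0 _]; rewrite /row_entry max_r.
have hsum := wiener_integral_sum BM (index_enum 'I_r)
  (fun j => wiener_integral_ito t0 (@cS j) (ggE j) (HK i j)).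
apply: (wiener_integral_ae BM hP (J := fun w => \sum_j K i j w)).
  by apply: filterS ME => w ->; rewrite mxE.
move: hsum; congr wiener_integral.
apply/funext => j; apply/funext => s.
by rewrite (bigD1 j)//= eqxx big1 ?addr0// => k kj; rewrite eq_sym (negbTE kj).
Qed.

Lemma sqnorm_two_blocks (a b s1 t1 s2 t2 : R) : 0 <= s1 -> s1 <= t1 -> t1 <= s2 -> s2 <= t2 ->
  sqnorm (fun j s => row_entry j s * (a * \1_(`]s1, t1]) s + b * \1_(`]s2, t2]) s)) =
  (a ^+ 2 * (row_clock t1 - row_clock s1) + b ^+ 2 * (row_clock t2 - row_clock s2))%:E.
Proof.
move=> s10 st1 ts st2.
have t10 : 0 <= t1 by exact: le_trans st1.
have s20 : 0 <= s2 by exact: le_trans ts.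
pose rho s : R := a ^+ 2 * \1_(`]s1, t1]) s + b ^+ 2 * \1_(`]s2, t2]) s.
have rho0 s : 0 <= rho s by rewrite addr_ge0// mulr_ge0 ?sqr_ge0.
have m1 : measurable_fun setT (fun s : R => \1_(`]s1, t1]) s : R) by exact: measurable_indic.
have m2 : measurable_fun setT (fun s : R => \1_(`]s2, t2]) s : R) by exact: measurable_indic.
have mrho : measurable_fun setT rho by apply: measurable_funD; exact: measurable_funM.
have mrow : measurable_fun setT (fun s => \sum_j row_entry j s ^+ 2).
  exact: continuous_measurable_fun.
have E j s : (row_entry j s * (a * \1_(`]s1, t1]) s + b * \1_(`]s2, t2]) s)) ^+ 2 =
    row_entry j s ^+ 2 * rho s.
  rewrite exprMn /rho; congr (_ * _); rewrite !indicE.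
  have [x1|_] := boolP (s \in (`]s1, t1]%classic : set R)); last first.
    by case: (s \in _); rewrite !mulr0 !add0r ?mulr1 ?mulr0// expr0n.
  rewrite memNset ?mulr0 ?addr0 ?mulr1//= in_itv/= => /andP[x2 _].
  by move: x1; rewrite inE/= in_itv/= => /andP[_ x1]; move: (lt_le_trans x2 x1); rewrite ltNge ts.
rewrite /sqnorm; under eq_bigr do under eq_integral do rewrite E.
have mj j : measurable_fun setT (fun s => row_entry j s ^+ 2 * rho s).
  by apply: measurable_funM => //; apply: measurable_funX; exact: continuous_measurable_fun.
have j0 j s : 0 <= row_entry j s ^+ 2 * rho s by apply: mulr_ge0; [exact: sqr_ge0|exact: rho0].
have := integral_ge0_sumr lebesgue_measure mj j0; rewrite /sqnorm => <-.
pose row s := \sum_j row_entry j s ^+ 2.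
have mi1 : measurable_fun setT (fun s => row s * \1_(`]s1, t1]) s) by exact: measurable_funM.
have mi2 : measurable_fun setT (fun s => row s * \1_(`]s2, t2]) s) by exact: measurable_funM.
have i10 s : 0 <= row s * \1_(`]s1, t1]) s by apply: mulr_ge0; [exact: row0|].
have i20 s : 0 <= row s * \1_(`]s2, t2]) s by apply: mulr_ge0; [exact: row0|].
transitivity (\int[lebesgue_measure]_s ((a ^+ 2 * (row s * \1_(`]s1, t1]) s))%:E +
    (b ^+ 2 * (row s * \1_(`]s2, t2]) s))%:E))%E.
  by apply: eq_integral => s _; rewrite -EFinD -mulr_suml -/(row s) /rho; congr EFin; ring.
have ma : measurable_fun setT (fun s => (a ^+ 2 * (row s * \1_(`]s1, t1]) s))%:E).
  by apply/measurable_EFinP; exact: measurable_funM.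
have mb : measurable_fun setT (fun s => (b ^+ 2 * (row s * \1_(`]s2, t2]) s))%:E).
  by apply/measurable_EFinP; exact: measurable_funM.
have a0 s : [set: R] s -> (0 <= (a ^+ 2 * (row s * \1_(`]s1, t1]) s))%:E)%E.
  by move=> _; rewrite lee_fin; apply: mulr_ge0; [exact: sqr_ge0|].
have b0 s : [set: R] s -> (0 <= (b ^+ 2 * (row s * \1_(`]s2, t2]) s))%:E)%E.
  by move=> _; rewrite lee_fin; apply: mulr_ge0; [exact: sqr_ge0|].
rewrite (ge0_integralD lebesgue_measure measurableT a0 ma b0 mb).
rewrite (integral_ge0Zl lebesgue_measure (sqr_ge0 a) mi1 i10).
rewrite (integral_ge0Zl lebesgue_measure (sqr_ge0 b) mi2 i20).
by rewrite !row_clock_itv.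
Qed.

(** The increments over disjoint intervals are integrals of functions with
    disjoint supports, so the variance of a combination has no cross term. *)
Lemma noise_joint_mgf (a b s1 t1 s2 t2 : R) : 0 <= s1 -> s1 <= t1 -> t1 <= s2 -> s2 <= t2 ->
  (\int[P]_w (expR (a * (M t1 w i 0 - M s1 w i 0) + b * (M t2 w i 0 - M s2 w i 0)))%:E =
  (expR ((a ^+ 2 * (row_clock t1 - row_clock s1) + b ^+ 2 * (row_clock t2 - row_clock s2)) / 2))%:E)%E.
Proof.
move=> s10 st1 ts st2.
have t10 : 0 <= t1 by exact: le_trans st1.
have s20 : 0 <= s2 by exact: le_trans ts.
have t20 : 0 <= t2 by exact: le_trans st2.
have w1 := wiener_integral_lin BM 1 (-1) (wiener_noise t10) (wiener_noise s10).
have w2 := wiener_integral_lin BM 1 (-1) (wiener_noise t20) (wiener_noise s20).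
have := wiener_mgf BM (wiener_integral_lin BM a b w1 w2).
have ind (s t u : R) : 0 <= s -> s <= t ->
    \1_(`[0, t]) u - \1_(`[0, s]) u = \1_(`]s, t]) u :> R.
  move=> s0 st; rewrite !indicE.
  have itvE (J : interval R) : (u \in ([set` J] : set R)) = (u \in J).
    by apply/idP/idP; rewrite inE.
  rewrite !itvE !in_itv/=.
  have [u0|u0] := leP 0 u; last first.
    by rewrite (_ : (s < u) = false) ?subrr//; apply/negbTE; rewrite -leNgt (le_trans (ltW u0)).
  have [us|us] := leP u s; first by rewrite (le_trans us st) subrr.
  by rewrite subr0.
rewrite (_ : (fun j s => _) = (fun j s => row_entry j s *
   (a * \1_(`]s1, t1]) s + b * \1_(`]s2, t2]) s))); last first.
  apply/funext => j; apply/funext => s; rewrite -(ind s1)// -(ind s2)//; ring.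
move=> /(_ _ (sqnorm_two_blocks a b s10 st1 ts st2)) <-.
by apply: eq_integral => w _; rewrite !mul1r !mulN1r.
Qed.

Lemma measurable_noise t : 0 <= t -> measurable_fun setT (fun w => M t w i 0).
Proof. by move=> t0; have [] := wiener_noise t0. Qed.

Lemma noise_gaussian_mgf s t : 0 <= s -> s <= t ->
  gaussian_mgf P (fun w => M t w i 0 - M s w i 0) (row_clock t - row_clock s).
Proof.
move=> s0 st; have t0 := le_trans s0 st; split.
  by apply: measurable_funB; exact: measurable_noise.
move=> a; have := noise_joint_mgf a 0 s0 st (lexx t) (lexx t).
rewrite expr0n/= mul0r addr0 => <-.
by apply: eq_integral => w _; rewrite mul0r addr0.
Qed.

End noise.

(** * Small noise from summable blocks *)

Section summable_blocks.
Context {R : realType} (v : nat -> R).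

Definition block_term (e : R) (n : nat) : R := Num.sqrt (v n) * expR (- (e / v n)).

Lemma block_term_ge0 e n : 0 <= block_term e n.
Proof. by rewrite mulr_ge0 ?sqrtr_ge0 ?expR_ge0. Qed.

(** The terms of a convergent series tend to 0, and
    [sqrt v * expR (- (e / v))] is bounded below for [v > rho]. *)
Lemma block_variance_cvg0 e : 0 < e ->
  (\sum_(0 <= n <oo) (block_term e n)%:E < +oo)%E ->
  forall rho, 0 < rho -> exists N, forall n, (N <= n)%N -> v n <= rho.
Proof.
move=> e0 fin rho rho0.
have nn n : (0 <= (block_term e n)%:E)%E by rewrite lee_fin block_term_ge0.
pose c0 := Num.sqrt rho * expR (- (e / rho)).
have c00 : 0 < c0 by rewrite mulr_gt0 ?sqrtr_gt0 ?expR_gt0.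
have c02 : 0 < c0 / 2 by lra.
have := nneseries_tail_cvg fin (fun k _ => nn k).
move=> /(cvge0_near_le c02)[N _ HN]; exists N => n Nn.
have := HN n Nn; have /= := nneseries_lim_ge n.+1 (fun k (_ : (n <= k)%N) (_ : true) => nn k).
rewrite big_nat1 => /le_trans h /h; rewrite lee_fin => tle.
rewrite leNgt; apply/negP => rv.
have vp : 0 < v n by exact: lt_trans rv.
suff : c0 <= block_term e n by lra.
apply: ler_pM; [exact: sqrtr_ge0|exact: expR_ge0|by rewrite ler_wsqrtr// ltW|].
rewrite ler_expR lerN2 ler_wpM2l ?(ltW e0)//.
by rewrite lef_pV2 ?posrE// ltW.
Qed.

(** The clock of a block is its variance plus a linear part of total size
    [dl = e0 / n.+1], which makes it strictly increasing. If the variance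
    dominates, the exponential is compared with the series at the cost of a
    factor 2 in the exponent, of which half absorbs the missing factor
    [sqrt v1]. If the linear part dominates, [dl] is small enough for a geometric
    bound. *)
Lemma expR_shifted_variance_le (e0 v1 dl : R) n : 0 < e0 -> 0 <= v1 -> v1 <= 1 -> dl = e0 / n.+1%:R ->
  expR (- (2 * e0 / (v1 + dl))) <=
  2 / e0 * (Num.sqrt v1 * expR (- (e0 / 2 / v1))) + 1 / (2 ^ n.+1)%:R.
Proof.
move=> e00 v10 v11 dlE.
have dl0 : 0 < dl by rewrite dlE divr_gt0.
have t0 : 0 <= 2 / e0 * (Num.sqrt v1 * expR (- (e0 / 2 / v1))).
  by rewrite !mulr_ge0 ?sqrtr_ge0 ?expR_ge0 ?invr_ge0 ?(ltW e00).
have half x : 0 < x -> v1 + dl <= 2 * x -> e0 / x <= 2 * e0 / (v1 + dl).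
  move=> x0 vx; rewrite ler_pdivlMr; last by lra.
  have -> : 2 * e0 = e0 / x * (2 * x) by field; rewrite gt_eqF.
  by rewrite ler_pM2l// divr_gt0.
have [vd|dv] := leP v1 dl.
  apply: (@le_trans _ _ (expR (- (e0 / dl)))).
    rewrite ler_expR lerN2; apply: half => //; lra.
  have -> : e0 / dl = n.+1%:R by rewrite dlE invf_div mulrC divfK ?gt_eqF.
  apply: (@le_trans _ _ (1 / (2 ^ n.+1)%:R)); last lra.
  rewrite div1r natrX -exprVn expRN -[n.+1%:R]mulr1 expRM_natl -exprVn.
  rewrite lerXn2r ?nnegrE ?invr_ge0 ?expR_ge0// lef_pV2 ?posrE ?expR_gt0//.
  by have := expR_ge1Dx (1 : R).
have vp : 0 < v1 by exact: lt_trans dv.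
apply: (@le_trans _ _ (2 / e0 * (Num.sqrt v1 * expR (- (e0 / 2 / v1)))));
  last by rewrite lerDl divr_ge0.
apply: (@le_trans _ _ (expR (- (e0 / v1)))).
  rewrite ler_expR lerN2; apply: half => //; lra.
have -> : expR (- (e0 / v1)) = expR (- (e0 / 2 / v1)) * expR (- (e0 / 2 / v1)).
  by rewrite -expRD; congr expR; field; rewrite gt_eqF.
rewrite mulrA ler_pM2r ?expR_gt0//.
have h1 : expR (- (e0 / 2 / v1)) <= 2 / e0 * v1.
  have -> : 2 / e0 * v1 = (e0 / 2 / v1)^-1 by field; rewrite ?gt_eqF.
  rewrite expRN lef_pV2 ?posrE ?expR_gt0 ?divr_gt0//.
  by have := expR_ge1Dx (e0 / 2 / v1); lra.
apply: le_trans h1 _; rewrite ler_pM2l ?divr_gt0//.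
rewrite -{1}(sqr_sqrtr v10) expr2 -[leRHS]mul1r ler_wpM2r ?sqrtr_ge0//.
by rewrite -[leRHS]sqrtr1 ler_wsqrtr.
Qed.

End summable_blocks.

Section oscillation.
Context {R : realType} (dd : measure_display) (T : measurableType dd)
  (P : probability T R) (d r : nat) (W : R -> T -> 'cV[R]_r).
Hypotheses (BM : standard_brownian_motion P W) (hP : measure_is_complete P).
Variables (Sigma : R -> 'M[R]_(d, r)) (M : R -> T -> 'cV[R]_d) (i : 'I_d).
Hypotheses (cSigma : continuous_on_ge0 Sigma)
  (hM : forall t : R, 0 <= t -> is_ito_integral_mx P W Sigma t (M t)).

Let clk := row_clock Sigma i.

Definition clock_block (n : nat) : R := row_clock Sigma i n.+1%:R - row_clock Sigma i n%:R.

Lemma clock_block_ge0 n : 0 <= clock_block n.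
Proof. by rewrite subr_ge0; apply: row_clock_mono => //; rewrite ler_nat. Qed.

Lemma S_series_clock e :
  S_series Sigma i e = (\sum_(0 <= n <oo) (block_term clock_block e n)%:E)%E.
Proof.
rewrite /S_series -(@nneseries_addn _ _ 1%N).
  by apply: eq_eseriesr => n _; rewrite addn1 (block_variance_clock _ cSigma).
by move=> n; rewrite lee_fin mulr_ge0 ?sqrtr_ge0 ?expR_ge0.
Qed.

(** The chaining bound for the clock [row_clock t + dl * t]. The numerical
    assumptions keep [kappa = eta ^+ 2 / (32 * C)] at least 24, where [C] is the
    block variance plus [dl]. *)
Lemma noise_block_bound (eta : R) (n : nat) : 0 < eta ->
  clock_block n <= 1 -> clock_block n <= eta ^+ 2 / 1536 -> (24 <= n.+1)%N ->
  exists E : set T, [/\ measurable E,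
    (P E <= (4 * (2 / (eta ^+ 2 / 64) * block_term clock_block (eta ^+ 2 / 64 / 2) n + 1 / (2 ^ n.+1)%:R))%:E)%E
    & forall w, ~ E w -> {within `[0, +oo[, continuous (fun t => M t w i 0)} ->
      forall t, n%:R <= t <= n.+1%:R -> `|M t w i 0 - M n%:R w i 0| <= eta].
Proof.
move=> eta0 v1 v2 n24.
set e0 := eta ^+ 2 / 64.
have e20 : 0 < eta ^+ 2 by rewrite exprn_gt0.
have e00 : 0 < e0 by rewrite divr_gt0.
pose dl := e0 / n.+1%:R.
have dl0 : 0 < dl by rewrite divr_gt0.
pose c t := row_clock Sigma i t + dl * t.
have nn : (n%:R : R) < n.+1%:R by rewrite ltr_nat.
have n0 : (0 : R) <= n%:R by [].
have CE : c n.+1%:R - c n%:R = clock_block n + dl.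
  by rewrite /c /clock_block (mulrSr _ n); ring.
have cincr s t : n%:R <= s -> s < t -> t <= n.+1%:R -> clk t - clk s < c t - c s.
  move=> ns st tn; have -> : c t - c s = clk t - clk s + dl * (t - s).
    by rewrite /c /clk; ring.
  by rewrite ltrDl mulr_gt0// subr_gt0.
have cmono s t : n%:R <= s -> s < t -> t <= n.+1%:R -> c s < c t.
  move=> ns st tn; rewrite -subr_gt0; apply: le_lt_trans (cincr s t ns st tn).
  by rewrite subr_ge0; apply: row_clock_mono => //; [exact: le_trans ns|exact: ltW].
have cc : {within `[n%:R, n.+1%:R], continuous c}.
  apply: continuous_in_subspaceT => t; rewrite inE/= in_itv/= => /andP[nt _].
  apply: cvgD; first by apply: continuous_row_clock => //; exact: le_trans nt.
  by apply: cvgM; [exact: cvg_cst|exact: cvg_id].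
have mS t : n%:R <= t <= n.+1%:R -> measurable_fun setT (fun w => M t w i 0).
  by move=> /andP[nt _]; apply: (measurable_noise BM hP i cSigma hM); exact: le_trans nt.
have tail s t x : n%:R <= s -> s < t -> t <= n.+1%:R -> 0 <= x ->
    (P [set w | (x <= `|M t w i 0 - M s w i 0|)%R] <=
      (2 * expR (- (x ^+ 2 / (2 * (c t - c s)))))%:E)%E.
  move=> ns st tn x0; have s0 := le_trans n0 ns.
  apply: (gaussian_tail_norm (noise_gaussian_mgf BM hP i cSigma hM s0 (ltW st))) => //.
    exact: ltW (cincr s t ns st tn).
  by rewrite subr_gt0 cmono.
have dl24 : dl <= eta ^+ 2 / 1536.
  rewrite /dl /e0 ler_pdivrMr//.
  have : 24 <= (n.+1%:R : R) by rewrite (ler_nat R 24).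
  move=> h; have : eta ^+ 2 / 1536 * 24 <= eta ^+ 2 / 1536 * n.+1%:R.
    apply: ler_wpM2l h; lra.
  lra.
have C0 : 0 < clock_block n + dl by have := clock_block_ge0 n; lra.
have k24 : 24 <= eta ^+ 2 / (32 * (c n.+1%:R - c n%:R)).
  by rewrite CE ler_pdivlMr ?mulr_gt0//; lra.
have [E [mE PE HE]] := chaining_maximal_bound nn cc cmono mS tail eta0 k24.
exists E; split => //.
  apply: le_trans PE _; rewrite lee_fin ler_pM2l//.
  have := expR_shifted_variance_le e00 (clock_block_ge0 n) v1 (erefl : dl = e0 / n.+1%:R).
  congr (_ <= _); congr (expR (- _)); rewrite CE /e0; field.
  by rewrite gt_eqF.
move=> w nE cw; apply: HE => //.
apply: continuous_subspaceW cw => t /=; rewrite !in_itv/= andbT => /andP[nt _].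
exact: le_trans nt.
Qed.

(** Borel-Cantelli over the blocks. *)
Lemma noise_block_ae (eta : R) : 0 < eta ->
  (forall e, 0 < e -> (S_series Sigma i e < +oo)%E) ->
  {ae P, forall w, {within `[0, +oo[, continuous (fun t => M t w i 0)}} ->
  {ae P, forall w, exists N, forall n, (N <= n)%N ->
     forall t, n%:R <= t <= n.+1%:R -> `|M t w i 0 - M n%:R w i 0| <= eta}.
Proof.
move=> eta0 hS hc.
have {}hS e : 0 < e -> (\sum_(0 <= n <oo) (block_term clock_block e n)%:E < +oo)%E.
  by move=> /hS; rewrite S_series_clock.
have e20 : 0 < eta ^+ 2 by rewrite exprn_gt0.
have [N1 HN1] := block_variance_cvg0 ltr01 (hS 1 ltr01) ltr01.
have [N2 HN2] := block_variance_cvg0 ltr01 (hS 1 ltr01)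
  (ltac:(lra) : 0 < eta ^+ 2 / 1536).
pose N := maxn N1 (maxn N2 24).
pose e0 := eta ^+ 2 / 64.
have e00 : 0 < e0 by rewrite divr_gt0.
pose u n := 4 * (2 / e0 * block_term clock_block (e0 / 2) n + 1 / (2 ^ n.+1)%:R).
have bt0 e n : 0 <= block_term clock_block e n by apply: block_term_ge0.
have u0 n : 0 <= u n.
  by rewrite mulr_ge0// addr_ge0 ?divr_ge0// mulr_ge0// divr_ge0// ltW.
have /choice[E HE] : forall n, exists E : set T, [/\ measurable E, (P E <= (u n)%:E)%E
    & (N <= n)%N -> forall w, ~ E w -> {within `[0, +oo[, continuous (fun t => M t w i 0)} ->
      forall t, n%:R <= t <= n.+1%:R -> `|M t w i 0 - M n%:R w i 0| <= eta].
  move=> n; have [Nn|nN] := leqP N n; last first.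
    by exists set0; split => //; rewrite measure0 lee_fin.
  move: Nn; rewrite !geq_max => /and3P[n1 n2 n24].
  have [E [mE PE HE]] := noise_block_bound eta0 (HN1 n n1) (HN2 n n2) (leqW n24).
  by exists E.
have mE n : measurable (E n) by case: (HE n).
have sumu : (\sum_(0 <= n <oo) (u n)%:E < +oo)%E.
  have -> : (\sum_(0 <= n <oo) (u n)%:E =
      (8 / e0)%:E * (\sum_(0 <= n <oo) (block_term clock_block (e0 / 2) n)%:E) +
      \sum_(0 <= n <oo) (4 / (2 ^ n.+1)%:R)%:E)%E.
    rewrite -nneseriesZl; last by move=> n _; rewrite lee_fin.
    rewrite -nneseriesD.
    - apply: eq_eseriesr => n _; rewrite -EFinM -EFinD /u; congr EFin.
      by field; rewrite ?gt_eqF.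
    - by move=> n _ _; rewrite -EFinM lee_fin mulr_ge0// divr_ge0// ltW.
    - by move=> n _ _; rewrite lee_fin divr_ge0.
  apply: lte_add_pinfty.
    by apply: lte_mul_pinfty => //; [rewrite lee_fin divr_ge0// ltW|apply: hS; rewrite divr_gt0].
  exact: le_lt_trans (epsilon_trick0 xpredT (ler0n R 4)) (ltry _).
have limsup0 : P (lim_sup_set E) = 0%E.
  apply: lim_sup_set_cvg0 => //; apply: le_lt_trans sumu.
  by apply: lee_nneseries => [n _ _|n _]; [exact: measure_ge0|case: (HE n)].
have aelim : {ae P, forall w, ~ lim_sup_set E w}.
  exists (lim_sup_set E); split => //.
    apply: bigcap_measurable => // n _.
    by apply: bigcup_measurable.
  by move=> w /= /contrapT.
apply: filterS2 hc aelim => w cw nl.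
move: nl => /existsNP[N' /not_implyP[_ nl]].
exists (maxn N N') => n; rewrite geq_max => /andP[Nn N'n] t tn.
have [_ _ /(_ Nn w)] := HE n; apply => //.
by move=> Ew; apply: nl; exists n.
Qed.

Lemma noise_oscillation :
  (forall e, 0 < e -> (S_series Sigma i e < +oo)%E) ->
  {ae P, forall w, {within `[0, +oo[, continuous (fun t => M t w i 0)}} ->
  {ae P, forall w, forall e : R, 0 < e -> exists N : R, forall t s : R, N <= t ->
     t - 1 <= s <= t -> `|M t w i 0 - M s w i 0| <= e}.
Proof.
move=> hS hc.
have /ae_foralln : forall k : nat, {ae P, forall w, exists N, forall n, (N <= n)%N ->
     forall t, n%:R <= t <= n.+1%:R -> `|M t w i 0 - M n%:R w i 0| <= k.+1%:R^-1}.
  by move=> k; apply: noise_block_ae => //; rewrite invr_gt0.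
apply: filterS => w H e e0.
(* The times s and t lie in the same block or in two adjacent ones, and three
   differences of size at most e / 3 connect them. *)
pose k := Num.bound (3 / e).
have ke : k.+1%:R^-1 <= e / 3.
  rewrite -[e / 3]invrK invf_div lef_pV2 ?posrE ?divr_gt0//.
  have : 3 / e < k%:R by apply: archi_boundP; rewrite divr_ge0// ltW.
  by rewrite mulrSr; lra.
have [N] := H k.
move: ke; move: (k.+1%:R^-1) => x xe HN.
exists (N%:R + 1) => t s Nt /andP[s1 s2].
have Ns : N%:R <= s by lra.
have s0 : 0 <= s by apply: le_trans Ns.
have t0 : 0 <= t by exact: le_trans s2.
have /andP[n1 n2] := truncn_itv s0; have /andP[m1 m2] := truncn_itv t0.
set n := Num.truncn s in n1 n2; set m := Num.truncn t in m1 m2.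
have Nn : (N <= n)%N by rewrite truncn_ge_nat.
have nm : (n <= m)%N by exact: le_truncn.
have Nm := leq_trans Nn nm.
have h1 := HN n Nn s ltac:(by rewrite n1 ltW).
have h2 := HN m Nm t ltac:(by rewrite m1 ltW).
have [mn|mn] := eqVneq m n.
  rewrite mn in h2; rewrite distrC in h1.
  have := ler_distD (M n%:R w i 0) (M t w i 0) (M s w i 0); lra.
have mE : m = n.+1.
  have mn2 : (m < n.+2)%N.
    by rewrite -(ltr_nat R) (mulrSr _ n.+1); apply: le_lt_trans m1 _; lra.
  by apply/eqP; rewrite eqn_leq -ltnS mn2 ltn_neqAle eq_sym mn.
have h3 := HN n Nn n.+1%:R ltac:(by rewrite lexx ler_nat leqnSn).
rewrite mE in h2; rewrite distrC in h1.
have := ler_distD (M n.+1%:R w i 0) (M t w i 0) (M s w i 0).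
have := ler_distD (M n%:R w i 0) (M n.+1%:R w i 0) (M s w i 0).
lra.
Qed.

End oscillation.

(** * Summable blocks from small noise *)

Section necessity.
Context {R : realType} (dd : measure_display) (T : measurableType dd)
  (P : probability T R).

Definition tends0 (x : nat -> R) := forall e, 0 < e -> exists N, forall n, (N <= n)%N -> `|x n| <= e.

(** The upper limit of events of probability at least [c] has probability at
    least [c]. *)
Lemma not_ae_eventually_avoids (E : nat -> set T) (c : R) : 0 < c ->
  (forall n, measurable (E n)) -> (forall n, (c%:E <= P (E n))%E) ->
  ~ {ae P, forall w, exists N, forall n, (N <= n)%N -> ~ E n w}.
Proof.
move=> c0 mE cE [N [mN PN sub]].
have mU n : measurable (\bigcup_(k in [set k | (n <= k)%N]) E k) by apply: bigcup_measurable.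
have limN : lim_sup_set E `<=` N.
  move=> w Ew; apply: sub => -[K HK].
  by have [n Kn En] := Ew K I; exact: HK n Kn En.
have lim0 : P (lim_sup_set E) = 0%E.
  apply/eqP; rewrite eq_le measure_ge0 andbT -PN; apply: le_measure; rewrite ?inE//.
  exact: bigcap_measurable.
have Hc : P (\bigcup_(k in [set k | (n <= k)%N]) E k) @[n --> \oo] --> 0%E.
  rewrite -lim0; apply: lim_sup_set_cvg => //.
  by apply: le_lt_trans (probability_le1 _ _) (ltry _).
have c2 : 0 < c / 2 by rewrite divr_gt0.
have [n _ /(_ n (leqnn n))] := cvge0_near_le c2 Hc.
move=> /= Pn; have : (P (E n) <= P (\bigcup_(k in [set k | (n <= k)%N]) E k))%E.
  apply: le_measure; rewrite ?inE//.
  by move=> w Ew; exists n => /=.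
move=> /le_trans /(_ Pn) /(le_trans (cE n)); rewrite lee_fin; lra.
Qed.

(** With probability bounded below, a centred Gaussian variable is at least
    [- (e / 2)], and likewise at most [e / 2], so it does not cancel a shift of
    size [e]. *)
Lemma vanishing_gaussian_means (J : nat -> T -> R) (v m : nat -> R) (e : R) : 0 < e ->
  (forall n, gaussian_mgf P (J n) (v n)) -> (forall n, 0 <= v n) ->
  (forall n, e <= `|m n|) -> ~ {ae P, forall w, tends0 (fun n => m n + J n w)}.
Proof.
move=> e0 gJ v0 em h.
pose E n := [set w | e / 2 <= `|m n + J n w|].
have mJ n : measurable_fun setT (J n) by have [] := gJ n.
have c0 : 0 < expR (- 4) / 4 :> R by rewrite divr_gt0 ?expR_gt0.
have e2 : 0 < e / 2 by rewrite divr_gt0.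
apply: (@not_ae_eventually_avoids E _ c0).
- move=> n; apply: measurable_ge_set; apply: measurableT_comp => //.
  exact: measurable_funD.
- have mE n : measurable (E n).
    by apply: measurable_ge_set; apply: measurableT_comp => //; exact: measurable_funD.
  move=> n; have [m0|m0] := leP 0 (m n).
    apply: le_trans (gaussian_ge_neg (gJ n) (v0 n) e2) _.
    apply: le_measure; rewrite ?inE//; first exact: measurable_ge_set.
    move=> w /= h1; have := em n; rewrite ger0_norm// => h2.
    by apply: le_trans (ler_norm _); lra.
  apply: le_trans (gaussian_ge_neg (gaussian_mgfN (gJ n)) (v0 n) e2) _.
  apply: le_measure; rewrite ?inE//.
    by apply: measurable_ge_set; exact: measurable_funN.
  move=> w /= h1; have := em n; rewrite ltr0_norm// => h2.
  by rewrite /E/= -normrN; apply: le_trans (ler_norm _); lra.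
- apply: filterS h => w /(_ (e / 4)) [|N HN]; first by rewrite divr_gt0.
  by exists N => n /HN h1 /=; rewrite /E/= => h2; lra.
Qed.

Lemma vanishing_gaussian_variances (J : nat -> T -> R) (v : nat -> R) (e : R) : 0 < e ->
  (forall n, gaussian_mgf P (J n) (v n)) -> (forall n, e <= v n) ->
  ~ {ae P, forall w, tends0 (fun n => J n w)}.
Proof.
move=> e0 gJ ev h.
have s0 : 0 < Num.sqrt e / 2 by rewrite divr_gt0 ?sqrtr_gt0.
pose E n := [set w | Num.sqrt e / 2 <= J n w].
have mJ n : measurable_fun setT (J n) by have [] := gJ n.
have c0 : 0 < expR (- 4) / 4 :> R by rewrite divr_gt0 ?expR_gt0.
apply: (@not_ae_eventually_avoids E _ c0).
- by move=> n; exact: measurable_ge_set.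
- move=> n; have vp : 0 < v n by exact: lt_le_trans (ev n).
  apply: le_trans (gaussian_ge_sqrt (gJ n) vp) _.
  apply: le_measure; rewrite ?inE//; try exact: measurable_ge_set.
  move=> w /=; apply: le_trans; rewrite ler_pM2r//; apply: ler_wsqrtr; exact: ev.
- apply: filterS h => w /(_ (Num.sqrt e / 4)) [|N HN]; first by rewrite divr_gt0 ?sqrtr_gt0.
  exists N => n /HN h1 /=; rewrite /E/= => h2.
  by have := le_trans h2 (ler_norm _); lra.
Qed.

(** Some event [G K], that [D n <= k / 4] for all [n >= K], has positive
    probability, so the second moment bound keeps the partial sums of
    [expR (- (k ^+ 2 / v n))] below [4 / P (G K)]; here [k ^+ 2 = e]. *)
Lemma summable_of_vanishing_blocks (D : nat -> T -> R) (v : nat -> R) (e : R) : 0 < e ->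
  (forall n, gaussian_mgf P (D n) (v n)) -> (forall n, 0 <= v n) ->
  (forall n m a b, n != m -> (\int[P]_w (expR (a * D n w + b * D m w))%:E =
     (expR ((a ^+ 2 * v n + b ^+ 2 * v m) / 2))%:E)%E) ->
  {ae P, forall w, tends0 (fun n => D n w)} -> tends0 v ->
  (\sum_(0 <= n <oo) (block_term v e n)%:E < +oo)%E.
Proof.
move=> e0 gD v0 jD aeD vto0.
pose k := Num.sqrt e.
have k0 : 0 < k by rewrite sqrtr_gt0.
have kE : k ^+ 2 = e by rewrite sqr_sqrtr// ltW.
have [N1 HN1] := vto0 _ (ltr01).
have [N2 HN2] : exists N, forall n, (N <= n)%N -> `|v n| <= k ^+ 2 / 4.
  by apply: vto0; rewrite divr_gt0// exprn_gt0.
have mD n : measurable_fun setT (D n) by have [] := gD n.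
pose G K := \bigcap_(n in [set n | (K <= n)%N]) [set w | D n w <= k / 4].
have mle n : measurable [set w | D n w <= k / 4].
  have := @measurable_ge_set R dd T (fun w => - D n w) (- (k / 4)) (measurable_funN (mD n)).
  by congr measurable; apply/seteqP; split => w /=; rewrite lerN2.
have mG K : measurable (G K) by apply: bigcap_measurable => //; exists K => /=.
(* Otherwise D n would exceed k / 4 infinitely often almost surely. *)
have [K0 PK0] : exists K, P (G K) <> 0%E.
  apply: contrapT => /forallNP H.
  have nG K : P.-negligible (G K).
    by exists (G K); split => //; apply: contrapT; exact: H.
  have : {ae P, forall w, forall K, ~ G K w}.
    by apply: ae_foralln => K; apply: negligibleS (nG K) => w /= /contrapT.
  move=> h; have : {ae P, forall w : T, False}.
    have k4 : 0 < k / 4 by rewrite divr_gt0.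
    apply: filterS2 aeD h => w /(_ _ k4) [K HK] nGw.
    by apply: (nGw K) => n /= Kn; apply: le_trans (ler_norm _) (HK n Kn).
  move=> [N [mN PN sub]].
  have : P setT = 0%E.
    by apply/eqP; rewrite eq_le measure_ge0 andbT -PN; apply: le_measure; rewrite ?inE// => w _; exact: sub.
  by rewrite probability_setT => /eqP; rewrite onee_eq0.
pose K := maxn K0 (maxn N1 N2).
have PK : (0 < P (G K))%E.
  apply: (@lt_le_trans _ _ (P (G K0))).
    by rewrite lt_neqAle measure_ge0 andbT eq_sym; apply/eqP.
  apply: le_measure; rewrite ?inE// => w h n /= Kn; apply: h => /=.
  exact: leq_trans (leq_maxl _ _) Kn.
have vK n : (K <= n)%N -> v n <= 1 /\ v n <= k ^+ 2 / 4.
  rewrite !geq_max => /and3P[_ n1 n2]; split.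
    by apply: le_trans (ler_norm _) (HN1 n n1).
  by apply: le_trans (ler_norm _) (HN2 n n2).
pose p n := if v n == 0 then 0 else expR (- (k ^+ 2 / v n)).
have : P (G K) \is a fin_num by exact: fin_num_measure.
move=> /fineK; set g := fine _ => gE.
have g0 : 0 < g by rewrite -lte_fin gE.
have sump L : \sum_(l < L) p (K + l)%N <= 4 / g.
  rewrite ler_pdivlMr// -lee_fin EFinM gE.
  apply: (@second_moment_bound _ _ _ P 'I_L (fun l => D (K + l)%N) (fun l => v (K + l)%N) k) => //.
  - by move=> l; rewrite v0/=; case: (vK (K + l)%N (leq_addr _ _)).
  - by move=> l l' a b ll'; apply: jD; rewrite eqn_add2l.
  - by move=> w l; apply => /=; exact: leq_addr.
have tp n : (K <= n)%N -> block_term v e n <= p n.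
  move=> /vK[v1 _]; rewrite /block_term /p kE; case: eqP => [->|_].
    by rewrite sqrtr0 mul0r.
  by rewrite ler_piMl ?expR_ge0// -[leRHS]sqrtr1 ler_wsqrtr.
have t0 n : (0 <= (block_term v e n)%:E)%E by rewrite lee_fin block_term_ge0.
rewrite (nneseries_split 0 K)//.
apply: lte_add_pinfty; first by rewrite sumEFin ltry.
rewrite add0n; apply: (@le_lt_trans _ _ (4 / g)%:E); last exact: ltry.
apply: lime_le; first by apply: is_cvg_nneseries => n _ _.
near=> L; have KL : (K <= L)%N by near: L; exact: nbhs_infty_ge.
rewrite -{1}(add0n K) big_addn big_mkord sumEFin lee_fin.
apply: le_trans (sump (L - K)%N); apply: ler_sum => l _.
by rewrite addnC; apply: tp; exact: leq_addr.
Unshelve. all: by end_near. Qed.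

End necessity.

(** * From the equation to its driving path *)

Section paths.
Context {R : realType} (d : nat) (q : R) (A B : 'M[R]_d).
Hypotheses (q0 : 0 < q) (q1 : q < 1).

Definition ext_ge0 {V : Type} (g : R -> V) (t : R) : V := g (Num.max 0 t).

Lemma ext_ge0E {V : Type} (g : R -> V) t : 0 <= t -> ext_ge0 g t = g t.
Proof. by move=> t0; rewrite /ext_ge0 max_r. Qed.

Lemma continuous_coord (x : R -> 'cV[R]_d) i : continuous x -> continuous (fun s => x s i 0).
Proof. by move=> cx s; move/continuous_colP: (cx s) => /(_ i). Qed.

(** The path with its drift removed. It is defined from the path alone, so it is
    continuous wherever the path is, and it equals the sum of the deterministic
    and the random forcing. *)
Definition driver (xi : 'cV[R]_d) (x : R -> 'cV[R]_d) (t : R) : 'cV[R]_d :=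
  ext_ge0 x t - (xi + (col_prim (drift q A B (ext_ge0 x)) (Num.max 0 t) -
                       col_prim (drift q A B (ext_ge0 x)) 0)).

Lemma driverE xi x t : 0 <= t -> ext_ge0 x t =
  xi + (col_prim (drift q A B (ext_ge0 x)) t - col_prim (drift q A B (ext_ge0 x)) 0) + driver xi x t.
Proof. by move=> t0; rewrite /driver max_r// addrC subrK. Qed.

Lemma continuous_max0 (t : R) : (Num.max 0 s : R) @[s --> t] --> (Num.max 0 t : R).
Proof.
apply: (@continuous_ext_ge0 R R id); apply: continuous_subspaceT => s; exact: cvg_id.
Qed.

Lemma continuous_col_prim (x : R -> 'cV[R]_d) t : continuous x -> 0 <= t ->
  {for t, continuous (col_prim x)}.
Proof.
move=> cx t0; apply: differentiable_continuous; apply/derivable1_diffP.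
by have [] := is_derive_col_prim (t := t) cx ltac:(lra).
Qed.

Lemma continuous_driver xi x : continuous_on_ge0 x -> continuous (driver xi x).
Proof.
move=> cx t; have cex : continuous (ext_ge0 x) by exact: continuous_ext_ge0.
have t0 : 0 <= Num.max 0 t by rewrite le_max lexx.
apply: cvgB; first exact: cex.
apply: cvgD; first exact: cvg_cst.
apply: cvgB; last exact: cvg_cst.
apply: (@cvg_comp _ _ _ (fun s : R => Num.max 0 s) (col_prim _)); first exact: continuous_max0.
by apply: continuous_col_prim => //; exact: continuous_drift.
Qed.

Lemma col_integral_prim (f : R -> 'cV[R]_d) (s t : R) : continuous_on_ge0 f ->
  0 <= s -> s <= t ->
  col_integral s t f = col_prim (ext_ge0 f) t - col_prim (ext_ge0 f) s.
Proof.
move=> cf s0 st; have cef : continuous (ext_ge0 f) by exact: continuous_ext_ge0.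
apply/matrixP => i j; rewrite !mxE.
rewrite -integral_prim//; [|exact: continuous_coord|lra].
apply: eq_Rintegral => u; rewrite inE/= in_itv/= => /andP[su _].
by rewrite ext_ge0E// (le_trans s0).
Qed.

Lemma noise_of_path (f : R -> 'cV[R]_d) xi (x m : R -> 'cV[R]_d) :
  continuous_on_ge0 f -> continuous_on_ge0 x ->
  (forall t, 0 <= t -> x t = xi + col_integral 0 t (fun s =>
     B *m x s + A *m x (q * s) + f s) + m t) ->
  forall t, 0 <= t ->
    m t = driver xi x t - (col_prim (ext_ge0 f) t - col_prim (ext_ge0 f) 0).
Proof.
move=> cf cx xE t t0.
have cef : continuous (ext_ge0 f) by exact: continuous_ext_ge0.
have cex : continuous (ext_ge0 x) by exact: continuous_ext_ge0.
have cdr := @continuous_drift R d q A B (ext_ge0 x) cex.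
have IE : col_integral 0 t (fun s => B *m x s + A *m x (q * s) + f s) =
    (col_prim (drift q A B (ext_ge0 x)) t - col_prim (drift q A B (ext_ge0 x)) 0) +
    (col_prim (ext_ge0 f) t - col_prim (ext_ge0 f) 0).
  apply/matrixP => i j; rewrite !mxE.
  have h2 : (-2 : R) <= 0 by lra.
  have ci := @continuous_coord _ i cdr; have fi := @continuous_coord _ i cef.
  rewrite -(integral_prim ci h2 t0) -(integral_prim fi h2 t0).
  rewrite -(RintegralD _ (continuous_integrable 0 t ci) (continuous_integrable 0 t fi))//.
  apply: eq_Rintegral => u; rewrite inE/= in_itv/= => /andP[u0 _].
  by rewrite /drift !ext_ge0E ?mulr_ge0 ?(ltW q0)// !mxE.
have cancel (u g n p : 'cV[R]_d) : xi + (u + g) + n = xi + u + p -> n = p - g.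
  move=> E; apply: (addrI (xi + u)); rewrite addrA -E !addrA.
  by rewrite (addrAC _ n) addrK.
by have := driverE xi x t0; rewrite ext_ge0E// xE// IE; exact: cancel.
Qed.

End paths.

Lemma common_bound {R : realType} (I : finType) (Q : I -> R -> Prop) :
  (forall i, exists T, forall t, T <= t -> Q i t) ->
  exists T, forall i t, T <= t -> Q i t.
Proof.
move=> /choice[T HT]; exists (\big[Num.max/0]_i T i) => i t Tt.
by apply: HT; apply: le_trans Tt; exact: le_bigmax.
Qed.

Lemma norm_sub_le_shift {R : realType} (a b x y z e : R) :
  `|a - (x - z) - (b - (y - z))| <= e / 2 -> `|x - y| <= e / 2 -> `|a - b| <= e.
Proof.
move=> h1 h2; have -> : a - b = (a - (x - z) - (b - (y - z))) + (x - y) by ring.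
by apply: le_trans (ler_normD _ _) _; lra.
Qed.

Lemma increment_cancel {R : realType} (f1 f2 f3 y1 y2 : R) :
  f1 - f2 + (y1 - (f1 - f3) - (y2 - (f2 - f3))) = y1 - y2.
Proof. by ring. Qed.

(** * The equivalence *)

Section solution.
Context {R : realType} (q : R) (d r : nat)
    (A B : 'M[R]_d) (f : R -> 'cV[R]_d) (Sigma : R -> 'M[R]_(d, r))
    (dd : measure_display) (T : measurableType dd) (P : probability T R)
    (W : R -> T -> 'cV[R]_r) (xi : 'cV[R]_d) (X M : R -> T -> 'cV[R]_d).
Hypotheses (q0 : 0 < q) (q1 : q < 1)
    (cf : continuous_on_ge0 f) (cSigma : continuous_on_ge0 Sigma)
    (hP : measure_is_complete P) (BM : standard_brownian_motion P W)
    (hM : forall t : R, 0 <= t -> is_ito_integral_mx P W Sigma t (M t))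
    (cX : {ae P, forall om, continuous_on_ge0 (X ^~ om)})
    (XE : {ae P, forall om, forall t, 0 <= t ->
           X t om = xi + col_integral 0 t (fun s =>
                           B *m X s om + A *m X (q * s) om + f s) + M t om}).

Let F := col_prim (ext_ge0 f).

Let coordB (a b c : 'cV[R]_d) i : (a - (b - c)) i 0 = a i 0 - (b i 0 - c i 0).
Proof. by rewrite !mxE. Qed.

Let coord2 (a b : 'cV[R]_d) i : (a - b) i 0 = a i 0 - b i 0.
Proof. by rewrite !mxE. Qed.

Let noiseE : {ae P, forall om, continuous_on_ge0 (X ^~ om) /\ forall t, 0 <= t ->
  M t om = driver q A B xi (X ^~ om) t - (F t - F 0)}.
Proof.
apply: filterS2 cX XE => om cx xE; split => // t t0.
exact: (noise_of_path (A := A) (B := B) (q := q) q0 cf cx xE).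
Qed.

Let noise_continuous i :
  {ae P, forall om, {within `[0, +oo[, continuous (fun t => M t om i 0)}}.
Proof.
apply: filterS noiseE => om [cx ME].
have cN : {within `[0, +oo[, continuous (fun t : R =>
    (driver q A B xi (X ^~ om) t - (F t - F 0)) i 0)}.
  apply: continuous_in_subspaceT => t; rewrite inE/= in_itv/= andbT => t0.
  apply: (@cvg_comp _ _ _ (fun t : R => driver q A B xi (X ^~ om) t - (F t - F 0))
    (fun N : 'cV[R]_d => N i 0)); last exact: coord_continuous.
  apply: cvgB; first exact: continuous_driver.
  apply: cvgB; last exact: cvg_cst.
  exact: (continuous_col_prim (continuous_ext_ge0 cf) t0).
apply: subspace_eq_continuous cN => t; rewrite inE/= in_itv/= andbT => t0.
by rewrite /from_subspace/= ME.
Qed.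

Lemma solution_vanishes_of_small_noise :
  (forall phi : R -> 'cV[R]_d, C0_fun phi ->
       forall Z : R -> 'cV[R]_d, pantograph_solution q A B phi Z ->
         Z t @[t --> +oo] --> (0 : 'cV[R]_d)) ->
  (forall theta : R, 0 < theta ->
      col_integral (t - theta) t f @[t --> +oo] --> (0 : 'cV[R]_d)) ->
  (forall (i : 'I_d) (eps : R), 0 < eps -> (S_series Sigma i eps < +oo)%E) ->
  {ae P, forall om : T, X t om @[t --> +oo] --> (0 : 'cV[R]_d)}.
Proof.
move=> stable fsmall Sfin.
have cef : continuous (ext_ge0 f) by exact: continuous_ext_ge0.
have oscM : {ae P, forall om, forall i (e : R), 0 < e -> exists N : R, forall t s : R, N <= t ->
     t - 1 <= s <= t -> `|M t om i 0 - M s om i 0| <= e}.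
  apply: filter_forall => i.
  by apply: (noise_oscillation BM hP cSigma hM) => //; exact: Sfin.
have oscF i (e : R) : 0 < e -> exists N : R, forall t s : R, N <= t ->
     t - 1 <= s <= t -> `|F t i 0 - F s i 0| <= e.
  move=> e0; pose Fe (t : R) := F (Num.max 0 t) i 0.
  have cFe : continuous Fe.
    move=> t; apply: (@cvg_comp _ _ _ (fun t : R => Num.max 0 t) (fun t => F t i 0)).
      exact: continuous_max0.
    have /continuous_colP/(_ i) : {for Num.max 0 t, continuous F}.
      by apply: continuous_col_prim => //; rewrite le_max lexx.
    exact.
  have [|N HN] := uniform_small_increments cFe _ e0.
    move=> th th0; have /cvg_colP/(_ i) h := fsmall th th0.
    apply: cvg_trans; last by rewrite mxE in h; exact: h.
    apply: near_eq_cvg; near=> t.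
    have tth : th <= t by near: t; apply: nbhs_pinfty_ge; exact: num_real.
    have [t0 s0 st] : [/\ 0 <= t, 0 <= t - th & t - th <= t] by split; lra.
    by rewrite (col_integral_prim cf s0 st) /Fe !max_r// /F !mxE.
  exists (Num.max 1 N) => t s; rewrite ge_max => /andP[t1 tN] st.
  have [t0 s0] : 0 <= t /\ 0 <= s by split; have /andP[] := st; lra.
  by have := HN t s tN st; rewrite /Fe !max_r.
apply: filterS2 noiseE oscM => om [cx ME] oscM.
have cex : continuous (ext_ge0 (X ^~ om)) by exact: continuous_ext_ge0.
have : ext_ge0 (X ^~ om) t @[t --> +oo] --> (0 : 'cV[R]_d).
  apply: (pantograph_stable_of_oscillation q0 stable (N := driver q A B xi (X ^~ om)) (xi := xi)) => //.
  - exact: continuous_driver.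
  - by move=> t t0; exact: driverE.
  - move=> e e0; have e2 : 0 < e / 2 by rewrite divr_gt0.
    have [N HN] : exists N, forall i t, N <= t -> forall s : R, t - 1 <= s <= t ->
        `|M t om i 0 - M s om i 0| <= e / 2 /\ `|F t i 0 - F s i 0| <= e / 2.
      apply: common_bound => i; have [N1 H1] := oscM i _ e2; have [N2 H2] := oscF i _ e2.
      exists (Num.max N1 N2) => t; rewrite ge_max => /andP[tN1 tN2] s st.
      by split; [exact: H1|exact: H2].
    exists (Num.max 1 N) => t s i; rewrite ge_max => /andP[t1 tN] st.
    have [h1 h2] := HN i t tN s st.
    have t0 : 0 <= t by lra.
    have s0 : 0 <= s by have /andP[] := st; lra.
    have MEi (u : R) : 0 <= u -> M u om i 0 =
        driver q A B xi (X ^~ om) u i 0 - (F u i 0 - F 0 i 0).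
      by move=> h; rewrite ME//; exact: coordB.
    rewrite (MEi t t0) (MEi s s0) in h1.
    exact: norm_sub_le_shift h1 h2.
apply: cvg_trans; apply: near_eq_cvg; near=> t.
have t0 : 0 <= t by near: t; apply: nbhs_pinfty_ge; exact: num_real.
by rewrite ext_ge0E.
Unshelve. all: by end_near. Qed.

Lemma small_noise_of_solution_vanishes :
  {ae P, forall om : T, X t om @[t --> +oo] --> (0 : 'cV[R]_d)} ->
  (forall theta : R, 0 < theta ->
      col_integral (t - theta) t f @[t --> +oo] --> (0 : 'cV[R]_d)) /\
  (forall (i : 'I_d) (eps : R), 0 < eps -> (S_series Sigma i eps < +oo)%E).
Proof.
move=> X0.
have incr0 : {ae P, forall om, forall theta : R, 0 < theta -> forall (i : 'I_d) (e : R), 0 < e ->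
    exists N : R, forall t, N <= t ->
    `|(F t i 0 - F (t - theta) i 0) + (M t om i 0 - M (t - theta) om i 0)| <= e}.
  apply: filterS2 noiseE X0 => om [cx ME] X0 th th0 i e e0.
  have cex : continuous (ext_ge0 (X ^~ om)) by exact: continuous_ext_ge0.
  have x0 : ext_ge0 (X ^~ om) t @[t --> +oo] --> (0 : 'cV[R]_d).
    apply: cvg_trans X0; apply: near_eq_cvg; near=> t.
    have t0 : 0 <= t by near: t; apply: nbhs_pinfty_ge; exact: num_real.
    by rewrite ext_ge0E.
  have := increments_of_vanishing q0 cex (driverE q A B xi (X ^~ om)) x0 th0.
  move=> /cvgy0P/(_ e e0)[N HN]; exists (Num.max th N) => t.
  rewrite ge_max => /andP[tth tN].
  have t0 : 0 <= t by lra.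
  have s0 : 0 <= t - th by lra.
  apply: le_trans (HN t tN); apply: le_trans (norm_coord_le _ i).
  rewrite le_eqVlt; apply/orP; left; apply/eqP; congr (`| _ |).
  have MEi (s : R) : 0 <= s -> M s om i 0 =
      driver q A B xi (X ^~ om) s i 0 - (F s i 0 - F 0 i 0).
    by move=> h; rewrite ME//; exact: coordB.
  by rewrite coord2 (MEi t t0) (MEi _ s0); exact: increment_cancel.
have means theta : 0 < theta -> forall (i : 'I_d) (e : R), 0 < e -> exists N : R, forall t, N <= t ->
    `|F t i 0 - F (t - theta) i 0| <= e.
  move=> th0 i e e0; apply: contrapT => H.
  have /choice[u Hu] : forall n : nat, exists t : R, n%:R + theta <= t /\ e < `|F t i 0 - F (t - theta) i 0|.
    move=> n; apply: contrapT => Hn; apply: H; exists (n%:R + theta) => t nt.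
    by rewrite leNgt; apply/negP => et; apply: Hn; exists t.
  have u0 n : 0 <= u n - theta by have [h _] := Hu n; have : (0 : R) <= n%:R by []; lra.
  have uu n : u n - theta <= u n by lra.
  have := @vanishing_gaussian_means R dd T P (fun n om => M (u n) om i 0 - M (u n - theta) om i 0)
    (fun n => row_clock Sigma i (u n) - row_clock Sigma i (u n - theta))
    (fun n => F (u n) i 0 - F (u n - theta) i 0) e e0.
  apply.
  - by move=> n; exact: (noise_gaussian_mgf BM hP i cSigma hM).
  - by move=> n; rewrite subr_ge0; exact: row_clock_mono.
  - by move=> n; have [_ /ltW] := Hu n.
  - apply: filterS incr0 => om /(_ theta th0 i) h e' e'0.
    have [N HN] := h e' e'0.
    exists (Num.bound `|N|) => n Nn; apply: HN.
    have [h1 _] := Hu n.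
    have : (Num.bound `|N|)%:R <= n%:R :> R by rewrite ler_nat.
    have := archi_boundP (normr_ge0 N); have := ler_norm N; lra.
split.
  move=> th th0; apply/cvg_colP => i; rewrite mxE; apply/cvgy0P => e e0.
  have [N HN] := means th th0 i e e0.
  exists (Num.max th N) => t; rewrite ge_max => /andP[tth tN].
  rewrite (col_integral_prim cf); [|lra|lra].
  by have := HN t tN; rewrite /F !mxE.
move=> i eps eps0.
pose D n om := M n.+1%:R om i 0 - M n%:R om i 0.
have nn n : (n%:R : R) <= n.+1%:R by rewrite ler_nat.
have gD n : gaussian_mgf P (D n) (clock_block Sigma i n).
  exact: (noise_gaussian_mgf BM hP i cSigma hM).
have D0 : {ae P, forall om, tends0 (fun n => D n om)}.
  apply: filterS incr0 => om /(_ 1 ltr01 i) h e e0.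
  have e2 : 0 < e / 2 by rewrite divr_gt0.
  have [N1 H1] := h _ e2; have [N2 H2] := means 1 ltr01 i _ e2.
  pose N := Num.max N1 N2.
  exists (Num.bound `|N|) => n Nn.
  have NN : N <= n.+1%:R.
    have : (Num.bound `|N|)%:R <= n%:R :> R by rewrite ler_nat.
    by have := archi_boundP (normr_ge0 N); have := ler_norm N; have := nn n; lra.
  move: NN; rewrite ge_max => /andP[n1 n2].
  have nE : n.+1%:R - 1 = n%:R :> R by rewrite mulrSr addrK.
  have := H1 _ n1; have := H2 _ n2; rewrite nE => h2 h1.
  rewrite /D -[X in `|X|](addKr (F n.+1%:R i 0 - F n%:R i 0)).
  apply: le_trans (ler_normD _ _) _; rewrite normrN; lra.
have v0 := clock_block_ge0 i cSigma.
have vto0 : tends0 (clock_block Sigma i).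
  move=> e e0; apply: contrapT => H.
  have /choice[u Hu] : forall n : nat, exists k, (n <= k)%N /\ e < clock_block Sigma i k.
    move=> n; apply: contrapT => Hn; apply: H; exists n => k nk.
    by rewrite ger0_norm// leNgt; apply/negP => ek; apply: Hn; exists k.
  apply: (@vanishing_gaussian_variances R dd T P (fun n => D (u n)) (fun n => clock_block Sigma i (u n)) e e0).
  - by move=> n; exact: gD.
  - by move=> n; have [_ /ltW] := Hu n.
  - apply: filterS D0 => om h e' /h[N HN]; exists N => n Nn; apply: HN.
    by have [nu _] := Hu n; exact: leq_trans nu.
rewrite (S_series_clock i cSigma).
apply: (summable_of_vanishing_blocks eps0 gD v0) => //.
move=> n m a b nm.
wlog lt_nm : n m a b nm / (n < m)%N.
  move=> wl; have [nm'|mn|eq_nm] := ltngtP n m; first exact: wl.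
    have mn' : m != n by rewrite eq_sym.
    have E := wl m n b a mn' mn.
    rewrite (addrC (a ^+ 2 * clock_block Sigma i n)) -E.
    by apply: eq_integral => w _; rewrite (addrC (a * D n w)).
  by rewrite eq_nm eqxx in nm.
apply: (noise_joint_mgf BM hP i cSigma hM) => //.
by rewrite ler_nat.
Unshelve. all: by end_near. Qed.

End solution.

Theorem theorem16 (R : realType) (q : R) (d r : nat)
    (A B : 'M[R]_d) (f : R -> 'cV[R]_d) (Sigma : R -> 'M[R]_(d, r))
    (dd : measure_display) (T : measurableType dd) (P : probability T R)
    (W : R -> T -> 'cV[R]_r) (xi : 'cV[R]_d) (X : R -> T -> 'cV[R]_d)
    (hq0 : 0 < q) (hq1 : q < 1) (hd : (1 <= d)%N) (hr : (1 <= r)%N)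
    (hA : A != 0)
    (hf : continuous_on_ge0 f) (hSigma : continuous_on_ge0 Sigma)
    (hstable : forall phi : R -> 'cV[R]_d, C0_fun phi ->
       forall Z : R -> 'cV[R]_d, pantograph_solution q A B phi Z ->
         Z t @[t --> +oo] --> (0 : 'cV[R]_d))
    (hP : measure_is_complete P)
    (hW : standard_brownian_motion P W)
    (hX : sde_solution P q A B f Sigma W xi X) :
  ((forall theta : R, 0 < theta ->
      col_integral (t - theta) t f @[t --> +oo] --> (0 : 'cV[R]_d)) /\
   (forall (i : 'I_d) (eps : R), 0 < eps -> (S_series Sigma i eps < +oo)%E))
  <->
  {ae P, forall om : T, X t om @[t --> +oo] --> (0 : 'cV[R]_d)}.
Proof.
have [_ cX _ [M [hM XE]]] := hX; split.
  move=> [fsmall Sfin].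
  exact: (solution_vanishes_of_small_noise hq0 hf hSigma hP hW hM cX XE hstable fsmall Sfin).
exact: (small_noise_of_solution_vanishes hq0 hf hSigma hP hW hM cX XE).
Qed.
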